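(* Consider the D1Q3 scheme à la Lax–Wendroff of the context with $\mathscr{C}\in(-1,0)\cup(0,1)$, $s_2,s_3\in(0,2)$ and $s_3\leq s_3^\star(s_2)$. Then, with the classification labels of the context: for $\mathscr{C}<0$: bounce-back MU-L; anti-bounce-back SS; two-steps anti-bounce-back SS; extrapolation with $1\leq\sigma\leq4$ SS; kinetic Dirichlet SS; for $\mathscr{C}>0$: bounce-back SS; anti-bounce-back SS; two-steps anti-bounce-back SS; extrapolation with $1\leq\sigma\leq4$ MU-E; kinetic Dirichlet SS.
   Context: Grid: $x_j=j\Delta x$, $j\in\mathbb{N}$ (ghost point $j=-1$), $\Delta t=\Delta x/\lambda$, $\lambda>0$, Courant number $\mathscr{C}=V/\lambda$. Distribution functions $f_1,f_2,f_3$ with velocities $c_1=0$, $c_2=1$, $c_3=-1$; moments $m_1=f_1+f_2+f_3$, $m_2=f_2-f_3$, $m_3=f_2+f_3$. Relaxation at every $j\in\mathbb{N}$: $m_1^\star=m_1$, $m_2^\star=(1-s_2)m_2+s_2\mathscr{C}m_1$, $m_3^\star=(1-s_3)m_3+s_3\mathscr{C}^2m_1$, then $f^\star$ recovered from $m^\star$. Transport: $f^{n+1}_{1,j}=f^{n\star}_{1,j}$, $f^{n+1}_{2,j}=f^{n\star}_{2,j-1}$, $f^{n+1}_{3,j}=f^{n\star}_{3,j+1}$, $j\in\mathbb{N}$. Zero initial data. Stability threshold: $s_3^\star(s):=1+\frac{\sqrt{(s^2-8s+8)^2+4s^2(2-s)^2}-2s(2-s)}{s^2-8s+8}$ if $s\neq3-2\sqrt2$,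 and $s_3^\star(3-2\sqrt2):=1$. Boundary conditions (source $g^n_{2,-1}$): bounce-back $f^{n\star}_{2,-1}=f^{n\star}_{3,0}+g^n_{2,-1}$; anti-bounce-back $f^{n\star}_{2,-1}=-f^{n\star}_{3,0}+g^n_{2,-1}$; two-steps anti-bounce-back $f^{n\star}_{2,-1}=-f^{n\star}_{1,0}-f^{n\star}_{3,1}+g^n_{2,-1}$; extrapolation of order $\sigma$: $f^{n\star}_{2,-1}=\sum_{j=0}^{\sigma-1}(-1)^j\binom{\sigma}{j+1}f^{n\star}_{2,j}+g^n_{2,-1}$; kinetic Dirichlet $f^{n\star}_{2,-1}=g^n_{2,-1}$. SS estimate: there is $C>0$ such that for all $\alpha>0$, all sources and all $\Delta x>0$: $\frac{\alpha}{1+\alpha\Delta t}\sum_{n,j\in\mathbb{N}}\Delta t\Delta x\,e^{-2\alpha n\Delta t}|m^n_j|^2\leq C\sum_{n}\Delta t\,e^{-2\alpha n\Delta t}(g^n_{2,-1})^2$ ($m^n_j\in\mathbb{R}^3$); SSOO estimate: the same with $(m^n_{1,j})^2$ on the left. Labels: SS = SS estimate holds; SSOO = SSOO holds but SS fails; MU-L/MU-E = neither holds, the instability being produced by a critical mode $(z,\kappa)$ shared by the bulk and boundary schemes (κ the limit of the stable spatial root) with $|z|=1$ and $|\kappa|<1$ (L) or $|\kappa|=1$ (E). *)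

(* Defs.v *)
From Stdlib Require Import Reals.
From Coquelicot Require Import Coquelicot.
Set Implicit Arguments.
Open Scope R_scope.

(** Threshold s_3^*(s), literally as in the context (with Stdlib's convention
    x / 0 = 0 where the denominator s^2-8s+8 vanishes). *)
Definition s3star (s : R) : R :=
  if Req_EM_T s (3 - 2 * sqrt 2) then 1
  else 1 + (sqrt ((s^2 - 8*s + 8)^2 + 4 * s^2 * (2 - s)^2) - 2 * s * (2 - s))
           / (s^2 - 8*s + 8).

Record F3 := mkF3 { c1 : R; c2 : R; c3 : R }.

Definition F3zero : F3 := mkF3 0 0 0.

Definition relax (Cr s2 s3 : R) (f : F3) : F3 :=
  let m1 := c1 f + c2 f + c3 f in
  let m2 := c2 f - c3 f in
  let m3 := c2 f + c3 f in
  let m2s := (1 - s2) * m2 + s2 * Cr * m1 in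
  let m3s := (1 - s3) * m3 + s3 * Cr^2 * m1 in
  mkF3 (m1 - m3s) ((m3s + m2s) / 2) ((m3s - m2s) / 2).

Inductive BC :=
| BounceBack
| AntiBounceBack
| TwoStepsAntiBounceBack
| Extrapolation (sigma : nat)
| KineticDirichlet.

Fixpoint fsum (N : nat) (u : nat -> R) : R :=
  match N with O => 0 | S n => fsum n u + u n end.

(** Value f^{n*}_{2,-1} at the ghost point, given post-collision data fs
    (fs j = f^{n*}_j, j in N) and the source g = g^n_{2,-1}. *)
Definition ghost (b : BC) (fs : nat -> F3) (g : R) : R :=
  match b with
  | BounceBack => c3 (fs O) + g
  | AntiBounceBack => - c3 (fs O) + g
  | TwoStepsAntiBounceBack => - c1 (fs O) - c3 (fs 1%nat) + g
  | Extrapolation sigma =>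
      fsum sigma (fun j => (-1)^j * Binomial.C sigma (S j) * c2 (fs j)) + g
  | KineticDirichlet => g
  end.

Definition step (Cr s2 s3 : R) (b : BC) (f : nat -> F3) (g : R) : nat -> F3 :=
  fun j =>
    let fs := fun i => relax Cr s2 s3 (f i) in
    mkF3 (c1 (fs j))
         (match j with O => ghost b fs g | S j' => c2 (fs j') end)
         (c3 (fs (S j))).

Fixpoint traj (Cr s2 s3 : R) (b : BC) (g : nat -> R) (n : nat) : nat -> F3 :=
  match n with
  | O => fun _ => F3zero
  | S n' => step Cr s2 s3 b (traj Cr s2 s3 b g n') (g n')
  end.

Definition mom1 (f : F3) : R := c1 f + c2 f + c3 f.
Definition mom2 (f : F3) : R := c2 f - c3 f.
Definition mom3 (f : F3) : R := c2 f + c3 f.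
Definition momnorm2 (f : F3) : R := (mom1 f)^2 + (mom2 f)^2 + (mom3 f)^2.

(** Sums of non-negative series in [0, +oo]. *)
Definition nnsum (u : nat -> R) : Rbar := Lim_seq (fun N => fsum N u).
Definition nnsum2 (u : nat -> nat -> R) : Rbar :=
  Lim_seq (fun N => fsum N (fun n => fsum N (fun j => u n j))).

Definition estimate (q : F3 -> R) (lam Cr s2 s3 : R) (b : BC) : Prop :=
  exists K : R, 0 < K /\
    forall (alpha : R) (g : nat -> R) (dx : R), 0 < alpha -> 0 < dx ->
      let dt := dx / lam in
      Rbar_le
        (Rbar_mult (Finite (alpha / (1 + alpha * dt)))
           (nnsum2 (fun n j => dt * dx * exp (-2 * alpha * INR n * dt)
                                 * q (traj Cr s2 s3 b g n j))))
        (Rbar_mult (Finite K)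
           (nnsum (fun n => dt * exp (-2 * alpha * INR n * dt) * (g n)^2))).

Definition SS_estimate := estimate momnorm2.
Definition SSOO_estimate := estimate (fun f => (mom1 f)^2).

(** ---- Normal modes f^n_j = z^n kappa^j phi (complex) ---- *)
Open Scope C_scope.

Record CF3 := mkCF3 { d1 : C; d2 : C; d3 : C }.

Definition relaxC (Cr s2 s3 : R) (f : CF3) : CF3 :=
  let m1 := d1 f + d2 f + d3 f in
  let m2 := d2 f - d3 f in
  let m3 := d2 f + d3 f in
  let m2s := RtoC (1 - s2) * m2 + RtoC (s2 * Cr) * m1 in
  let m3s := RtoC (1 - s3) * m3 + RtoC (s3 * Cr^2) * m1 in
  mkCF3 (m1 - m3s) ((m3s + m2s) / RtoC 2) ((m3s - m2s) / RtoC 2).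

Fixpoint Cpow (x : C) (n : nat) : C :=
  match n with O => RtoC 1 | S n' => Cpow x n' * x end.

Fixpoint Csum (N : nat) (u : nat -> C) : C :=
  match N with O => RtoC 0 | S n => Csum n u + u n end.

(** phi is a (nonzero) eigenmode of the bulk scheme for (z, kappa):
    z phi_1 = (A phi)_1, z kappa phi_2 = (A phi)_2, z phi_3 = kappa (A phi)_3
    (kappa times the bulk relation, i.e. the dispersion relation
     kappa * det(z I - diag(1, 1/kappa, kappa) A) = 0 in polynomial form). *)
Definition bulk_mode (Cr s2 s3 : R) (z kappa : C) (phi : CF3) : Prop :=
  phi <> mkCF3 (RtoC 0) (RtoC 0) (RtoC 0) /\
  let a := relaxC Cr s2 s3 phi in
  z * d1 phi = d1 a /\ z * kappa * d2 phi = d2 a /\ z * d3 phi = kappa * d3 a.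

Definition bulk_root (Cr s2 s3 : R) (z kappa : C) : Prop :=
  exists phi, bulk_mode Cr s2 s3 z kappa phi.

(** Ghost value for the mode (source g = 0): post-collision data a * kappa^j. *)
Definition ghostC (b : BC) (kappa : C) (a : CF3) : C :=
  match b with
  | BounceBack => d3 a
  | AntiBounceBack => - d3 a
  | TwoStepsAntiBounceBack => - d1 a - kappa * d3 a
  | Extrapolation sigma =>
      Csum sigma (fun j => RtoC ((-1)^j * Binomial.C sigma (S j)) * Cpow kappa j * d2 a)
  | KineticDirichlet => RtoC 0
  end.

Definition boundary_mode (Cr s2 s3 : R) (b : BC) (z kappa : C) : Prop :=
  exists phi, bulk_mode Cr s2 s3 z kappa phi /\
    z * d2 phi = ghostC b kappa (relaxC Cr s2 s3 phi).

Definition stable_root_limit (Cr s2 s3 : R) (z kappa : C) : Prop :=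
  forall eps : R, 0 < eps -> exists delta : R, 0 < delta /\
    forall z' : C, 1 < Cmod z' -> Cmod (z' - z) < delta ->
      (exists kappa', Cmod kappa' < 1 /\ bulk_root Cr s2 s3 z' kappa') /\
      (forall kappa', Cmod kappa' < 1 -> bulk_root Cr s2 s3 z' kappa' ->
                      Cmod (kappa' - kappa) < eps).

Close Scope C_scope.

Definition label_SS (lam Cr s2 s3 : R) (b : BC) : Prop :=
  SS_estimate lam Cr s2 s3 b.

Definition label_SSOO (lam Cr s2 s3 : R) (b : BC) : Prop :=
  SSOO_estimate lam Cr s2 s3 b /\ ~ SS_estimate lam Cr s2 s3 b.

Definition critical_mode (Cr s2 s3 : R) (b : BC) (z kappa : C) : Prop :=
  Cmod z = 1 /\ stable_root_limit Cr s2 s3 z kappa /\ boundary_mode Cr s2 s3 b z kappa.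

Definition label_MU_L (lam Cr s2 s3 : R) (b : BC) : Prop :=
  ~ SS_estimate lam Cr s2 s3 b /\ ~ SSOO_estimate lam Cr s2 s3 b /\
  exists z kappa, critical_mode Cr s2 s3 b z kappa /\ Cmod kappa < 1.

Definition label_MU_E (lam Cr s2 s3 : R) (b : BC) : Prop :=
  ~ SS_estimate lam Cr s2 s3 b /\ ~ SSOO_estimate lam Cr s2 s3 b /\
  exists z kappa, critical_mode Cr s2 s3 b z kappa /\ Cmod kappa = 1.

(* Main.v *)
(** Putting w = 1/z, the bulk relation is a quadratic in kappa. In the variables
    (z - 1) / (z + 1) and (kappa - 1) / (kappa + 1) its restriction to |kappa| = 1 is a cubic
    whose Bezoutian is positive definite under the threshold on s3, so that (1, 1) is the only
    root with |z| >= 1; by connectedness exactly one root kappa is then stable for |z| > 1.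
    The boundary residual on a stable mode is explicit in each case: it is the mass for the
    two-steps condition, (1 - kappa)^sigma times the incoming population for extrapolation,
    and (1 - kappa) times it is (1 - w) times the mass for bounce-back. A compactness argument
    turns its non-vanishing into a uniform lower bound.

    A partial sum of w^n f^n solves the resolvent equation up to the term w^N f^N, and
    subtracting the stable mode leaves a quantity governed by the outer root only. Parseval at
    the nodes of a circle |w| = r converts the resulting bound into an inequality for
    S_N = sum_(n < N) r^(2n) |f^n|^2, namely S_N <= B + C (S_(N+1) - S_N). Hence S stays below
    B unless it grows geometrically at a definite rate, and this bounds it for all r < 1 by
    continuation from small r. In the unstable cases a constant source is tested at real z
    tending to 1, where the mass transform in the first cell is too large for the estimate. *)

From Stdlib Require Import Reals Lra Lia Psatz List ClassicalEpsilon Classical.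
From Coquelicot Require Import Coquelicot.
Require Import Defs.
Open Scope R_scope.

(** * Von Neumann stability of the cubic *)

(** The obstacle is that nothing is known beforehand about the growth of a trajectory, so its
    z-transform cannot be assumed to converge for |w| near 1. Finite sums are pure algebra, at the
    price of an end term whose constant C may blow up as r tends to 1. This is harmless: C fixes
    only the growth rate to be excluded and is absent from the conclusion S_N <= B. Hence only the
    constants of the boundary term must be uniform up to |w| = 1. That term carries a single factor
    1 / (1 - |kappa|), which is at worst of order 1 / (1 - |w|) because dkappa / dw = 1 / Cr at (1,
    1); the weight alpha / (1 + alpha dt) of the estimate compensates exactly this loss. The sign of
    Cr decides whether the root through (1, 1) is the stable one, and this separates the labels. For
    Cr > 0 the stable root reaches 1, where the extrapolation residual degenerates. For Cr < 0 it
    stays inside the disc, and bounce-back degenerates at w = 1 because it lets no mass through. In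
    the unstable cases the estimate allows a first-cell transform of order (1 - r)^(-3/2), whereas
    the degenerate residual forces (1 - r)^(-2). *)

Lemma s3star_henon (s2 s3 : R) :
  0 < s2 < 2 -> 0 < s3 < 2 -> s3 <= s3star s2 ->
  let A := (2 - s2) / s2 in
  let B := (2 - s3) / s3 in
  0 < A /\ 0 < B /\ A + B <= A * B * (2 * A + B).
Proof.
  intros H2 H3 Hs A B.
  assert (HA : 0 < A) by (apply Rdiv_lt_0_compat; lra).
  assert (HB : 0 < B) by (apply Rdiv_lt_0_compat; lra).
  split; [exact HA | split; [exact HB |]].
  assert (E2 : s2 = 2 / (1 + A)) by (unfold A; field; lra).
  assert (E3 : s3 = 2 / (1 + B)) by (unfold B; field; lra).
  set (D := s2 ^ 2 - 8 * s2 + 8) in *.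
  set (E := 2 * s2 * (2 - s2)).
  assert (HE : 0 < E) by (unfold E; nra).
  assert (ED : D = 4 * (2 * A ^ 2 - 1) / (1 + A) ^ 2)
    by (unfold D; rewrite E2; field; lra).
  assert (EE : E = 8 * A / (1 + A) ^ 2) by (unfold E; rewrite E2; field; lra).
  (* [s3star s2 - 1] is the root [(sqrt (D ^ 2 + E ^ 2) - E) / D] of [D q ^ 2 + 2 E q - D]. At
     [q = s3 - 1] this quadratic equals [A + B - A B (2 A + B)] up to the positive factor
     [16 / ((1 + A) ^ 2 (1 + B) ^ 2)]. *)
  assert (key : D * (s3 - 1) ^ 2 + 2 * E * (s3 - 1) - D <= 0 ->
                A + B <= A * B * (2 * A + B)).
  { intros K. rewrite ED, EE, E3 in K.
    replace (4 * (2 * A ^ 2 - 1) / (1 + A) ^ 2 * (2 / (1 + B) - 1) ^ 2 +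
             2 * (8 * A / (1 + A) ^ 2) * (2 / (1 + B) - 1) -
             4 * (2 * A ^ 2 - 1) / (1 + A) ^ 2)
      with ((A + B - A * B * (2 * A + B)) * (16 / ((1 + A) ^ 2 * (1 + B) ^ 2)))
      in K by (field; lra).
    assert (0 < 16 / ((1 + A) ^ 2 * (1 + B) ^ 2))
      by (apply Rdiv_lt_0_compat; [lra | apply Rmult_lt_0_compat; apply pow_lt; lra]).
    nra. }
  revert Hs; unfold s3star.
  destruct (Req_EM_T s2 (3 - 2 * sqrt 2)) as [e | ne].
  (* At the exceptional value both [A] and [B] are at least 1, and then [A B >= 1] is enough. *)
  - intros Hs.
    assert (HB1 : 1 <= B).
    { apply Rmult_le_reg_r with s3; [lra|].
      replace (B * s3) with (2 - s3) by (unfold B; field; lra). lra. }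
    assert (HA1 : 1 <= A).
    { apply Rmult_le_reg_r with s2; [lra|].
      replace (A * s2) with (2 - s2) by (unfold A; field; lra).
      assert (1 <= sqrt 2) by (rewrite <- sqrt_1; apply sqrt_le_1; lra). lra. }
    clear -HA1 HB1. assert (1 <= A * B) by nra. nra.
  - fold D. intros Hs.
    destruct (Req_dec D 0) as [D0 | D0].
    (* [D] vanishes at [s2 = 4 - 2 sqrt 2]. There the convention [x / 0 = 0] makes the threshold 1,
       in agreement with the limit of the formula as [D] tends to 0. *)
    + assert (s3 <= 1).
      { rewrite D0 in Hs. unfold Rdiv in Hs. rewrite Rinv_0 in Hs. lra. }
      apply key. rewrite D0. nra.
    + apply key.
      set (r := sqrt (D ^ 2 + 4 * s2 ^ 2 * (2 - s2) ^ 2)) in *.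
      assert (Hr : r * r = D ^ 2 + E ^ 2).
      { unfold r; rewrite sqrt_sqrt; [unfold E; ring |].
        replace (4 * s2 ^ 2 * (2 - s2) ^ 2) with (E ^ 2) by (unfold E; ring).
        apply Rplus_le_le_0_compat; apply pow2_ge_0. }
      assert (Hr0 : 0 <= r) by apply sqrt_pos.
      fold E in Hs.
      set (e0 := (r - E) / D) in *.
      assert (He0 : D * e0 = r - E) by (unfold e0; field; exact D0).
      assert (HrE : E < r) by nra.
      assert (Hle : s3 - 1 <= e0) by lra.
      assert (-1 < s3 - 1 < 1) by lra.
      set (q := s3 - 1) in *.
      (* Completing the square reduces the claim to comparing [D q + E] with [r] and [- r]. The sign
         of [D] decides the side; for [D > 0] the lower comparison uses [q > -1]. *)
      assert (HID : D * (D * q ^ 2 + 2 * E * q - D) = (D * q + E) ^ 2 - r * r)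
        by (rewrite Hr; ring).
      destruct (Rtotal_order D 0) as [Dn | [?|Dp]]; [|lra|].
      * assert (r - E <= D * q) by nra.
        assert (0 <= (D * q + E) ^ 2 - r * r) by nra.
        nra.
      * assert (D * q + E <= r) by nra.
        assert (- r <= D * q + E).
        { assert (D - E <= r) by nra. nra. }
        assert ((D * q + E) ^ 2 - r * r <= 0) by nra.
        nra.
Qed.

(** Sylvester's criterion by completing squares without division: [r] is eliminated first and [p]
    next, which uses the two minors that are easiest to sign in the application. *)
Lemma quadratic_form3_pos (m00 m01 m02 m11 m12 m22 p q r : R) :
  0 < m22 -> 0 < m00 * m22 - m02 ^ 2 ->
  0 < m00 * (m11 * m22 - m12 ^ 2) - m01 * (m01 * m22 - m12 * m02)
      + m02 * (m01 * m12 - m11 * m02) ->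
  0 <= m00 * p ^ 2 + m11 * q ^ 2 + m22 * r ^ 2
      + 2 * (m01 * p * q + m02 * p * r + m12 * q * r)
  /\ (p <> 0 -> 0 < m00 * p ^ 2 + m11 * q ^ 2 + m22 * r ^ 2
      + 2 * (m01 * p * q + m02 * p * r + m12 * q * r)).
Proof.
  intros H1 H2 H3.
  set (F := m00 * p ^ 2 + m11 * q ^ 2 + m22 * r ^ 2
      + 2 * (m01 * p * q + m02 * p * r + m12 * q * r)).
  set (dt := m00 * (m11 * m22 - m12 ^ 2) - m01 * (m01 * m22 - m12 * m02)
      + m02 * (m01 * m12 - m11 * m02)) in *.
  set (n := m00 * m22 - m02 ^ 2) in *.
  set (k := m01 * m22 - m02 * m12).
  assert (I : m22 * n * F = n * (m22 * r + m02 * p + m12 * q) ^ 2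
                           + (n * p + k * q) ^ 2 + m22 * dt * q ^ 2)
    by (unfold F, n, k, dt; ring).
  assert (P : 0 < m22 * n) by (apply Rmult_lt_0_compat; assumption).
  assert (P2 : 0 < m22 * dt) by (apply Rmult_lt_0_compat; assumption).
  assert (N1 : 0 <= n * (m22 * r + m02 * p + m12 * q) ^ 2)
    by (apply Rmult_le_pos; [lra | apply pow2_ge_0]).
  assert (N2 : 0 <= (n * p + k * q) ^ 2) by apply pow2_ge_0.
  assert (N3 : 0 <= m22 * dt * q ^ 2)
    by (apply Rmult_le_pos; [lra | apply pow2_ge_0]).
  split.
  - apply Rmult_le_reg_l with (m22 * n); [exact P|]. rewrite Rmult_0_r. lra.
  - intros Hp. apply Rmult_lt_reg_l with (m22 * n); [exact P|]. rewrite Rmult_0_r, I.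
    destruct (Req_dec q 0) as [-> | Hq].
    + assert (0 < (n * p + k * 0) ^ 2).
      { replace (n * p + k * 0) with (n * p) by ring.
        apply pow2_gt_0. apply Rmult_integral_contrapositive; lra. }
      lra.
    + assert (0 < m22 * dt * q ^ 2)
        by (apply Rmult_lt_0_compat; [lra | apply pow2_gt_0; exact Hq]).
      lra.
Qed.

Section Hurwitz.
Variables A B e H : R.
Let a := A * B + H - e ^ 2.
Let b := (A + B) * (1 + H) - A * e ^ 2.
Let g := A * B * H + 1 + e ^ 2.

(* Real and imaginary parts of the dispersion relation at tau = (z - 1) / (z + 1) = x + i y and
   kappa = (1 + i eta) / (1 - i eta), with e = Cr eta, H = eta^2 and the parameters
   A = 2 / s2 - 1, B = 2 / s3 - 1, in which the threshold reads A + B <= A B (2 A + B). *)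
Definition cubic_re (x y : R) : R :=
  (A * B + H - e ^ 2) * (x ^ 3 - 3 * x * y ^ 2) + e * B * (3 * x ^ 2 * y - y ^ 3)
  + ((A + B) * (1 + H) - A * e ^ 2) * (x ^ 2 - y ^ 2) + e * (2 * x * y)
  + (A * B * H + 1 + e ^ 2) * x - e * B * y + e ^ 2 * A.

Definition cubic_im (x y : R) : R :=
  (A * B + H - e ^ 2) * (3 * x ^ 2 * y - y ^ 3) - e * B * (x ^ 3 - 3 * x * y ^ 2)
  + ((A + B) * (1 + H) - A * e ^ 2) * (2 * x * y) - e * (x ^ 2 - y ^ 2)
  + (A * B * H + 1 + e ^ 2) * y + e * B * x + e.

Let m00 := B + A * g.
Let m01 := (A + B) * (1 + H).
Let m02 := e * (B - A * a).
Let m11 := b * g - e ^ 2 * A * a.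
Let m12 := e * B * (g + a).
Let m22 := e ^ 2 * B + a * b.
Let form (p q r : R) := m00 * p ^ 2 + m11 * q ^ 2 + m22 * r ^ 2
      + 2 * (m01 * p * q + m02 * p * r + m12 * q * r).

Let bez (x y : R) := form e y (y ^ 2 - x ^ 2) + form 0 (- x) (- 2 * x * y).

(** Hermite's root criterion. With [s = y - i x = - i tau], [bez] is the Bezoutian form at the
    vector [(e, s, s ^ 2)], real and imaginary parts separated, so a root with [x > 0] makes it
    nonpositive. The first coordinate is [e] rather than 1 because a factor [e] has been taken out
    of the Bezoutian. *)
Lemma bezoutian_identity (x y : R) :
  cubic_re x y ^ 2 + cubic_im x y ^ 2
    - cubic_re (- x) y ^ 2 - cubic_im (- x) y ^ 2 = 4 * x * bez x y.
Proof.
  unfold cubic_re, cubic_im, bez, form, m00, m01, m02, m11, m12, m22, a, b, g. ring.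
Qed.

(* On the imaginary axis the Bezoutian is the Wronskian of real and imaginary parts. *)
Lemma bezoutian_axis (y : R) :
  cubic_re 0 y = 0 -> cubic_im 0 y = 0 -> bez 0 y = 0.
Proof.
  intros HR HI.
  replace (bez 0 y) with
    (cubic_re 0 y *
       (- 3 * (A * B + H - e ^ 2) * y ^ 2 + 2 * e * y + (A * B * H + 1 + e ^ 2))
     + cubic_im 0 y * (3 * e * B * y ^ 2 + 2 * ((A + B) * (1 + H) - A * e ^ 2) * y + e * B)).
  - rewrite HR, HI; ring.
  - unfold cubic_re, cubic_im, bez, form, m00, m01, m02, m11, m12, m22, a, b, g. ring.
Qed.

Lemma cubic_no_root_right_half_plane (c x y : R) :
  0 < A -> 0 < B -> A + B <= A * B * (2 * A + B) ->
  0 < H -> 0 < c < 1 -> e ^ 2 = c * H ->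
  0 <= x -> cubic_re x y = 0 -> cubic_im x y = 0 -> False.
Proof.
  intros HA HB Hstar HH Hc He Hx HR HI.
  assert (Hbez : bez x y <= 0).
  { destruct (Req_dec x 0) as [-> | Hx0].
    - rewrite (bezoutian_axis _ HR HI); lra.
    - pose proof (bezoutian_identity x y) as I. rewrite HR, HI in I.
      pose proof (pow2_ge_0 (cubic_re (- x) y)).
      pose proof (pow2_ge_0 (cubic_im (- x) y)). nra. }
  assert (He0 : e <> 0) by (intros ->; nra).
  set (T := A * B * (2 * A + B) - (A + B)).
  assert (HT : 0 <= T) by (unfold T; lra).
  assert (HAB : 0 < A * B) by (apply Rmult_lt_0_compat; assumption).
  (* This gives a sign to the term [4 (A B) - 1] of [K1] below. *)
  assert (HAB2 : 1 <= 2 * (A * B)).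
  { apply Rmult_le_reg_r with (2 * A + B); [lra|]. nra. }
  assert (Pa : 0 < a) by (unfold a; rewrite He; nra).
  assert (Pb : 0 < b).
  { unfold b; rewrite He.
    replace ((A + B) * (1 + H) - A * (c * H))
      with (A + B + B * H + A * H * (1 - c)) by ring.
    assert (0 < B * H) by (apply Rmult_lt_0_compat; assumption).
    assert (0 < A * H * (1 - c)) by (repeat apply Rmult_lt_0_compat; lra). lra. }
  assert (P22 : 0 < m22).
  { unfold m22. assert (0 < a * b) by (apply Rmult_lt_0_compat; assumption).
    assert (0 <= e ^ 2 * B) by (apply Rmult_le_pos; [apply pow2_ge_0 | lra]). lra. }
  assert (P20 : 0 < m00 * m22 - m02 ^ 2).
  { set (c' := 1 - c).
    replace (m00 * m22 - m02 ^ 2) with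
      ((1 + H) * (A * B ^ 3 + B ^ 2 * H * c' + A * B * H * (1 + c') + A * B * H ^ 2 * c * c'
        + A ^ 2 * H * c' + 2 * A ^ 2 * B ^ 2 + 2 * A ^ 2 * B ^ 2 * H * c
        + A ^ 2 * B ^ 2 * H ^ 2 * c' + A ^ 3 * B + A ^ 3 * B * H ^ 2 * c' ^ 2
        + A ^ 3 * B ^ 3 * H + A ^ 4 * B ^ 2 * H * c')).
    2:{ unfold m00, m22, m02, a, b, g.
        replace ((e * (B - A * (A * B + H - e ^ 2))) ^ 2)
          with (e ^ 2 * (B - A * (A * B + H - e ^ 2)) ^ 2) by ring.
        rewrite He; unfold c'; ring. }
    assert (0 < c') by (unfold c'; lra). destruct Hc as [Hc _].
    apply Rmult_lt_0_compat; [lra|].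
    repeat apply Rplus_lt_0_compat;
      repeat (apply Rmult_lt_0_compat || apply pow_lt); lra. }
  assert (Pdet : 0 < m00 * (m11 * m22 - m12 ^ 2) - m01 * (m01 * m22 - m12 * m02)
      + m02 * (m01 * m12 - m11 * m02)).
  (* The lowest power of [H] carries the slack [T]: the threshold is the condition at small wave
     numbers. When [T = 0], strict positivity still comes from [H ^ 2 * K2]. *)
  { set (K1 := (1 - c) * ((A + B) ^ 2 * T + A ^ 4 * B ^ 5 + 2 * A ^ 5 * B ^ 4 + A ^ 6 * B ^ 3)
       + c * (A * B * (T + B ^ 3
            + A ^ 2 * B * (B * T + 2 * B ^ 2 + (4 * (A * B) - 1))))).
    set (K2 := A * B ^ 2 * c ^ 2 + 2 * A ^ 2 * B ^ 3 * c + 2 * A ^ 3 * B ^ 2 * c * (1 - c)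
       + A ^ 3 * B ^ 4 + 2 * A ^ 4 * B ^ 3 * (1 - c) + A ^ 5 * B ^ 2 * (1 - c) ^ 2).
    replace (m00 * (m11 * m22 - m12 ^ 2) - m01 * (m01 * m22 - m12 * m02)
      + m02 * (m01 * m12 - m11 * m02)) with
      (H * (1 - c) * (1 + H) ^ 2 * (A * B * (A + B) ^ 2 * T + H * K1 + H ^ 2 * K2)).
    2:{ unfold m00, m01, m12, m11, m22, m02.
        replace ((e * B * (g + a)) ^ 2) with (e ^ 2 * (B * (g + a)) ^ 2) by ring.
        replace (e * B * (g + a) * (e * (B - A * a)))
          with (e ^ 2 * (B * (g + a) * (B - A * a))) by ring.
        set (q0 := (A + B) * (1 + H)).
        replace (e * (B - A * a) * (q0 * (e * B * (g + a))
              - (b * g - e ^ 2 * A * a) * (e * (B - A * a))))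
          with (e ^ 2 * ((B - A * a) * (q0 * (B * (g + a))
              - (b * g - e ^ 2 * A * a) * (B - A * a)))) by ring.
        unfold q0, a, b, g. rewrite He. unfold K1, K2, T. ring. }
    assert (0 <= K1).
    { unfold K1. destruct Hc.
      assert (0 <= (A + B) ^ 2 * T) by (apply Rmult_le_pos; [apply pow2_ge_0 | lra]).
      assert (0 <= B * T) by (apply Rmult_le_pos; lra).
      assert (0 < A ^ 4 * B ^ 5) by (repeat (apply Rmult_lt_0_compat || apply pow_lt); lra).
      assert (0 < 2 * A ^ 5 * B ^ 4) by (repeat (apply Rmult_lt_0_compat || apply pow_lt); lra).
      assert (0 < A ^ 6 * B ^ 3) by (repeat (apply Rmult_lt_0_compat || apply pow_lt); lra).
      assert (0 < B ^ 3) by (apply pow_lt; lra).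
      apply Rplus_le_le_0_compat; [apply Rmult_le_pos; lra|].
      apply Rmult_le_pos; [lra|]. apply Rmult_le_pos; [lra|].
      apply Rplus_le_le_0_compat; [lra|].
      apply Rmult_le_pos; [apply Rmult_le_pos; [apply pow2_ge_0 | lra]|].
      pose proof (pow2_ge_0 B). lra. }
    assert (0 < K2).
    { unfold K2. destruct Hc.
      repeat apply Rplus_lt_0_compat;
        repeat (apply Rmult_lt_0_compat || apply pow_lt); lra. }
    destruct Hc.
    apply Rmult_lt_0_compat.
    - repeat (apply Rmult_lt_0_compat || apply pow_lt); lra.
    - apply Rplus_le_lt_0_compat.
      + apply Rplus_le_le_0_compat; repeat apply Rmult_le_pos; try lra; apply pow2_ge_0.
      + apply Rmult_lt_0_compat; [apply pow_lt|]; lra. }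
  destruct (quadratic_form3_pos m00 m01 m02 m11 m12 m22 e y (y ^ 2 - x ^ 2) P22 P20 Pdet)
    as [_ Q1].
  destruct (quadratic_form3_pos m00 m01 m02 m11 m12 m22 0 (- x) (- 2 * x * y) P22 P20 Pdet)
    as [Q2 _].
  specialize (Q1 He0). unfold bez, form in Hbez. lra.
Qed.
End Hurwitz.

Lemma RtoC_C_re_im (z : C) : z = (Re z, Im z).
Proof. destruct z; reflexivity. Qed.

Lemma Cmod_sqr (z : C) : Cmod z ^ 2 = Re z ^ 2 + Im z ^ 2.
Proof. apply Cmod2_alt. Qed.

Lemma Cmod_lt_1_iff (z : C) : Cmod z < 1 <-> Re z ^ 2 + Im z ^ 2 < 1.
Proof.
  rewrite <- Cmod_sqr. pose proof (Cmod_ge_0 z). split; intros; nra.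
Qed.

Lemma Cmod_le_1_iff (z : C) : Cmod z <= 1 <-> Re z ^ 2 + Im z ^ 2 <= 1.
Proof.
  rewrite <- Cmod_sqr. pose proof (Cmod_ge_0 z). split; intros; nra.
Qed.

Lemma Cmod_eq_1_sqr (z : C) : Cmod z = 1 -> Re z ^ 2 + Im z ^ 2 = 1.
Proof. rewrite <- Cmod_sqr. intros ->. ring. Qed.

Lemma Cmult_eq_0 (x y : C) : (x * y)%C = 0 -> x = 0 \/ y = 0.
Proof.
  intros H. destruct (Ceq_dec x 0) as [|Hx]; [now left | right].
  apply Cmod_eq_0. apply (f_equal Cmod) in H. rewrite Cmod_mult, Cmod_0 in H.
  apply Cmod_gt_0 in Hx. apply Rmult_integral in H. destruct H; lra.
Qed.

Lemma Cmod_1_sub_neq_0 (x : C) : Cmod x < 1 -> (1 - x)%C <> 0.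
Proof.
  intros H E. apply Ceq_minus in E. rewrite <- E, Cmod_1 in H. lra.
Qed.

(** A non-real root comes with its conjugate, which forces [q |w| ^ 2 = 1]. For a real root the
    value is bounded below through [(1 - |w|) (1 - q |w|) >= 0]. *)
Lemma jury_quadratic (p q : R) (w : C) :
  Rabs q < 1 -> Rabs p < 1 + q -> Cmod w <= 1 ->
  (1 + RtoC p * w + RtoC q * w * w)%C <> 0.
Proof.
  intros Hq Hp Hw E. apply Cmod_le_1_iff in Hw.
  apply Rabs_def2 in Hq. apply Rabs_def2 in Hp.
  destruct w as [a b]. simpl in Hw.
  pose proof (f_equal Re E) as E1. pose proof (f_equal Im E) as E2.
  simpl in E1, E2. clear E.
  ring_simplify in E1. ring_simplify in E2.
  assert (Hb : b * (p + 2 * q * a) = 0) by lra.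
  apply Rmult_integral in Hb. destruct Hb as [-> | Hb].
  - assert (-1 <= a <= 1) by nra.
    assert (E1' : 1 + p * a + q * (a * a) = 0) by (rewrite <- E1; ring).
    destruct (Rlt_le_dec 0 a) as [Ha | Ha].
    + assert (0 <= (1 - a) * (1 - q * a)) by (apply Rmult_le_pos; nra).
      assert (0 < (p + (1 + q)) * a) by (apply Rmult_lt_0_compat; lra). lra.
    + assert (0 <= (1 + a) * (1 + q * a)) by (apply Rmult_le_pos; nra).
      destruct (Req_dec a 0) as [a0 | a0]; [rewrite a0 in E1'; lra|].
      assert (0 < (1 + q - p) * - a) by (apply Rmult_lt_0_compat; lra). lra.
  - assert (Hp' : p = - (2 * q * a)) by lra. rewrite Hp' in E1.
    assert (Hqq : q * (a ^ 2 + b ^ 2) = 1).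
    { replace 1 with (1 - 0) by ring. rewrite <- E1. ring. }
    nra.
Qed.

(** * Sequential compactness *)

Lemma choice_sequence {A : Type} (P : nat -> A -> Prop) :
  (forall n, exists x, P n x) -> exists u, forall n, P n (u n).
Proof.
  intros H. exists (fun n => proj1_sig (constructive_indefinite_description _ (H n))).
  intros n. destruct (constructive_indefinite_description _ (H n)). assumption.
Qed.

Lemma inv_INR_pos (n : nat) : 0 < / (INR n + 1).
Proof. apply Rinv_0_lt_compat. pose proof (pos_INR n). lra. Qed.

Lemma is_lim_seq_inv_INR : is_lim_seq (fun n => / (INR n + 1)) 0.
Proof.
  apply (is_lim_seq_inv _ p_infty); [|discriminate].
  apply is_lim_seq_plus with p_infty 1;
    [apply is_lim_seq_INR | apply is_lim_seq_const | reflexivity].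
Qed.

Definition Clim (u : nat -> C) (l : C) : Prop :=
  is_lim_seq (fun n => Re (u n)) (Re l) /\ is_lim_seq (fun n => Im (u n)) (Im l).

Lemma Clim_const (l : C) : Clim (fun _ => l) l.
Proof. split; apply is_lim_seq_const. Qed.

Lemma Clim_plus (u v : nat -> C) (l m : C) :
  Clim u l -> Clim v m -> Clim (fun n => u n + v n)%C (l + m)%C.
Proof.
  intros [U1 U2] [V1 V2]; split; simpl;
  [apply (is_lim_seq_plus' _ _ _ _ U1 V1) | apply (is_lim_seq_plus' _ _ _ _ U2 V2)].
Qed.

Lemma Clim_mult (u v : nat -> C) (l m : C) :
  Clim u l -> Clim v m -> Clim (fun n => u n * v n)%C (l * m)%C.
Proof.
  intros [U1 U2] [V1 V2]; split; simpl.
  - apply (is_lim_seq_minus' _ _ _ _ (is_lim_seq_mult' _ _ _ _ U1 V1) (is_lim_seq_mult' _ _ _ _ U2 V2)).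
  - apply (is_lim_seq_plus' _ _ _ _ (is_lim_seq_mult' _ _ _ _ U1 V2) (is_lim_seq_mult' _ _ _ _ U2 V1)).
Qed.

Lemma Clim_opp (u : nat -> C) (l : C) : Clim u l -> Clim (fun n => - u n)%C (- l)%C.
Proof.
  intros [U1 U2]; split; simpl;
  [apply (proj1 (is_lim_seq_opp _ _) U1) | apply (proj1 (is_lim_seq_opp _ _) U2)].
Qed.

Lemma Clim_minus (u v : nat -> C) (l m : C) :
  Clim u l -> Clim v m -> Clim (fun n => u n - v n)%C (l - m)%C.
Proof. intros U V. apply Clim_plus; [exact U | apply Clim_opp, V]. Qed.

Lemma Clim_Cmod (u : nat -> C) (l : C) :
  Clim u l -> is_lim_seq (fun n => Cmod (u n)) (Cmod l).
Proof.
  intros [U1 U2]. unfold Cmod.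
  apply (is_lim_seq_continuous sqrt (fun n => Re (u n) ^ 2 + Im (u n) ^ 2)).
  - apply continuity_pt_sqrt. pose proof (pow2_ge_0 (fst l)). pose proof (pow2_ge_0 (snd l)). lra.
  - apply is_lim_seq_plus'; simpl; apply is_lim_seq_mult'; try assumption;
    apply is_lim_seq_mult'; try assumption; apply is_lim_seq_const.
Qed.

Lemma Clim_of_Cmod (u : nat -> C) (l : C) :
  is_lim_seq (fun n => Cmod (u n - l)) 0 -> Clim u l.
Proof.
  intros H.
  assert (H' : is_lim_seq (fun n => - Cmod (u n - l)) 0).
  { replace (Finite 0) with (Rbar_opp 0) by (simpl; f_equal; lra).
    exact (proj1 (is_lim_seq_opp _ _) H). }
  split.
  - apply is_lim_seq_ext with (fun n => Re (u n - l) + Re l); [intros n; unfold Re, Im; simpl; unfold Re, Im; ring|].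
    replace (Finite (Re l)) with (Finite (0 + Re l)) by (f_equal; ring).
    apply is_lim_seq_plus'; [|apply is_lim_seq_const].
    apply is_lim_seq_le_le with (2 := H') (3 := H). intros n.
    pose proof (re_le_Cmod (u n - l)). apply Rabs_le_between. exact H0.
  - apply is_lim_seq_ext with (fun n => Im (u n - l) + Im l); [intros n; unfold Re, Im; simpl; unfold Re, Im; ring|].
    replace (Finite (Im l)) with (Finite (0 + Im l)) by (f_equal; ring).
    apply is_lim_seq_plus'; [|apply is_lim_seq_const].
    apply is_lim_seq_le_le with (2 := H') (3 := H). intros n.
    apply Rabs_le_between.
    apply Rle_trans with (2 := Rmax_Cmod (u n - l)%C). apply Rmax_r.
Qed.

Lemma Clim_ext (u v : nat -> C) (l : C) : (forall n, u n = v n) -> Clim u l -> Clim v l.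
Proof.
  intros E [H1 H2]. split; eapply is_lim_seq_ext; try eassumption; intros n; simpl; now rewrite E.
Qed.

Lemma Clim_unique (u : nat -> C) (l m : C) : Clim u l -> Clim u m -> l = m.
Proof.
  intros [U1 U2] [V1 V2].
  apply is_lim_seq_unique in U1, U2, V1, V2.
  rewrite U1 in V1. rewrite U2 in V2.
  apply injective_projections; [now injection V1 | now injection V2].
Qed.

Lemma Clim_RtoC (u : nat -> R) (l : R) : is_lim_seq u l -> Clim (fun n => RtoC (u n)) (RtoC l).
Proof. intros H. split; simpl; [exact H | apply is_lim_seq_const]. Qed.

Definition extraction (psi : nat -> nat) : Prop := forall n, (psi n < psi (S n))%nat.

Lemma extraction_ge (psi : nat -> nat) : extraction psi -> forall n, (n <= psi n)%nat.
Proof. intros H n. induction n; [lia|]. specialize (H n). lia. Qed.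

Lemma extraction_lt (psi : nat -> nat) :
  extraction psi -> forall n m, (n < m)%nat -> (psi n < psi m)%nat.
Proof.
  intros H n m Hm. induction Hm as [|m Hm IH]; [apply H|]. specialize (H m). lia.
Qed.

Lemma extraction_comp (p q : nat -> nat) :
  extraction p -> extraction q -> extraction (fun n => p (q n)).
Proof. intros P Q n. apply extraction_lt; [exact P | apply Q]. Qed.

Lemma extraction_shift (N : nat) : extraction (fun n => (n + N)%nat).
Proof. intros n. lia. Qed.

Lemma is_lim_seq_extraction (u : nat -> R) (l : Rbar) (psi : nat -> nat) :
  extraction psi -> is_lim_seq u l -> is_lim_seq (fun n => u (psi n)) l.
Proof. intros H. apply is_lim_seq_subseq, eventually_subseq, H. Qed.

Lemma Clim_extraction (u : nat -> C) (l : C) (psi : nat -> nat) :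
  extraction psi -> Clim u l -> Clim (fun n => u (psi n)) l.
Proof.
  intros H [U1 U2]. split;
  [apply (is_lim_seq_extraction (fun n => Re (u n))) | apply (is_lim_seq_extraction (fun n => Im (u n)))];
  assumption.
Qed.

Lemma bounded_extraction_R (u : nat -> R) (M : R) :
  (forall n, Rabs (u n) <= M) ->
  exists psi l, extraction psi /\ is_lim_seq (fun n => u (psi n)) (Finite l).
Proof.
  intros H.
  destruct (Bolzano_Weierstrass u (fun c => - M <= c <= M) (compact_P3 (- M) M)) as [l Hl].
  { intros n. apply Rabs_le_between. apply H. }
  assert (S : forall n N : nat, exists p, (N <= p)%nat /\ Rabs (u p - l) < / (INR n + 1)).
  { intros n N.
    assert (P : 0 < / (INR n + 1)) by (apply inv_INR_pos).
    destruct (Hl (disc l (mkposreal _ P)) N) as [p [Hp Hd]].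
    - exists (mkposreal _ P). intros x Hx. exact Hx.
    - exists p. split; [exact Hp | exact Hd]. }
  set (f := fun n N => proj1_sig (constructive_indefinite_description _ (S n N))).
  assert (Hf : forall n N, (N <= f n N)%nat /\ Rabs (u (f n N) - l) < / (INR n + 1)).
  { intros n N. unfold f. destruct (constructive_indefinite_description _ (S n N)). assumption. }
  set (psi := fix psi n := match n with O => f O O | Datatypes.S m => f n (Datatypes.S (psi m)) end).
  exists psi, l. split.
  - intros n. change (psi (Datatypes.S n)) with (f (Datatypes.S n) (Datatypes.S (psi n))).
    destruct (Hf (Datatypes.S n) (Datatypes.S (psi n))). lia.
  - assert (B : forall n, Rabs (u (psi n) - l) < / (INR n + 1)).
    { intros [|n]; [apply (Hf O O) | apply (Hf (Datatypes.S n) (Datatypes.S (psi n)))]. }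
    apply is_lim_seq_spec. intros eps.
    destruct (archimed_cor1 eps (cond_pos eps)) as [N [HN HN0]].
    exists N. intros n Hn. eapply Rlt_trans; [apply B|].
    eapply Rle_lt_trans; [|apply HN].
    apply Rinv_le_contravar; [apply lt_0_INR; exact HN0|].
    apply le_INR in Hn. lra.
Qed.

Lemma bounded_extraction (u : nat -> C) (M : R) :
  (forall n, Cmod (u n) <= M) ->
  exists psi l, extraction psi /\ Clim (fun n => u (psi n)) l.
Proof.
  intros H.
  destruct (bounded_extraction_R (fun n => Re (u n)) M) as (p & a & Hp & Ha).
  { intros n. eapply Rle_trans; [apply re_le_Cmod | apply H]. }
  destruct (bounded_extraction_R (fun n => Im (u (p n))) M) as (q & b & Hq & Hb).
  { intros n. eapply Rle_trans; [|apply (H (p n))].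
    eapply Rle_trans; [|apply Rmax_Cmod]. apply Rmax_r. }
  exists (fun n => p (q n)), (a, b). split; [apply extraction_comp; assumption|].
  split; [apply (is_lim_seq_extraction (fun n => Re (u (p n)))) | ]; assumption.
Qed.

Lemma bounded_extraction_list (us : list (nat -> C)) :
  (forall u, In u us -> exists M, forall n, Cmod (u n) <= M) ->
  exists psi, extraction psi /\ forall u, In u us -> exists l, Clim (fun n => u (psi n)) l.
Proof.
  induction us as [|v us IH]; intros H.
  - exists (fun n => n). split; [intros n; lia | intros u []].
  - destruct IH as (p & Hp & Hl); [intros u Hu; apply H; now right|].
    destruct (H v (or_introl eq_refl)) as [M HM].
    destruct (bounded_extraction (fun n => v (p n)) M) as (q & l & Hq & Hql).
    { intros n; apply HM. }
    exists (fun n => p (q n)). split; [apply extraction_comp; assumption|].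
    intros u [<- | Hu]; [exists l; exact Hql|].
    destruct (Hl u Hu) as [m Hm]. exists m.
    apply (Clim_extraction (fun n => u (p n))); assumption.
Qed.

Definition Rcont (f : C -> R) : Prop :=
  forall u l, Clim u l -> is_lim_seq (fun n => f (u n)) (f l).

Lemma Rcont_neg_disc (f : C -> R) (r : R) :
  Rcont f -> (forall w, Cmod w <= r -> f w < 0) ->
  exists c, 0 < c /\ forall w, Cmod w <= r -> f w <= - c.
Proof.
  intros Hf Hneg. apply NNPP. intros N.
  assert (S : forall n : nat, exists w, Cmod w <= r /\ - / (INR n + 1) < f w).
  { intros n. apply NNPP. intros N2. apply N. exists (/ (INR n + 1)). split.
    - apply inv_INR_pos.
    - intros w Hw. apply Rnot_lt_le. intros L. apply N2. exists w. split; assumption. }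
  destruct (choice_sequence _ S) as [u Hu]. cbv beta in Hu.
  destruct (bounded_extraction u r) as (p & l & Hp & Hl); [intros n; apply Hu|].
  assert (Hlr : Cmod l <= r).
  { apply (is_lim_seq_le (fun n => Cmod (u (p n))) (fun _ => r) (Cmod l) r);
    [intros n; apply Hu | apply Clim_Cmod, Hl | apply is_lim_seq_const]. }
  assert (0 <= f l).
  { apply (is_lim_seq_le (fun n => - / (INR (p n) + 1)) (fun n => f (u (p n))) 0 (f l)).
    - intros n. apply Rlt_le, Hu.
    - apply (is_lim_seq_extraction (fun n => - / (INR n + 1))); [exact Hp|].
      replace (Finite 0) with (Rbar_opp (Finite 0)) by (simpl; f_equal; ring).
      apply (proj1 (is_lim_seq_opp _ _)).
      apply is_lim_seq_inv_INR.
    - apply Hf, Hl. }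
  specialize (Hneg l Hlr). lra.
Qed.

Lemma Rcont_bounded_disc (f : C -> R) (r : R) :
  Rcont f -> exists M, 0 < M /\ forall w, Cmod w <= r -> f w <= M.
Proof.
  intros Hf. apply NNPP. intros N.
  assert (S : forall n : nat, exists w, Cmod w <= r /\ INR n + 1 < f w).
  { intros n. apply NNPP. intros N2. apply N. exists (INR n + 1). split.
    - pose proof (pos_INR n); lra.
    - intros w Hw. apply Rnot_lt_le. intros L. apply N2. exists w. split; assumption. }
  destruct (choice_sequence _ S) as [u Hu]. cbv beta in Hu.
  destruct (bounded_extraction u r) as (p & l & Hp & Hl); [intros n; apply Hu|].
  assert (is_lim_seq (fun n => f (u (p n))) p_infty).
  { apply is_lim_seq_le_p_loc with (fun n => INR n).
    - exists O. intros n _. apply Rlt_le. eapply Rle_lt_trans; [|apply Hu].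
      pose proof (extraction_ge p Hp n) as E. apply le_INR in E. lra.
    - apply is_lim_seq_INR. }
  assert (E := Hf _ _ Hl). apply is_lim_seq_unique in E. apply is_lim_seq_unique in H.
  rewrite H in E. discriminate.
Qed.

Lemma seq_continuity (f : R -> R) :
  (forall u x, is_lim_seq u (Finite x) -> is_lim_seq (fun n => f (u n)) (Finite (f x))) ->
  continuity f.
Proof.
  intros H x. apply NNPP. intros N.
  assert (E : exists eps, 0 < eps /\ forall d, 0 < d -> exists y, Rabs (y - x) < d /\ eps <= Rabs (f y - f x)).
  { apply NNPP. intros N2. apply N. intros eps Heps.
    apply NNPP. intros N3. apply N2. exists eps. split; [exact Heps|].
    intros d Hd. apply NNPP. intros N4. apply N3. exists d. split; [exact Hd|].
    intros y [_ Hy]. apply Rnot_le_lt. intros L. apply N4. exists y. split; assumption. }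
  destruct E as (eps & Heps & E).
  assert (S : forall n : nat, exists y, Rabs (y - x) < / (INR n + 1) /\ eps <= Rabs (f y - f x)).
  { intros n. apply E. apply inv_INR_pos. }
  destruct (choice_sequence _ S) as [u Hu]. cbv beta in Hu.
  assert (L : is_lim_seq u x).
  { apply is_lim_seq_spec. intros e.
    destruct (archimed_cor1 e (cond_pos e)) as [N0 [HN HN0]].
    exists N0. intros n Hn. eapply Rlt_trans; [apply Hu|].
    eapply Rle_lt_trans; [|apply HN].
    apply Rinv_le_contravar; [apply lt_0_INR; exact HN0|].
    apply le_INR in Hn. lra. }
  apply H in L. apply is_lim_seq_spec in L. destruct (L (mkposreal _ Heps)) as [n0 Hn].
  specialize (Hn n0 (Nat.le_refl _)). simpl in Hn. destruct (Hu n0). lra.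
Qed.

(** * Roots of complex quadratics *)

Lemma Csqrt_exists (z : C) : exists s : C, (s * s)%C = z.
Proof.
  destruct z as [a b]. set (r := Cmod (a, b)).
  assert (Hr : r * r = a * a + b * b).
  { unfold r, Cmod. simpl. rewrite sqrt_sqrt; [ring | nra]. }
  assert (Hr0 : 0 <= r) by apply Cmod_ge_0.
  assert (Ha : - r <= a <= r) by (split; nra).
  set (p := sqrt ((r + a) / 2)). set (q := sqrt ((r - a) / 2)).
  assert (Hp : p * p = (r + a) / 2) by (apply sqrt_sqrt; lra).
  assert (Hq : q * q = (r - a) / 2) by (apply sqrt_sqrt; lra).
  assert (Hp0 : 0 <= p) by apply sqrt_pos. assert (Hq0 : 0 <= q) by apply sqrt_pos.
  assert (Hpq : (2 * p * q) * (2 * p * q) = b * b).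
  { replace ((2 * p * q) * (2 * p * q)) with (4 * (p * p) * (q * q)) by ring.
    rewrite Hp, Hq. lra. }
  assert (0 <= 2 * p * q) by (apply Rmult_le_pos; [lra | exact Hq0]).
  destruct (Rle_lt_dec 0 b).
  - exists (p, q). assert (2 * p * q = b) by nra.
    apply injective_projections; simpl; lra.
  - exists (p, - q). assert (2 * p * q = - b) by nra.
    apply injective_projections; simpl; lra.
Qed.

(** The roots are kept homogeneous, as [y1 / x1] and [y2 / x2], so that a vanishing leading
    coefficient is a root at infinity and not a separate case. The symbol needs this at [w = 0]. *)
Lemma quadratic_split (a b c : C) :
  exists x1 y1 x2 y2 : C,
    a = (x1 * x2)%C /\ b = (- (x1 * y2 + x2 * y1))%C /\ c = (y1 * y2)%C.
Proof.
  destruct (Ceq_dec a 0) as [-> | Ha].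
  - exists (RtoC 0), (- (1))%C, b, (- c)%C. repeat split; ring.
  - destruct (Csqrt_exists (b * b - 4 * a * c)) as [s Hs].
    exists (RtoC 1), ((- b + s) / (2 * a))%C, a, ((- b - s) / 2)%C.
    assert (H2 : RtoC 2 <> 0) by (intros E; apply RtoC_inj in E; lra).
    split; [ring|]. split; [field; exact Ha|].
    replace ((- b + s) / (2 * a) * ((- b - s) / 2))%C
      with ((b * b - s * s) / (4 * a))%C by (field; exact Ha).
    rewrite Hs. field. exact Ha.
Qed.

(* For a k^2 + b k + c with roots k1, k2 this is |a|^2 (1 - |k1|^2) (1 - |k2|^2);
   it is negative exactly when one root lies inside the unit circle and one outside. *)
Definition root_split (a b c : C) : R :=
  Cmod a ^ 2 + Cmod c ^ 2 - (Cmod b ^ 2 + Cmod (b * b - 4 * a * c)) / 2.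

(** The discriminant is the square of [x1 y2 - x2 y1], so [|b| ^ 2 + |b b - 4 a c|] is the sum of a
    parallelogram law. The product over both roots is therefore continuous in the coefficients,
    without any choice of a root. *)
Lemma root_split_factor (x1 y1 x2 y2 : C) :
  root_split (x1 * x2) (- (x1 * y2 + x2 * y1)) (y1 * y2)
  = (Cmod x1 ^ 2 - Cmod y1 ^ 2) * (Cmod x2 ^ 2 - Cmod y2 ^ 2).
Proof.
  unfold root_split.
  replace (- (x1 * y2 + x2 * y1) * - (x1 * y2 + x2 * y1) - 4 * (x1 * x2) * (y1 * y2))%C
    with ((x1 * y2 - x2 * y1) * (x1 * y2 - x2 * y1))%C by ring.
  rewrite (Cmod_mult (x1 * y2 - x2 * y1)), Cmod_opp.
  replace (Cmod (x1 * y2 - x2 * y1) * Cmod (x1 * y2 - x2 * y1))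
    with (Cmod (x1 * y2 - x2 * y1) ^ 2) by ring.
  rewrite (Cmod_mult x1 x2), (Cmod_mult y1 y2), !Rpow_mult_distr, !Cmod_sqr.
  destruct x1, x2, y1, y2; simpl. field.
Qed.

Local Ltac clim := repeat lazymatch goal with
  | |- Clim (fun _ => ?c) _ => apply (Clim_const c)
  | |- Clim (fun n => Cplus (@?a n) (@?b n)) (Cplus ?c ?d) => apply (Clim_plus a b c d)
  | |- Clim (fun n => Cminus (@?a n) (@?b n)) (Cminus ?c ?d) => apply (Clim_minus a b c d)
  | |- Clim (fun n => Cmult (@?a n) (@?b n)) (Cmult ?c ?d) => apply (Clim_mult a b c d)
  | |- Clim (fun n => Copp (@?a n)) (Copp ?c) => apply (Clim_opp a c)
  | |- Clim _ _ => assumption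
  end.

(** * Complex triples and their norms *)

Open Scope C_scope.

Definition norm1 (f : CF3) : R := (Cmod (d1 f) + Cmod (d2 f) + Cmod (d3 f))%R.

Definition scale3 (s : C) (f : CF3) : CF3 := mkCF3 (s * d1 f) (s * d2 f) (s * d3 f).

Definition Clim3 (f : nat -> CF3) (l : CF3) : Prop :=
  Clim (fun n => d1 (f n)) (d1 l) /\ Clim (fun n => d2 (f n)) (d2 l) /\
  Clim (fun n => d3 (f n)) (d3 l).

Lemma norm1_ge_0 (f : CF3) : (0 <= norm1 f)%R.
Proof.
  unfold norm1. pose proof (Cmod_ge_0 (d1 f)). pose proof (Cmod_ge_0 (d2 f)).
  pose proof (Cmod_ge_0 (d3 f)). lra.
Qed.

Lemma norm1_scale3 (s : C) (f : CF3) : norm1 (scale3 s f) = (Cmod s * norm1 f)%R.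
Proof. unfold norm1, scale3; simpl. rewrite !Cmod_mult. ring. Qed.

Lemma norm1_pos (f : CF3) : f <> mkCF3 0 0 0 -> (0 < norm1 f)%R.
Proof.
  intros H. destruct (Rle_lt_or_eq_dec _ _ (norm1_ge_0 f)) as [|E]; [assumption|exfalso].
  apply H. unfold norm1 in E. pose proof (Cmod_ge_0 (d1 f)). pose proof (Cmod_ge_0 (d2 f)).
  pose proof (Cmod_ge_0 (d3 f)). destruct f as [a b c]; simpl in *.
  f_equal; apply Cmod_eq_0; lra.
Qed.

Lemma norm1_0 : norm1 (mkCF3 0 0 0) = 0%R.
Proof. unfold norm1; simpl. rewrite Cmod_0. ring. Qed.

Lemma Csum_scale (N : nat) (u : nat -> C) (a s : C) :
  Csum N (fun j => u j * (s * a)) = s * Csum N (fun j => u j * a).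
Proof. induction N as [|N IH]; simpl; [ring | rewrite IH; ring]. Qed.

Lemma ghostC_scale3 (b : BC) (k s : C) (f : CF3) :
  ghostC b k (scale3 s f) = s * ghostC b k f.
Proof. destruct b; simpl; try ring. apply Csum_scale. Qed.

Close Scope C_scope.

Lemma Cmod_mult_le (a b : C) (x y : R) :
  Cmod a <= x -> Cmod b <= y -> Cmod (a * b) <= x * y.
Proof.
  intros Ha Hb. rewrite Cmod_mult.
  apply Rmult_le_compat; try apply Cmod_ge_0; assumption.
Qed.

Lemma Cmod_plus_le (a b : C) (x y : R) :
  Cmod a <= x -> Cmod b <= y -> Cmod (a + b) <= x + y.
Proof. intros Ha Hb. eapply Rle_trans; [apply Cmod_triangle | lra]. Qed.

Lemma Cmod_minus_le (a b : C) (x y : R) :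
  Cmod a <= x -> Cmod b <= y -> Cmod (a - b) <= x + y.
Proof. intros Ha Hb. apply Cmod_plus_le; [exact Ha | rewrite Cmod_opp; exact Hb]. Qed.

(** * Finite sums and weighted norms *)

Lemma fsum_S (N : nat) (u : nat -> R) : fsum (S N) u = fsum N u + u N.
Proof. reflexivity. Qed.

Lemma fsum_ext (N : nat) (u v : nat -> R) :
  (forall n, (n < N)%nat -> u n = v n) -> fsum N u = fsum N v.
Proof.
  induction N as [|N IH]; intros H; simpl; [reflexivity|].
  rewrite IH by (intros; apply H; lia). rewrite H by lia. reflexivity.
Qed.

Lemma fsum_le (N : nat) (u v : nat -> R) :
  (forall n, (n < N)%nat -> u n <= v n) -> fsum N u <= fsum N v.
Proof.
  induction N as [|N IH]; intros H; simpl; [lra|].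
  apply Rplus_le_compat; [apply IH; intros; apply H; lia | apply H; lia].
Qed.

Lemma fsum_plus (N : nat) (u v : nat -> R) :
  fsum N (fun n => u n + v n) = fsum N u + fsum N v.
Proof. induction N as [|N IH]; simpl; [ring | rewrite IH; ring]. Qed.

Lemma fsum_scal (N : nat) (c : R) (u : nat -> R) :
  fsum N (fun n => c * u n) = c * fsum N u.
Proof. induction N as [|N IH]; simpl; [ring | rewrite IH; ring]. Qed.

Lemma fsum_nonneg (N : nat) (u : nat -> R) :
  (forall n, (n < N)%nat -> 0 <= u n) -> 0 <= fsum N u.
Proof.
  induction N as [|N IH]; intros H; simpl; [lra|].
  apply Rplus_le_le_0_compat; [apply IH; intros; apply H; lia | apply H; lia].
Qed.

Lemma fsum_shift (N : nat) (u : nat -> R) :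
  fsum N (fun n => u (S n)) = fsum (S N) u - u O.
Proof. induction N as [|N IH]; simpl in *; [ring | rewrite IH; ring]. Qed.

Lemma fsum_term_le (N n : nat) (u : nat -> R) :
  (forall m, 0 <= u m) -> (n < N)%nat -> u n <= fsum N u.
Proof.
  intros H. induction N as [|N IH]; intros Hn; [lia|]. simpl.
  pose proof (fsum_nonneg N u (fun m _ => H m)).
  destruct (Nat.eq_dec n N) as [->|]; [lra|]. specialize (H N). apply Rle_trans with (fsum N u); [apply IH; lia | lra].
Qed.

(** Convexity of the square at [m a + (1 - m) (h / (1 - m))]. *)
Lemma sqr_convex (m a h : R) : 0 <= m < 1 -> (m * a + h) ^ 2 <= m * a ^ 2 + h ^ 2 / (1 - m).
Proof.
  intros Hm.
  apply Rmult_le_reg_r with (1 - m); [lra|].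
  replace ((m * a ^ 2 + h ^ 2 / (1 - m)) * (1 - m))
    with (m * a ^ 2 * (1 - m) + h ^ 2) by (field; lra).
  assert (0 <= m * ((1 - m) * a - h) ^ 2) by (apply Rmult_le_pos; [lra | apply pow2_ge_0]).
  apply Rminus_le.
  replace ((m * a + h) ^ 2 * (1 - m) - (m * a ^ 2 * (1 - m) + h ^ 2))
    with (- (m * ((1 - m) * a - h) ^ 2)) by ring. lra.
Qed.

(** The initial value costs one factor [1 / (1 - m)] and the source two. The distinction is
    essential: with [m = |k|] the first factor is the only loss that the final estimate can pay
    for. *)
Lemma forward_recursion_l2 (J : nat) (m : R) (a h : nat -> R) :
  0 <= m < 1 -> (forall j, 0 <= a j) ->
  (forall j, a (S j) <= m * a j + h j) ->
  fsum J (fun j => a j ^ 2) <= a O ^ 2 / (1 - m) + fsum J (fun j => h j ^ 2) / (1 - m) ^ 2.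
Proof.
  intros Hm Ha H.
  assert (T : forall N, fsum (S N) (fun j => a j ^ 2) <=
    a O ^ 2 + m * fsum N (fun j => a j ^ 2) + fsum N (fun j => h j ^ 2) / (1 - m)).
  { intros N.
    replace (fsum (S N) (fun j => a j ^ 2)) with (a O ^ 2 + fsum N (fun j => a (S j) ^ 2))
      by (rewrite (fsum_shift N (fun j => a j ^ 2)); ring).
    rewrite Rplus_assoc. apply Rplus_le_compat_l.
    unfold Rdiv. rewrite Rmult_comm with (r1 := fsum N _), <- !fsum_scal, <- fsum_plus.
    apply fsum_le. intros n _. rewrite (Rmult_comm (/ (1 - m))). apply Rle_trans with ((m * a n + h n) ^ 2).
    - apply pow_incr. split; [apply Ha | apply H].
    - apply sqr_convex, Hm. }
  specialize (T J). rewrite fsum_S in T.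
  set (S1 := fsum J (fun j => a j ^ 2)) in *. set (S2 := fsum J (fun j => h j ^ 2)) in *.
  pose proof (pow2_ge_0 (a J)).
  apply Rmult_le_reg_r with (1 - m); [lra|].
  replace ((a O ^ 2 / (1 - m) + S2 / (1 - m) ^ 2) * (1 - m))
    with (a O ^ 2 + S2 / (1 - m)) by (field; lra).
  lra.
Qed.

Lemma backward_recursion_l2 (J : nat) (m : R) (a h : nat -> R) :
  0 <= m < 1 -> (forall j, 0 <= a j) -> a J = 0 ->
  (forall j, a j <= m * a (S j) + h j) ->
  fsum J (fun j => a j ^ 2) <= fsum J (fun j => h j ^ 2) / (1 - m) ^ 2.
Proof.
  intros Hm Ha HJ H.
  assert (T : fsum J (fun j => a j ^ 2) <=
    m * fsum J (fun j => a (S j) ^ 2) + fsum J (fun j => h j ^ 2) / (1 - m)).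
  { unfold Rdiv. rewrite Rmult_comm with (r1 := fsum J (fun j => h j ^ 2)), <- !fsum_scal, <- fsum_plus.
    apply fsum_le. intros n _. rewrite (Rmult_comm (/ (1 - m))).
    apply Rle_trans with ((m * a (S n) + h n) ^ 2).
    - apply pow_incr. split; [apply Ha | apply H].
    - apply sqr_convex, Hm. }
  rewrite (fsum_shift J (fun j => a j ^ 2)) in T. rewrite fsum_S, HJ in T.
  set (S1 := fsum J (fun j => a j ^ 2)) in *. set (S2 := fsum J (fun j => h j ^ 2)) in *.
  pose proof (pow2_ge_0 (a O)).
  apply Rmult_le_reg_r with (1 - m); [lra|].
  replace (S2 / (1 - m) ^ 2 * (1 - m)) with (S2 / (1 - m)) by (field; lra).
  assert (0 <= m * a O ^ 2) by (apply Rmult_le_pos; lra).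
  nra.
Qed.

(** * Boundary functionals on sequences *)

Definition ghostS (b : BC) (fs : nat -> CF3) : C :=
  (match b with
  | BounceBack => d3 (fs O)
  | AntiBounceBack => - d3 (fs O)
  | TwoStepsAntiBounceBack => - d1 (fs O) - d3 (fs 1%nat)
  | Extrapolation sigma =>
      Csum sigma (fun j => RtoC ((-1) ^ j * Binomial.C sigma (S j)) * d2 (fs j))
  | KineticDirichlet => RtoC 0
  end)%C.

Definition add3 (f g : CF3) : CF3 := mkCF3 (d1 f + d1 g) (d2 f + d2 g) (d3 f + d3 g).

Lemma ghostS_add (b : BC) (f g : nat -> CF3) :
  ghostS b (fun j => add3 (f j) (g j)) = (ghostS b f + ghostS b g)%C.
Proof.
  destruct b; simpl; try ring.
  (* Only the summation bound is generalised; the upper index of the binomial coefficients stays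
     [sigma]. *)
  generalize sigma at 1 3 5. intros N.
  induction N as [|N IH]; simpl; [ring | rewrite IH; ring].
Qed.

Lemma ghostS_mode (b : BC) (k s : C) (f : CF3) :
  ghostS b (fun j => scale3 (s * Defs.Cpow k j) f) = (s * ghostC b k f)%C.
Proof.
  destruct b; simpl; try ring.
  generalize sigma at 1 3. intros N.
  induction N as [|N IH]; simpl; [ring | rewrite IH; ring].
Qed.

(** The functional reads only the cells up to [L], so that later a remainder bound growing with the
    cell index is sufficient. *)
Lemma ghostS_bound (b : BC) :
  exists K L, 0 <= K /\ forall fs M, (forall j, (j <= L)%nat -> norm1 (fs j) <= M) ->
    Cmod (ghostS b fs) <= K * M.
Proof.
  assert (T : forall f M, norm1 f <= M -> Cmod (d1 f) <= M /\ Cmod (d2 f) <= M /\ Cmod (d3 f) <= M).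
  { intros f M H. unfold norm1 in H. pose proof (Cmod_ge_0 (d1 f)).
    pose proof (Cmod_ge_0 (d2 f)). pose proof (Cmod_ge_0 (d3 f)). lra. }
  destruct b.
  - exists 1, O. split; [lra|]. intros fs M H. simpl. rewrite Rmult_1_l.
    apply T, H. lia.
  - exists 1, O. split; [lra|]. intros fs M H. simpl. rewrite Rmult_1_l, Cmod_opp.
    apply T, H. lia.
  - exists 2, 1%nat. split; [lra|]. intros fs M H. simpl.
    replace (2 * M) with (M + M) by ring.
    apply Cmod_minus_le; [rewrite Cmod_opp|]; apply T, H; lia.
  - assert (G : forall N, exists K, 0 <= K /\ forall fs M, (forall j, (j <= N)%nat -> norm1 (fs j) <= M) ->
      Cmod (Csum N (fun j => (RtoC ((-1) ^ j * Binomial.C sigma (S j)) * d2 (fs j))%C)) <= K * M).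
    { induction N as [|N (K & K0 & HK)].
      - exists 0. split; [lra|]. intros fs M _. simpl. rewrite Cmod_0. lra.
      - exists (K + Cmod (RtoC ((-1) ^ N * Binomial.C sigma (S N)))).
        split; [pose proof (Cmod_ge_0 (RtoC ((-1) ^ N * Binomial.C sigma (S N)))); lra|].
        intros fs M H. simpl. rewrite Rmult_plus_distr_r.
        apply Cmod_plus_le; [apply HK; intros; apply H; lia|].
        apply Cmod_mult_le; [lra | apply T, H; lia]. }
    destruct (G sigma) as (K & K0 & HK). exists K, sigma. split; assumption.
  - exists 0, O. split; [lra|]. intros fs M _. simpl. rewrite Cmod_0. lra.
Qed.

Definition sq3 (f : CF3) : R := Cmod (d1 f) ^ 2 + Cmod (d2 f) ^ 2 + Cmod (d3 f) ^ 2.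
Definition sqr (f : F3) : R := c1 f ^ 2 + c2 f ^ 2 + c3 f ^ 2.
Definition toC (f : F3) : CF3 := mkCF3 (RtoC (c1 f)) (RtoC (c2 f)) (RtoC (c3 f)).

Lemma sq3_le_norm1 (f : CF3) : sq3 f <= norm1 f ^ 2.
Proof.
  unfold sq3, norm1. pose proof (Cmod_ge_0 (d1 f)). pose proof (Cmod_ge_0 (d2 f)).
  pose proof (Cmod_ge_0 (d3 f)).
  assert (0 <= Cmod (d1 f) * Cmod (d2 f)) by (apply Rmult_le_pos; assumption).
  assert (0 <= Cmod (d1 f) * Cmod (d3 f)) by (apply Rmult_le_pos; assumption).
  assert (0 <= Cmod (d2 f) * Cmod (d3 f)) by (apply Rmult_le_pos; assumption). lra.
Qed.

Lemma norm1_le_sq3 (f : CF3) : norm1 f ^ 2 <= 3 * sq3 f.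
Proof.
  unfold sq3, norm1. set (a := Cmod (d1 f)). set (b := Cmod (d2 f)). set (d := Cmod (d3 f)).
  pose proof (pow2_ge_0 (a - b)). pose proof (pow2_ge_0 (a - d)). pose proof (pow2_ge_0 (b - d)). lra.
Qed.

Lemma sqr_ge_0 (f : F3) : 0 <= sqr f.
Proof.
  unfold sqr. pose proof (pow2_ge_0 (c1 f)). pose proof (pow2_ge_0 (c2 f)).
  pose proof (pow2_ge_0 (c3 f)). lra.
Qed.

Lemma sq3_scale_toC (s : C) (f : F3) : sq3 (scale3 s (toC f)) = Cmod s ^ 2 * sqr f.
Proof.
  unfold sq3, sqr, scale3, toC; cbn [d1 d2 d3].
  rewrite !Cmod_mult, !Cmod_R, !Rpow_mult_distr, !pow2_abs. ring.
Qed.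

Lemma fsum_swap (N M : nat) (u : nat -> nat -> R) :
  fsum N (fun n => fsum M (fun m => u n m)) = fsum M (fun m => fsum N (fun n => u n m)).
Proof.
  induction N as [|N IH]; simpl.
  - induction M as [|M IH]; simpl; [reflexivity | rewrite <- IH; ring].
  - rewrite IH, <- fsum_plus. reflexivity.
Qed.

Lemma fsum_const (N : nat) (a : R) : fsum N (fun _ => a) = INR N * a.
Proof. induction N as [|N IH]; [simpl; ring | rewrite fsum_S, IH, S_INR; ring]. Qed.

(** * Discrete Parseval identity *)

Definition cis (t : R) : C := (cos t, sin t).

Lemma cis_pow (t : R) (n : nat) : (cis t ^ n)%C = cis (INR n * t).
Proof.
  induction n as [|n IH].
  - simpl INR. rewrite Rmult_0_l. unfold cis. rewrite cos_0, sin_0. reflexivity.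
  - change (cis t ^ S n)%C with (cis t * cis t ^ n)%C. rewrite IH, S_INR.
    replace ((INR n + 1) * t) with (t + INR n * t) by ring.
    unfold cis. rewrite cos_plus, sin_plus. apply injective_projections; simpl; ring.
Qed.

Lemma Cmod_cis (t : R) : Cmod (cis t) = 1.
Proof.
  unfold Cmod, cis. simpl fst. simpl snd.
  replace (cos t ^ 2 + sin t ^ 2) with 1; [apply sqrt_1|].
  pose proof (sin2_cos2 t) as E. unfold Rsqr in E. rewrite <- E. ring.
Qed.

Lemma geometric_sum_zero (q : C) (M : nat) :
  q <> 1 -> (q ^ M)%C = 1 -> Csum M (fun m => (q ^ m)%C) = 0.
Proof.
  intros Hq HM.
  assert (T : forall N, ((q - 1) * Csum N (fun m => (q ^ m)%C))%C = (q ^ N - 1)%C).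
  { induction N as [|N IH]; simpl; [ring|].
    rewrite Cmult_plus_distr_l, IH. ring. }
  specialize (T M). rewrite HM in T.
  replace (1 - 1)%C with (RtoC 0) in T by ring.
  apply Cmult_eq_0 in T. destruct T as [T|T]; [|exact T].
  exfalso. apply Hq, Ceq_minus, T.
Qed.

Lemma Re_Csum (N : nat) (u : nat -> C) : Re (Csum N u) = fsum N (fun n => Re (u n)).
Proof. induction N as [|N IH]; simpl; [reflexivity | rewrite <- IH; reflexivity]. Qed.

Definition node (M m : nat) : R := 2 * PI * INR m / INR M.

Lemma cos_orthogonality (M d : nat) :
  (0 < d < M)%nat -> fsum M (fun m => cos (INR d * node M m)) = 0.
Proof.
  intros Hd. assert (HM : 0 < INR M) by (apply lt_0_INR; lia).
  assert (Hd0 : 0 < INR d) by (apply lt_0_INR; lia).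
  assert (HdM : INR d < INR M) by (apply lt_INR; lia).
  set (x := PI * INR d / INR M).
  assert (Hx : 0 < x < PI).
  { pose proof PI_RGT_0. unfold x. split.
    - apply Rdiv_lt_0_compat; [apply Rmult_lt_0_compat|]; assumption.
    - apply Rmult_lt_reg_r with (INR M); [exact HM|].
      replace (PI * INR d / INR M * INR M) with (PI * INR d) by (field; lra).
      apply Rmult_lt_compat_l; assumption. }
  assert (Z := geometric_sum_zero (cis (2 * x)) M).
  rewrite <- (re_RtoC 0), <- Z.
  - rewrite Re_Csum. apply fsum_ext. intros m _. rewrite cis_pow. simpl. f_equal.
    unfold x, node. field. lra.
  - intros E. apply (f_equal Re) in E. simpl in E. rewrite cos_2a_sin in E.
    assert (0 < sin x) by (apply sin_gt_0; lra). nra.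
  - rewrite cis_pow. replace (INR M * (2 * x)) with (0 + 2 * INR d * PI) by (unfold x; field; lra).
    unfold cis. rewrite cos_period, sin_period, cos_0, sin_0. reflexivity.
Qed.

(** The frequencies in the squared modulus are differences of exponents below [N <= M], hence
    nonzero modulo [M] off the diagonal. The average over [M] nodes is then exact and replaces the
    integral over the circle. *)
Lemma parseval_nodes (M N : nat) (r : R) (a : nat -> R) :
  (N <= M)%nat ->
  fsum M (fun m => Cmod (Csum N (fun n => (RtoC r * cis (node M m)) ^ n * RtoC (a n))%C) ^ 2)
  = INR M * fsum N (fun n => r ^ (2 * n) * a n ^ 2).
Proof.
  induction N as [|N IH]; intros HN.
  - simpl Csum. rewrite (fsum_ext M _ (fun _ => 0)) by (intros; rewrite Cmod_0; ring).
    rewrite fsum_const. simpl. ring.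
  - rewrite fsum_S, Rmult_plus_distr_l, <- IH by lia.
    set (z := fun m => (RtoC r * cis (node M m))%C) in *.
    assert (E : forall m, Cmod (Csum (S N) (fun n => (z m ^ n * RtoC (a n))%C)) ^ 2 =
      Cmod (Csum N (fun n => (z m ^ n * RtoC (a n))%C)) ^ 2 + (r ^ (2 * N) * a N ^ 2
      + fsum N (fun n => 2 * a n * a N * r ^ (n + N) * cos (INR (N - n) * node M m)))).
    { intros m. simpl Csum. set (P := Csum N (fun n => (z m ^ n * RtoC (a n))%C)).
      set (q := (z m ^ N * RtoC (a N))%C).
      assert (Zn : forall n, (z m ^ n)%C = (RtoC (r ^ n) * cis (INR n * node M m))%C).
      { intros n. unfold z. rewrite Cpow_mult_l, cis_pow, RtoC_pow. reflexivity. }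
      assert (Hq : Cmod q ^ 2 = r ^ (2 * N) * a N ^ 2).
      { unfold q. rewrite Zn, !Cmod_mult, Cmod_cis, !Cmod_R, !Rpow_mult_distr, !pow2_abs, <- pow_mult.
        replace (N * 2)%nat with (2 * N)%nat by lia. ring. }
      assert (HX : 2 * (Re P * Re q + Im P * Im q) =
        fsum N (fun n => 2 * a n * a N * r ^ (n + N) * cos (INR (N - n) * node M m))).
      { replace (Re P * Re q + Im P * Im q) with (Re (P * Cconj q)%C)
          by (clearbody P q; destruct P, q; simpl; ring).
        assert (X : forall K (u : nat -> C) s, (Csum K u * s)%C = Csum K (fun n => (u n * s)%C)).
        { induction K as [|K IHK]; intros u s; simpl; [ring | rewrite <- IHK; ring]. }
        unfold P. rewrite X, Re_Csum, <- fsum_scal. apply fsum_ext. intros n Hn.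
        unfold q. rewrite !Zn, minus_INR by lia. rewrite pow_add.
        replace ((INR N - INR n) * node M m) with (INR N * node M m - INR n * node M m) by ring.
        rewrite cos_minus. unfold cis. simpl. ring. }
      rewrite <- HX, <- Hq, !Cmod_sqr. clearbody P q. destruct P, q. simpl. ring. }
    etransitivity; [apply fsum_ext; intros m _; apply E|].
    rewrite fsum_plus, fsum_plus, fsum_const, fsum_swap.
    rewrite (fsum_ext N _ (fun _ => 0)); [rewrite fsum_const; unfold z; ring|].
    intros n Hn. rewrite fsum_scal, cos_orthogonality by lia. ring.
Qed.

Lemma toC_relax (Cr s2 s3 : R) (f : F3) : relaxC Cr s2 s3 (toC f) = toC (relax Cr s2 s3 f).
Proof.
  unfold relaxC, toC, relax; simpl.
  f_equal; apply injective_projections; simpl; field.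
Qed.

Lemma ghostS_toC (b : BC) (fs : nat -> F3) (g : R) :
  RtoC (ghost b fs g) = (ghostS b (fun j => toC (fs j)) + RtoC g)%C.
Proof.
  destruct b; simpl; rewrite ?RtoC_plus, ?RtoC_minus, ?RtoC_opp; try ring.
  f_equal. generalize sigma at 1 3. intros N.
  induction N as [|N IH]; simpl; [reflexivity|].
  rewrite RtoC_plus, IH, RtoC_mult. reflexivity.
Qed.

Lemma ghostS_ext (b : BC) (f g : nat -> CF3) : (forall j, f j = g j) -> ghostS b f = ghostS b g.
Proof.
  intros H. destruct b; simpl; rewrite ?H; try reflexivity.
  generalize sigma at 1 3. intros N. induction N as [|N IH]; simpl; [reflexivity|].
  rewrite IH, H. reflexivity.
Qed.

Lemma ghostS_scale (b : BC) (s : C) (f : nat -> CF3) :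
  ghostS b (fun j => scale3 s (f j)) = (s * ghostS b f)%C.
Proof.
  destruct b; simpl; try ring.
  generalize sigma at 1 3. intros N.
  induction N as [|N IH]; simpl; [ring | rewrite IH; ring].
Qed.

(** Information travels one cell per step. All sums over the cells are therefore finite, and the
    backward recursion in space can start from zero. *)
Lemma traj_support (Cr s2 s3 : R) (b : BC) (g : nat -> R) (n : nat) :
  forall j, (n <= j)%nat -> traj Cr s2 s3 b g n j = F3zero.
Proof.
  assert (Z : relax Cr s2 s3 F3zero = F3zero).
  { unfold relax, F3zero; simpl. f_equal; field. }
  induction n as [|n IH]; intros j Hj; [reflexivity|].
  destruct j as [|j]; [lia|]. simpl. unfold step.
  rewrite !IH by lia. rewrite Z. reflexivity.
Qed.

(** * Geometric growth and weighted sums in time *)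

Lemma pow_ratio_unbounded (q : R) (A : R) : 1 < q -> exists n, A < q ^ n.
Proof.
  intros Hq. destruct (Pow_x_infinity q) with (b := A + 1) as [n Hn].
  - rewrite Rabs_pos_eq; lra.
  - exists n. specialize (Hn n (le_n n)). rewrite Rabs_pos_eq in Hn by (apply pow_le; lra). lra.
Qed.

(* Either S stays below B or S - B grows at least like (1 + 1/C)^N. *)
Lemma growth_dichotomy (S : nat -> R) (B C B0 q : R) :
  0 < C -> 0 <= B -> (forall N, S N <= B + C * (S (Datatypes.S N) - S N)) ->
  0 < q < 1 + / C -> (forall N, S N <= B0 * q ^ N) ->
  forall N, S N <= B.
Proof.
  intros HC HB H Hq Hgr N. destruct (Rle_lt_dec (S N) B) as [|L]; [assumption|exfalso].
  set (c := / C) in *. assert (Hc : 0 < c) by (apply Rinv_0_lt_compat, HC).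
  assert (G : forall m, (S N - B) * (1 + c) ^ m <= S (N + m)%nat - B).
  { induction m as [|m IH]; [rewrite Nat.add_0_r; simpl; lra|].
    rewrite Nat.add_succ_r. simpl. specialize (H (N + m)%nat).
    assert (c * (S (N + m)%nat - B) <= S (Datatypes.S (N + m)) - S (N + m)%nat).
    { apply Rmult_le_reg_l with C; [exact HC|]. unfold c.
      rewrite <- Rmult_assoc, Rinv_r by lra. lra. }
    apply Rle_trans with ((1 + c) * (S (N + m)%nat - B)); [|lra].
    replace ((S N - B) * ((1 + c) * (1 + c) ^ m)) with ((1 + c) * ((S N - B) * (1 + c) ^ m)) by ring.
    apply Rmult_le_compat_l; lra. }
  destruct (pow_ratio_unbounded ((1 + c) / q) (B0 * q ^ N / (S N - B))) as [m Hm].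
  { apply Rmult_lt_reg_r with q; [lra|]. unfold Rdiv. rewrite Rmult_assoc, Rinv_l by lra. lra. }
  specialize (G m). specialize (Hgr (N + m)%nat). rewrite pow_add in Hgr.
  assert (Hqm : 0 < q ^ m) by (apply pow_lt; lra).
  apply Rmult_lt_compat_r with (r := (S N - B) * q ^ m) in Hm;
    [|apply Rmult_lt_0_compat; lra].
  replace (B0 * q ^ N / (S N - B) * ((S N - B) * q ^ m)) with (B0 * (q ^ N * q ^ m)) in Hm
    by (field; lra).
  replace (((1 + c) / q) ^ m * ((S N - B) * q ^ m)) with ((S N - B) * (1 + c) ^ m) in Hm.
  2:{ unfold Rdiv. rewrite Rpow_mult_distr, pow_inv. field. lra. }
  lra.
Qed.

Definition wsum (E : nat -> R) (r : R) (N : nat) : R := fsum N (fun n => r ^ (2 * n) * E n).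

Lemma wsum_scale (E : nat -> R) (r r' : R) (N : nat) :
  (forall n, 0 <= E n) -> 0 < r <= r' -> wsum E r' N <= wsum E r N * ((r' / r) ^ 2) ^ N.
Proof.
  intros HE Hr. unfold wsum. rewrite Rmult_comm, <- fsum_scal. apply fsum_le. intros n Hn.
  rewrite <- Rmult_assoc. apply Rmult_le_compat_r; [apply HE|].
  rewrite <- pow_mult.
  replace (2 * N)%nat with (2 * (N - n) + 2 * n)%nat by lia. rewrite pow_add.
  assert (Hq : 1 <= r' / r).
  { apply Rmult_le_reg_r with r; [lra|]. unfold Rdiv. rewrite Rmult_assoc, Rinv_l; lra. }
  assert (H1 := pow_R1_Rle (r' / r) (2 * (N - n)) Hq).
  replace (r' ^ (2 * n)) with (1 * ((r' / r) ^ (2 * n) * r ^ (2 * n))).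
  - rewrite Rmult_assoc. apply Rmult_le_compat_r; [|exact H1].
    apply Rmult_le_pos; apply pow_le; lra.
  - rewrite Rmult_1_l, <- Rpow_mult_distr. f_equal. field. lra.
Qed.

(* The bound propagates from a small weight r0 to r in geometric steps of a fixed ratio. *)
Lemma weight_bootstrap (E : nat -> R) (r r0 B C B0 : R) :
  (forall n, 0 <= E n) -> 0 < C -> 0 <= B -> 0 < r0 <= r ->
  (forall p N, 0 < p <= r -> wsum E p N <= B + C * (p ^ (2 * N) * E N)) ->
  (forall N, wsum E r0 N <= B0) ->
  forall N, wsum E r N <= B.
Proof.
  intros HE HC HB Hr H H0.
  assert (Hi : 0 < / C) by (apply Rinv_0_lt_compat, HC).
  (* A bound at [p] by any constant limits the growth at [p'] to the rate [(p' / p) ^ 2]. Below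
     [1 + / C] the dichotomy returns the same [B], so constants do not accumulate over the steps. *)
  assert (step : forall p p' B', 0 < p <= p' -> p' <= r -> (p' / p) ^ 2 < 1 + / C ->
     (forall N, wsum E p N <= B') -> forall N, wsum E p' N <= B).
  { intros p p' B' Hp Hp' Hq Hb.
    apply growth_dichotomy with C B' ((p' / p) ^ 2); try assumption.
    - intros N. replace (wsum E p' (S N) - wsum E p' N) with (p' ^ (2 * N) * E N)
        by (unfold wsum; rewrite fsum_S; ring). apply H. lra.
    - split; [|exact Hq]. apply pow_lt, Rdiv_lt_0_compat; lra.
    - intros N. eapply Rle_trans; [apply (wsum_scale E p p' N HE Hp)|].
      apply Rmult_le_compat_r; [|apply Hb]. apply pow_le, pow_le, Rlt_le, Rdiv_lt_0_compat; lra. }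
  (* [d <= 1] gives [(1 + d) ^ 2 <= 1 + 3 d], and [3 d < / C]. *)
  set (d := Rmin 1 (/ C / 8)).
  assert (Hd : 0 < d <= 1).
  { unfold d. split; [apply Rmin_glb_lt; lra | apply Rmin_l]. }
  assert (Hd2 : d <= / C / 8) by apply Rmin_r.
  assert (Q : forall i p, r0 <= p <= r -> p <= r0 * (1 + d) ^ i -> exists B', forall N, wsum E p N <= B').
  { induction i as [|i IH]; intros p Hp Hpi.
    - simpl in Hpi. exists B0. replace p with r0 by lra. exact H0.
    - destruct (IH (Rmax r0 (p / (1 + d)))) as [B' HB'].
      + split; [apply Rmax_l|]. apply Rmax_lub; [lra|].
        apply Rmult_le_reg_r with (1 + d); [lra|].
        unfold Rdiv. rewrite Rmult_assoc, Rinv_l by lra. nra.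
      + apply Rmax_lub.
        * assert (1 <= (1 + d) ^ i) by (apply pow_R1_Rle; lra). nra.
        * apply Rmult_le_reg_r with (1 + d); [lra|].
          unfold Rdiv. rewrite Rmult_assoc, Rinv_l by lra. simpl in Hpi. lra.
      + exists B. apply (step (Rmax r0 (p / (1 + d))) p B'); try assumption; try lra.
        * split; [apply Rlt_le_trans with r0; [lra | apply Rmax_l]|].
          apply Rmax_lub; [lra|]. apply Rmult_le_reg_r with (1 + d); [lra|].
          unfold Rdiv. rewrite Rmult_assoc, Rinv_l by lra. nra.
        * apply Rle_lt_trans with ((1 + d) ^ 2); [|nra].
          assert (L : p / (1 + d) <= Rmax r0 (p / (1 + d))) by apply Rmax_r.
          set (m := Rmax r0 (p / (1 + d))) in *.
          assert (Hm : 0 < m) by (apply Rlt_le_trans with r0; [lra | apply Rmax_l]).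
          apply pow_incr. split; [apply Rlt_le, Rdiv_lt_0_compat; lra|].
          apply Rmult_le_reg_r with m; [exact Hm|].
          unfold Rdiv at 1. rewrite Rmult_assoc, Rinv_l, Rmult_1_r by lra.
          apply Rmult_le_compat_l with (r := 1 + d) in L; [|lra].
          replace ((1 + d) * (p / (1 + d))) with p in L by (field; lra). exact L. }
  destruct (pow_ratio_unbounded (1 + d) (r / r0)) as [i Hi']; [lra|].
  destruct (Q i r) as [B' HB']; [lra| |].
  { apply Rmult_lt_compat_l with (r := r0) in Hi'; [|lra].
    replace (r0 * (r / r0)) with r in Hi' by (field; lra). lra. }
  apply (step r r B'); try assumption; try lra.
  replace (r / r) with 1 by (field; lra). lra.
Qed.

(** * Nonnegative series in the extended reals *)

Lemma Rbar_mult_pos_p_infty (K : R) : 0 < K -> Rbar_mult K p_infty = p_infty.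
Proof.
  intros H. apply is_Rbar_mult_unique, is_Rbar_mult_sym, is_Rbar_mult_p_infty_pos. exact H.
Qed.

Lemma Rbar_mult_pos_m_infty (K : R) : 0 < K -> Rbar_mult K m_infty = m_infty.
Proof.
  intros H. apply is_Rbar_mult_unique, is_Rbar_mult_sym, is_Rbar_mult_m_infty_pos. exact H.
Qed.

Lemma Lim_seq_incr_cases (v : nat -> R) :
  (forall N, 0 <= v N) -> (forall N, v N <= v (S N)) ->
  Lim_seq v = p_infty \/ exists l : R, Lim_seq v = l /\ forall N, v N <= l.
Proof.
  intros H I. destruct (ex_lim_seq_incr _ I) as [l L].
  rewrite (is_lim_seq_unique _ _ L). destruct l as [l| |].
  - right. exists l. split; [reflexivity|]. apply (is_lim_seq_incr_compare v l L I).
  - now left.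
  - exfalso. exact (is_lim_seq_le (fun _ => 0) v 0 m_infty H (is_lim_seq_const 0) L).
Qed.

Lemma nnsum_cases (u : nat -> R) :
  (forall n, 0 <= u n) ->
  nnsum u = p_infty \/ exists l : R, nnsum u = l /\ forall N, fsum N u <= l.
Proof.
  intros H. apply (Lim_seq_incr_cases (fun N => fsum N u)); intros N.
  - apply fsum_nonneg. intros; apply H.
  - rewrite fsum_S. specialize (H N). lra.
Qed.

Lemma nnsum_le (u : nat -> R) (B : R) : (forall N, fsum N u <= B) -> Rbar_le (nnsum u) B.
Proof.
  intros H. unfold nnsum. rewrite <- (Lim_seq_const B). apply Lim_seq_le_loc.
  exists O. intros N _. apply H.
Qed.

Lemma nnsum2_le (u : nat -> nat -> R) (B : R) :
  (forall N, fsum N (fun n => fsum N (fun j => u n j)) <= B) -> Rbar_le (nnsum2 u) B.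
Proof.
  intros H. unfold nnsum2. rewrite <- (Lim_seq_const B). apply Lim_seq_le_loc.
  exists O. intros N _. apply H.
Qed.

Lemma nnsum2_cases (u : nat -> nat -> R) :
  (forall n j, 0 <= u n j) ->
  nnsum2 u = p_infty \/
  exists l : R, nnsum2 u = l /\ forall N, fsum N (fun n => fsum N (fun j => u n j)) <= l.
Proof.
  intros H. apply (Lim_seq_incr_cases (fun N => fsum N (fun n => fsum N (fun j => u n j)))); intros N.
  - apply fsum_nonneg. intros; apply fsum_nonneg. intros; apply H.
  - rewrite fsum_S.
    apply Rle_trans with (fsum N (fun n => fsum (S N) (fun j => u n j))).
    + apply fsum_le. intros n _. rewrite fsum_S. specialize (H n N). lra.
    + assert (0 <= fsum (S N) (fun j => u N j)) by (apply fsum_nonneg; intros; apply H). lra.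
Qed.

Lemma Rbar_mult_le_finite (a b : R) (x : Rbar) :
  0 < a -> Rbar_le x b -> Rbar_le (Rbar_mult a x) (a * b).
Proof.
  intros Ha H. destruct x as [x| |].
  - simpl in *. apply Rmult_le_compat_l; lra.
  - destruct H.
  - rewrite Rbar_mult_pos_m_infty by exact Ha. exact I.
Qed.

(** With [x = alpha dt] and [r = exp (- x)], the second bound compares the prefactor
    [alpha / (1 + alpha dt)] of the estimates with [(1 - r) / dt]. *)
Lemma exp_neg_bounds (x : R) : 0 < x -> 0 < exp (- x) < 1 /\ x / (1 + x) <= 1 - exp (- x).
Proof.
  intros Hx. pose proof (exp_pos (- x)) as P. pose proof (exp_ineq1 x ltac:(lra)) as E.
  assert (I : exp (- x) <= / (1 + x)).
  { rewrite exp_Ropp. apply Rinv_le_contravar; lra. }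
  split.
  - split; [exact P|]. apply Rle_lt_trans with (1 := I). rewrite <- Rinv_1. apply Rinv_lt_contravar; lra.
  - replace (x / (1 + x)) with (1 - / (1 + x)) by (field; lra). lra.
Qed.

Lemma exp_INR_mult (n : nat) (x : R) : exp (INR n * x) = exp x ^ n.
Proof.
  induction n as [|n IH]; [simpl; rewrite Rmult_0_l; apply exp_0|].
  rewrite S_INR. replace ((INR n + 1) * x) with (x + INR n * x) by ring.
  rewrite exp_plus, IH. reflexivity.
Qed.

Lemma momnorm2_le (f : F3) : momnorm2 f <= 7 * sqr f.
Proof.
  unfold momnorm2, mom1, mom2, mom3, sqr. destruct f as [a b d]; cbn [c1 c2 c3].
  pose proof (pow2_ge_0 (a - b)). pose proof (pow2_ge_0 (a - d)). pose proof (pow2_ge_0 (b - d)).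
  pose proof (pow2_ge_0 (b + d)). pose proof (pow2_ge_0 a). nra.
Qed.

Lemma SS_estimate_SSOO (lam Cr s2 s3 : R) (b : BC) :
  0 < lam -> SS_estimate lam Cr s2 s3 b -> SSOO_estimate lam Cr s2 s3 b.
Proof.
  intros Hl (K & HK & H). exists K. split; [exact HK|]. intros alpha g dx Ha Hdx dt.
  specialize (H alpha g dx Ha Hdx). cbv zeta in H. fold dt in H.
  assert (Hdt : 0 < dt) by (apply Rdiv_lt_0_compat; assumption).
  assert (Hc : 0 < alpha / (1 + alpha * dt)).
  { apply Rdiv_lt_0_compat; [assumption|].
    assert (0 < alpha * dt) by (apply Rmult_lt_0_compat; assumption). lra. }
  refine (Rbar_le_trans _ _ _ _ H). clear H.
  set (W := fun n : nat => dt * dx * exp (-2 * alpha * INR n * dt)).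
  assert (HW : forall n, 0 <= W n).
  { intros n. unfold W. apply Rmult_le_pos; [apply Rmult_le_pos; lra | apply Rlt_le, exp_pos]. }
  assert (L : Rbar_le
    (nnsum2 (fun n j => W n * (mom1 (traj Cr s2 s3 b g n j)) ^ 2))
    (nnsum2 (fun n j => W n * momnorm2 (traj Cr s2 s3 b g n j)))).
  { unfold nnsum2. apply Lim_seq_le_loc. exists O. intros N _.
    apply fsum_le. intros n _. apply fsum_le. intros j _.
    apply Rmult_le_compat_l; [apply HW|]. unfold momnorm2.
    pose proof (pow2_ge_0 (mom2 (traj Cr s2 s3 b g n j))).
    pose proof (pow2_ge_0 (mom3 (traj Cr s2 s3 b g n j))). lra. }
  destruct (nnsum2_cases (fun n j => W n * momnorm2 (traj Cr s2 s3 b g n j))) as [E | (l & E & _)].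
  - intros n j. apply Rmult_le_pos; [apply HW|]. unfold momnorm2.
    pose proof (pow2_ge_0 (mom1 (traj Cr s2 s3 b g n j))).
    pose proof (pow2_ge_0 (mom2 (traj Cr s2 s3 b g n j))).
    pose proof (pow2_ge_0 (mom3 (traj Cr s2 s3 b g n j))). lra.
  - fold (W). unfold W in E. rewrite E, Rbar_mult_pos_p_infty by exact Hc.
    destruct (Rbar_mult _ _); exact I.
  - unfold W in E, L. rewrite E in L |- *. apply Rbar_mult_le_finite; assumption.
Qed.

(** * The symbol of the bulk scheme *)

Section Symbol.
Variables Cr s2 s3 : R.

Record admissible : Prop := {
  adm_Cr : -1 < Cr < 1;
  adm_Cr0 : Cr <> 0;
  adm_s2 : 0 < s2 < 2;
  adm_s3 : 0 < s3 < 2;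
  adm_star : (2 - s2) / s2 + (2 - s3) / s3 <=
    (2 - s2) / s2 * ((2 - s3) / s3) * (2 * ((2 - s2) / s2) + (2 - s3) / s3) }.

Open Scope C_scope.

Definition pX : C := RtoC (1 - s3).
Definition pY : C := RtoC (1 - s2).
Definition pU : C := RtoC (s2 * Cr).
Definition pV : C := RtoC (s3 * Cr ^ 2).

(* With w = 1/z, the rest population is eliminated by
   dd w * f1 = w (1 - pX - pV) (f2 + f3); the matrix ((al, be), (ga, de)) then
   maps (f2, f3) to dd w times the post-collision pair. *)
Definition dd (w : C) : C := 1 - (1 - pV) * w.
(** Since [dd w + w (1 - pX - pV) = tx w], the elimination turns the total mass into
    [dd w * mass = tx w * (f2 + f3)]. *)
Definition tx (w : C) : C := 1 - pX * w.
Definition al (w : C) : C := ((pX + pY) * dd w + (pV + pU) * tx w) / 2.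
Definition be (w : C) : C := ((pX - pY) * dd w + (pV + pU) * tx w) / 2.
Definition ga (w : C) : C := ((pX - pY) * dd w + (pV - pU) * tx w) / 2.
Definition de (w : C) : C := ((pX + pY) * dd w + (pV - pU) * tx w) / 2.
Definition qa (w : C) : C := w * de w.
Definition qb (w : C) : C := - (dd w + w * w * pY * (pX * dd w + pV * tx w)).
Definition qc (w : C) : C := w * al w.
Definition disp (w k : C) : C := qa w * k * k + qb w * k + qc w.

Definition bulk_w (w k : C) (phi : CF3) : Prop :=
  phi <> mkCF3 (RtoC 0) (RtoC 0) (RtoC 0) /\
  d1 phi = w * d1 (relaxC Cr s2 s3 phi) /\
  k * d2 phi = w * d2 (relaxC Cr s2 s3 phi) /\
  d3 phi = w * k * d3 (relaxC Cr s2 s3 phi).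

Lemma relaxC_d1 (f : CF3) :
  d1 (relaxC Cr s2 s3 f) = (1 - pV) * d1 f + (1 - pX - pV) * (d2 f + d3 f).
Proof. unfold relaxC, pX, pV; simpl. ring. Qed.

Lemma relaxC_d2 (f : CF3) :
  d2 (relaxC Cr s2 s3 f) =
  (pX * (d2 f + d3 f) + pY * (d2 f - d3 f) + (pV + pU) * (d1 f + d2 f + d3 f)) / 2.
Proof. unfold relaxC, pX, pY, pU, pV; simpl. field. Qed.

Lemma relaxC_d3 (f : CF3) :
  d3 (relaxC Cr s2 s3 f) =
  (pX * (d2 f + d3 f) - pY * (d2 f - d3 f) + (pV - pU) * (d1 f + d2 f + d3 f)) / 2.
Proof. unfold relaxC, pX, pY, pU, pV; simpl. field. Qed.

Lemma bulk_w_iff (z k : C) (phi : CF3) :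
  z <> 0 -> bulk_mode Cr s2 s3 z k phi <-> bulk_w (/ z) k phi.
Proof.
  intros Hz. unfold bulk_mode, bulk_w.
  set (a1 := d1 (relaxC Cr s2 s3 phi)). set (a2 := d2 (relaxC Cr s2 s3 phi)).
  set (a3 := d3 (relaxC Cr s2 s3 phi)).
  split; intros (H0 & H1 & H2 & H3); split; try assumption.
  - fold a1 a2 a3 in H1, H2, H3. rewrite <- H1, <- H2.
    split; [field; exact Hz |]. split; [field; exact Hz |].
    replace (/ z * k * a3) with (/ z * (k * a3)) by ring. rewrite <- H3. field; exact Hz.
  - rewrite H1. split; [field; exact Hz|].
    replace (z * k * d2 phi) with (z * (k * d2 phi)) by ring. rewrite H2.
    split; [field; exact Hz|]. rewrite H3. field; exact Hz.
Qed.

Section Admissible.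
Hypothesis Hadm : admissible.

Lemma Cr_sqr_bounds : (0 < Cr ^ 2 < 1)%R.
Proof.
  destruct (adm_Cr Hadm). pose proof (adm_Cr0 Hadm).
  split; [apply pow2_gt_0; assumption | nra].
Qed.

Lemma dd_neq_0 (w : C) : (Cmod w <= 1)%R -> dd w <> 0.
Proof.
  intros Hw. unfold dd. apply Cmod_1_sub_neq_0. rewrite Cmod_mult.
  unfold pV. rewrite <- RtoC_minus, Cmod_R.
  assert (Rabs (1 - s3 * Cr ^ 2) < 1)%R.
  { destruct Cr_sqr_bounds. destruct (adm_s3 Hadm). apply Rabs_def1; nra. }
  pose proof (Rabs_pos (1 - s3 * Cr ^ 2)). pose proof (Cmod_ge_0 w). nra.
Qed.

Lemma bulk_w_d1 (w k : C) (phi : CF3) :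
  bulk_w w k phi -> dd w * d1 phi = w * (1 - pX - pV) * (d2 phi + d3 phi).
Proof.
  intros (_ & H & _). rewrite relaxC_d1 in H. unfold dd.
  transitivity (d1 phi - (1 - pV) * w * d1 phi); [ring|]. rewrite H at 1. ring.
Qed.

Lemma dd_relaxC_d2 (w : C) (f : CF3) (e : C) :
  dd w * d1 f = w * (1 - pX - pV) * (d2 f + d3 f) + e ->
  dd w * d2 (relaxC Cr s2 s3 f) = al w * d2 f + be w * d3 f + (pV + pU) / 2 * e.
Proof.
  intros H. rewrite relaxC_d2. unfold al, be.
  transitivity ((pX * (d2 f + d3 f) + pY * (d2 f - d3 f)) * dd w / 2
    + (pV + pU) * (dd w * d1 f + dd w * (d2 f + d3 f)) / 2); [field|].
  rewrite H. unfold dd, tx. field.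
Qed.

Lemma dd_relaxC_d3 (w : C) (f : CF3) (e : C) :
  dd w * d1 f = w * (1 - pX - pV) * (d2 f + d3 f) + e ->
  dd w * d3 (relaxC Cr s2 s3 f) = ga w * d2 f + de w * d3 f + (pV - pU) / 2 * e.
Proof.
  intros H. rewrite relaxC_d3. unfold ga, de.
  transitivity ((pX * (d2 f + d3 f) - pY * (d2 f - d3 f)) * dd w / 2
    + (pV - pU) * (dd w * d1 f + dd w * (d2 f + d3 f)) / 2); [field|].
  rewrite H. unfold dd, tx. field.
Qed.

Lemma bulk_w_pair (w k : C) (phi : CF3) :
  bulk_w w k phi ->
  dd w * (k * d2 phi) = w * (al w * d2 phi + be w * d3 phi) /\
  dd w * d3 phi = w * k * (ga w * d2 phi + de w * d3 phi).
Proof.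
  intros Hb. assert (H1 := bulk_w_d1 _ _ _ Hb). destruct Hb as (_ & _ & H2 & H3).
  assert (H1' : dd w * d1 phi = w * (1 - pX - pV) * (d2 phi + d3 phi) + 0)
    by (rewrite H1; ring).
  split.
  - rewrite H2. transitivity (w * (dd w * d2 (relaxC Cr s2 s3 phi))); [ring|].
    rewrite (dd_relaxC_d2 _ _ _ H1'). ring.
  - rewrite H3 at 1. transitivity (w * k * (dd w * d3 (relaxC Cr s2 s3 phi))); [ring|].
    rewrite (dd_relaxC_d3 _ _ _ H1'). ring.
Qed.

(** [al de - be ga] is divisible by [dd], with quotient [pY (pX dd + pV tx)]. Taking out this factor
    leaves a quadratic in [k] whose coefficients are polynomials in [w]. *)
Lemma det_disp (w k : C) :
  (k * dd w - w * al w) * (dd w - w * k * de w) - w * w * k * be w * ga w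
  = - dd w * disp w k.
Proof. unfold disp, qa, qb, qc, al, be, ga, de. field. Qed.

Lemma bulk_w_pair_neq_0 (w k : C) (phi : CF3) :
  (Cmod w <= 1)%R -> bulk_w w k phi -> ~ (d2 phi = 0 /\ d3 phi = 0).
Proof.
  intros Hw Hb [H2 H3]. assert (H1 := bulk_w_d1 _ _ _ Hb).
  apply (proj1 Hb). destruct phi as [f1 f2 f3]; simpl in *. subst.
  replace (w * (1 - pX - pV) * (0 + 0)) with (RtoC 0) in H1 by ring.
  apply Cmult_eq_0 in H1. destruct H1 as [H1 | ->]; [|reflexivity].
  destruct (dd_neq_0 _ Hw H1).
Qed.

Lemma bulk_w_disp (w k : C) (phi : CF3) :
  (Cmod w <= 1)%R -> bulk_w w k phi -> disp w k = 0.
Proof.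
  intros Hw Hb. assert (Hnz := bulk_w_pair_neq_0 _ _ _ Hw Hb).
  destruct (bulk_w_pair _ _ _ Hb) as [H2 H3].
  set (m := (k * dd w - w * al w) * (dd w - w * k * de w) - w * w * k * be w * ga w).
  assert (M2 : m * d2 phi = 0).
  { transitivity ((dd w - w * k * de w) * (dd w * (k * d2 phi) - w * (al w * d2 phi + be w * d3 phi))
      + w * be w * (dd w * d3 phi - w * k * (ga w * d2 phi + de w * d3 phi))); [unfold m; ring|].
    rewrite H2, H3; ring. }
  assert (M3 : m * d3 phi = 0).
  { transitivity ((k * dd w - w * al w) * (dd w * d3 phi - w * k * (ga w * d2 phi + de w * d3 phi))
      + w * k * ga w * (dd w * (k * d2 phi) - w * (al w * d2 phi + be w * d3 phi))); [unfold m; ring|].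
    rewrite H2, H3; ring. }
  assert (M : m = 0).
  { apply Cmult_eq_0 in M2. apply Cmult_eq_0 in M3. tauto. }
  unfold m in M. rewrite det_disp in M. apply Cmult_eq_0 in M.
  destruct M as [M|M]; [|exact M]. destruct (dd_neq_0 _ Hw).
  transitivity (- - dd w); [ring|]. rewrite M; ring.
Qed.

Lemma bulk_w_of_pair (w k p q : C) :
  (Cmod w <= 1)%R -> ~ (p = 0 /\ q = 0) ->
  dd w * (k * p) = w * (al w * p + be w * q) ->
  dd w * q = w * k * (ga w * p + de w * q) ->
  bulk_w w k (mkCF3 (w * (1 - pX - pV) * (p + q) / dd w) p q).
Proof.
  intros Hw Hnz H2 H3. assert (Hd := dd_neq_0 _ Hw).
  set (phi := mkCF3 (w * (1 - pX - pV) * (p + q) / dd w) p q).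
  assert (H1 : dd w * d1 phi = w * (1 - pX - pV) * (d2 phi + d3 phi) + 0)
    by (simpl; field; exact Hd).
  assert (E2 := dd_relaxC_d2 _ _ _ H1). assert (E3 := dd_relaxC_d3 _ _ _ H1).
  assert (cancel : forall s t : C, dd w * s = dd w * t -> s = t).
  { intros s t E. apply Ceq_minus.
    destruct (Cmult_eq_0 (dd w) (s - t)) as [|]; [|tauto|assumption].
    transitivity (dd w * s - dd w * t); [ring | rewrite E; ring]. }
  unfold bulk_w. split; [|split; [|split]].
  - intros E. apply Hnz. split; [exact (f_equal d2 E) | exact (f_equal d3 E)].
  - rewrite relaxC_d1. apply cancel. clear E2 E3.
    set (m := w * (1 - pX - pV) * (d2 phi + d3 phi)) in *.
    transitivity (m * dd w + (1 - pV) * w * (dd w * d1 phi));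
      [rewrite H1; unfold dd; ring | unfold m; ring].
  - apply cancel. change (d2 phi) with p at 1. rewrite H2.
    transitivity (w * (dd w * d2 (relaxC Cr s2 s3 phi))); [rewrite E2; simpl; ring | ring].
  - apply cancel. change (d3 phi) with q at 1. rewrite H3.
    transitivity (w * k * (dd w * d3 (relaxC Cr s2 s3 phi))); [rewrite E3; simpl; ring | ring].
Qed.

Lemma bulk_w_exists (w k : C) :
  (Cmod w <= 1)%R -> disp w k = 0 -> exists phi, bulk_w w k phi.
Proof.
  intros Hw Hq.
  assert (D := det_disp w k). rewrite Hq in D.
  (* The kernel of a singular matrix of size 2 is obtained by rotating a nonzero row; if all four
     entries vanish, any vector will do. *)
  destruct (Ceq_dec (w * be w) 0) as [Eb | Nb];
  destruct (Ceq_dec (k * dd w - w * al w) 0) as [Ea | Na];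
  [ destruct (Ceq_dec (dd w - w * k * de w) 0) as [Ed | Nd];
    [ destruct (Ceq_dec (w * k * ga w) 0) as [Eg | Ng] | ] | .. ].
  1: { eexists; apply (bulk_w_of_pair w k 1 0 Hw).
    - intros [E _]. apply C1_nz, E.
    - transitivity ((k * dd w - w * al w) + w * al w); [ring | rewrite Ea; ring].
    - transitivity (w * k * ga w); [rewrite Eg; ring | ring]. }
  1,2: eexists; apply (bulk_w_of_pair w k (dd w - w * k * de w) (w * k * ga w) Hw);
    [ tauto
    | apply Ceq_minus;
      match goal with |- ?l = _ =>
        replace l with ((k * dd w - w * al w) * (dd w - w * k * de w)
             - w * w * k * be w * ga w) by ring end; rewrite D; ring
    | ring ].
  all: eexists; apply (bulk_w_of_pair w k (w * be w) (k * dd w - w * al w) Hw);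
    [ tauto
    | ring
    | apply Ceq_minus;
      match goal with |- ?l = _ =>
        replace l with ((k * dd w - w * al w) * (dd w - w * k * de w)
             - w * w * k * be w * ga w) by ring end; rewrite D; ring ].
Qed.

(** [k = -1] is the point sent to infinity by the variable [(k - 1) / (k + 1)]. There the symbol
    splits into a linear and a quadratic factor in [w], both without roots in the closed disc. *)
Lemma disp_minus_1 (w : C) : (Cmod w <= 1)%R -> disp w (- (1)) <> 0.
Proof.
  intros Hw E.
  assert (F : disp w (- (1)) =
    (1 - - pY * w) * (1 + RtoC (2 * s3 * Cr ^ 2 - s3) * w + RtoC (- (1 - s3)) * w * w)).
  { unfold disp, qa, qb, qc, al, de, dd, tx.
    replace (RtoC (2 * s3 * Cr ^ 2 - s3)) with (2 * pV + pX - 1)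
      by (unfold pV, pX; rewrite !RtoC_minus, !RtoC_mult; ring).
    replace (RtoC (- (1 - s3))) with (- pX) by (unfold pX; rewrite RtoC_opp; ring).
    field. }
  rewrite F in E. apply Cmult_eq_0 in E.
  destruct Cr_sqr_bounds. destruct (adm_s3 Hadm). destruct (adm_s2 Hadm).
  destruct E as [E|E].
  - revert E. apply Cmod_1_sub_neq_0. rewrite Cmod_mult, Cmod_opp.
    unfold pY. rewrite Cmod_R.
    assert (Rabs (1 - s2) < 1)%R by (apply Rabs_def1; lra).
    pose proof (Rabs_pos (1 - s2)). pose proof (Cmod_ge_0 w). nra.
  - revert E. apply jury_quadratic; [| |exact Hw]; apply Rabs_def1; nra.
Qed.

Definition cubic_sym (A B C0 tau k : C) : C :=
  tau * (A * B * (tau * tau - k * k) + (A + B) * tau * (1 - k * k) + 1 - tau * tau * k * k)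
  + (1 - tau * tau) * (- C0 * C0 * k * k * (A + tau) + C0 * k * (B * tau + 1)).

(** The homogeneous form, with [tau = t1 / t0] and [eta = k1 / k0], makes the change of variables a
    polynomial identity, valid also where [1 + w] or [1 + k] vanishes. *)
Definition cubic_hom (A B C0 t1 t0 k1 k0 : C) : C :=
  t1 * (A * B * (t1 * t1 * k0 * k0 - k1 * k1 * t0 * t0) + (A + B) * t1 * t0 * (k0 * k0 - k1 * k1)
        + t0 * t0 * k0 * k0 - t1 * t1 * k1 * k1)
  + (t0 * t0 - t1 * t1) * (- C0 * C0 * k1 * k1 * (A * t0 + t1) + C0 * k1 * k0 * (B * t1 + t0)).

Lemma cubic_hom_sym (A B C0 tau eta t0 k0 : C) :
  cubic_hom A B C0 (tau * t0) t0 (eta * k0) k0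
  = t0 * t0 * t0 * k0 * k0 * cubic_sym A B C0 tau eta.
Proof. unfold cubic_hom, cubic_sym. ring. Qed.

Lemma cubic_hom_disp (A B w k : C) :
  (1 + B) * pX = B - 1 -> (1 + A) * pY = A - 1 ->
  (1 + A) * pU = 2 * RtoC Cr -> (1 + B) * pV = 2 * RtoC Cr * RtoC Cr ->
  cubic_hom A B (RtoC Cr) (1 - w) (1 + w) (k - 1) (1 + k)
  = - 4 * ((1 + A) * (1 + B) * disp w k).
Proof.
  intros EX EY EU EV.
  assert (E : 2 * ((1 + A) * (1 + B) * disp w k) =
    w * k * k * ((1 + A) * ((1 + B) * pX * (1 - w) + (1 + B) * pV)
      + (1 + A) * pY * ((1 + B) * (1 - w) + (1 + B) * pV * w)
      - (1 + A) * pU * (1 + B - (1 + B) * pX * w))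
    - 2 * k * ((1 + A) * ((1 + B) * (1 - w) + (1 + B) * pV * w)
      + w * w * ((1 + A) * pY) * ((1 + B) * pX * (1 - w) + (1 + B) * pV))
    + w * ((1 + A) * ((1 + B) * pX * (1 - w) + (1 + B) * pV)
      + (1 + A) * pY * ((1 + B) * (1 - w) + (1 + B) * pV * w)
      + (1 + A) * pU * (1 + B - (1 + B) * pX * w))).
  { unfold disp, qa, qb, qc, al, de, dd, tx. field. }
  rewrite EX, EY, EU, EV in E.
  transitivity (- 2 * (2 * ((1 + A) * (1 + B) * disp w k))); [rewrite E | ring].
  unfold cubic_hom. ring.
Qed.

Lemma cubic_sym_disp (w k tau eta : C) :
  tau * (1 + w) = 1 - w -> eta * (1 + k) = k - 1 ->
  1 + w <> 0 -> 1 + k <> 0 -> disp w k = 0 ->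
  cubic_sym (RtoC ((2 - s2) / s2)) (RtoC ((2 - s3) / s3)) (RtoC Cr) tau eta = 0.
Proof.
  intros Ht He Hw Hk Hq.
  destruct (adm_s2 Hadm). destruct (adm_s3 Hadm).
  set (A := RtoC ((2 - s2) / s2)). set (B := RtoC ((2 - s3) / s3)).
  assert (Z : cubic_hom A B (RtoC Cr) (1 - w) (1 + w) (k - 1) (1 + k) = 0).
  { rewrite cubic_hom_disp, Hq; [ring | ..];
    unfold A, B, pX, pY, pU, pV;
    rewrite <- ?RtoC_mult, <- ?RtoC_plus, <- ?RtoC_minus, <- ?RtoC_mult;
    f_equal; field; lra. }
  rewrite <- Ht, <- He, cubic_hom_sym in Z.
  apply Cmult_eq_0 in Z. destruct Z as [Z|Z]; [exfalso | exact Z].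
  revert Z. repeat apply Cmult_neq_0; assumption.
Qed.

Lemma cubic_sym_re_im (A B C0 x y h : R) :
  cubic_sym A B C0 (x, y) (0%R, h) =
  (cubic_re A B (C0 * h) (h ^ 2) x y, cubic_im A B (C0 * h) (h ^ 2) x y).
Proof.
  unfold cubic_sym, cubic_re, cubic_im. apply injective_projections; simpl; ring.
Qed.

(* Von Neumann stability, with strict dissipation away from the zero frequency. *)
Lemma disp_unit_circle (w k : C) :
  (Cmod w <= 1)%R -> Cmod k = 1%R -> disp w k = 0 -> w = 1 /\ k = 1.
Proof.
  intros Hw Hk Hq.
  destruct (adm_s2 Hadm). destruct (adm_s3 Hadm). destruct Cr_sqr_bounds.
  set (A := ((2 - s2) / s2)%R). set (B := ((2 - s3) / s3)%R).
  assert (HA : (0 < A)%R) by (apply Rdiv_lt_0_compat; lra).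
  assert (HB : (0 < B)%R) by (apply Rdiv_lt_0_compat; lra).
  assert (Hst := adm_star Hadm). fold A B in Hst.
  apply Cmod_eq_1_sqr in Hk.
  destruct (Req_dec (1 + Re k) 0) as [Ek | Nk].
  { exfalso. apply (disp_minus_1 w Hw). rewrite <- Hq. f_equal.
    rewrite (RtoC_C_re_im k). assert (Im k = 0)%R by nra.
    apply injective_projections; simpl; lra. }
  set (h := (Im k / (1 + Re k))%R).
  assert (Hh : (0%R, h) * (1 + k) = k - 1).
  { rewrite (RtoC_C_re_im k) in Hk |- *. unfold h. simpl in *.
    apply injective_projections; simpl.
    - field_simplify_eq; [|exact Nk]. nra.
    - field; exact Nk. }
  assert (N1k : 1 + k <> 0).
  { intros E. apply Nk. apply (f_equal Re) in E. simpl in E. exact E. }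
  (* [w = -1] is the pole of [tau] and is treated directly. For |k| = 1 the real part of
     [disp (-1) k] times the conjugate of [k] is [- (m + n Re k)], where [m + n] and [m - n] are
     both positive. *)
  destruct (Ceq_dec (1 + w) 0) as [Ew | Nw].
  { exfalso.
    assert (Hw1 : w = - (1)) by (transitivity (1 + w - 1); [ring | rewrite Ew; ring]).
    rewrite Hw1, (RtoC_C_re_im k) in Hq. rewrite (RtoC_C_re_im k) in Hk.
    set (p := Re k) in *. set (q := Im k) in *. simpl in Hk.
    assert (HR : Re (disp (- (1)) (p, q) * (p, - q)%R) = 0%R) by (rewrite Hq; simpl; ring).
    set (x := (1 - s3)%R) in *. set (y := (1 - s2)%R) in *. set (v := (s3 * Cr ^ 2)%R) in *.
    set (u := (s2 * Cr)%R) in *.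
    assert (HR' : ((p * p + q * q) * (2 * (2 - v + y * (x * (2 - v) + v * (1 + x)))
        + p * ((x + y) * (2 - v) + (v - u) * (1 + x)))
        + p * ((x + y) * (2 - v) + (v + u) * (1 + x)) = 0)%R).
    { replace 0%R with (- 2 * 0)%R by ring. rewrite <- HR.
      replace (disp (- (1)) (p, q)) with
        ((RtoC (/ 2)) * (- ((pX + pY) * dd (- (1)) + (pV - pU) * tx (- (1))) * (p, q) * (p, q)
        - 2 * (dd (- (1)) + pY * (pX * dd (- (1)) + pV * tx (- (1)))) * (p, q)
        - ((pX + pY) * dd (- (1)) + (pV + pU) * tx (- (1)))))
        by (rewrite RtoC_inv by lra; unfold disp, qa, qb, qc, al, de; field).
      unfold dd, tx, pX, pY, pU, pV. fold x y v u. simpl. field. }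
    replace (p * p + q * q)%R with 1%R in HR' by (rewrite <- Hk; ring).
    assert (-1 <= p <= 1)%R by nra.
    assert (0 < (1 + y) * (2 * (1 + x)))%R
      by (apply Rmult_lt_0_compat; unfold x, y; lra).
    assert (0 < (1 - y) * (2 * s3 * (1 - Cr ^ 2)))%R
      by (repeat apply Rmult_lt_0_compat; unfold y; lra).
    set (m := (2 - v + y * (x * (2 - v) + v * (1 + x)))%R) in *.
    set (n := ((x + y) * (2 - v) + v * (1 + x))%R) in *.
    assert (Hmn : (0 < m - n)%R).
    { replace (m - n)%R with ((1 - y) * (2 * s3 * (1 - Cr ^ 2)))%R; [assumption|].
      unfold m, n, v, x; ring. }
    assert (Hpn : (0 < m + n)%R).
    { replace (m + n)%R with ((1 + y) * (2 * (1 + x)))%R; [assumption|]. unfold m, n; ring. }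
    assert (HR2 : (m + p * n = 0)%R) by (unfold n; lra).
    assert (0 <= (1 + p) * (m + n))%R by (apply Rmult_le_pos; lra).
    assert (0 <= (1 - p) * (m - n))%R by (apply Rmult_le_pos; lra).
    destruct (Rle_lt_dec p 0).
    - assert (0 < (1 - p) * (m - n))%R by (apply Rmult_lt_0_compat; lra). lra.
    - assert (0 < (1 + p) * (m + n))%R by (apply Rmult_lt_0_compat; lra). lra. }
  set (N := ((1 + Re w) ^ 2 + Im w ^ 2)%R).
  assert (HN0 : (0 < N)%R).
  { unfold N. destruct (Req_dec (Im w) 0) as [i0 | i0].
    - assert (1 + Re w <> 0)%R.
      { intros E. apply Nw. rewrite (RtoC_C_re_im w), i0.
        apply injective_projections; simpl; [exact E | ring]. }
      pose proof (pow2_gt_0 (1 + Re w)). pose proof (pow2_ge_0 (Im w)). lra.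
    - pose proof (pow2_gt_0 _ i0). pose proof (pow2_ge_0 (1 + Re w)). lra. }
  assert (HN : N <> 0%R) by lra.
  apply Cmod_le_1_iff in Hw.
  set (x := ((1 - Re w ^ 2 - Im w ^ 2) / N)%R). set (y := (- 2 * Im w / N)%R).
  assert (Ht : (x, y) * (1 + w) = 1 - w).
  { rewrite (RtoC_C_re_im w). unfold x, y.
    apply injective_projections; simpl; field_simplify_eq; try exact HN; unfold N; ring. }
  assert (Hx : (0 <= x)%R).
  { unfold x. apply Rmult_le_pos; [lra | apply Rlt_le, Rinv_0_lt_compat, HN0]. }
  assert (P := cubic_sym_disp w k _ _ Ht Hh Nw N1k Hq).
  fold A B in P. rewrite cubic_sym_re_im in P.
  pose proof (f_equal fst P) as PR. pose proof (f_equal snd P) as PI. simpl in PR, PI.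
  (* For [h = 0], that is [k = 1], the cubic is [tau (1 + A tau) (1 + B tau)], whose only root with
     nonnegative real part is 0. *)
  destruct (Req_dec h 0) as [h0 | h0].
  - assert (Ek : k = 1).
    { apply Ceq_minus. rewrite <- Hh, h0.
      apply injective_projections; simpl; ring. }
    split; [|exact Ek].
    unfold cubic_re in PR; unfold cubic_im in PI. rewrite h0 in PR, PI.
    ring_simplify in PR. ring_simplify in PI.
    assert (xy : x = 0%R /\ y = 0%R).
    { assert (HAB : (0 < A * B)%R) by (apply Rmult_lt_0_compat; assumption).
      destruct (Req_dec y 0) as [y0 | y0].
      - split; [|exact y0]. rewrite y0 in PR.
        destruct (Req_dec x 0) as [|x0]; [assumption|exfalso].
        assert (0 < x)%R by lra.
        assert (0 < A * B * x ^ 3 + (A + B) * x ^ 2 + x)%R.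
        { assert (0 < A * B * x ^ 3)%R
            by (apply Rmult_lt_0_compat; [exact HAB | apply pow_lt; assumption]).
          assert (0 <= (A + B) * x ^ 2)%R
            by (apply Rmult_le_pos; [lra | apply pow2_ge_0]). lra. }
        lra.
      - exfalso.
        assert (I : (A * B * (3 * x ^ 2 - y ^ 2) + 2 * (A + B) * x + 1 = 0)%R).
        { apply Rmult_eq_reg_r with y; [|exact y0]. rewrite Rmult_0_l, <- PI. ring. }
        assert (I2 : (A * B * (x ^ 3 - 3 * x * y ^ 2) + (A + B) * (x ^ 2 - y ^ 2) + x = 0)%R)
          by (rewrite <- PR; ring).
        assert (Z : (A * B * y ^ 2 = A * B * 3 * x ^ 2 + 2 * (A + B) * x + 1)%R) by lra.
        assert (Z2 : (A * B * (8 * A * B * x ^ 3 + 8 * (A + B) * x ^ 2 + 2 * x)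
          + 2 * (A + B) ^ 2 * x + (A + B) = 0)%R).
        { replace 0%R with (- (A * B * 0))%R by ring. rewrite <- I2.
          replace (- (A * B * (A * B * (x ^ 3 - 3 * x * y ^ 2) + (A + B) * (x ^ 2 - y ^ 2) + x)))%R
           with (- (A * B * (A * B * x ^ 3 + (A + B) * x ^ 2 + x)) + (A * B * y ^ 2) * (3 * (A * B) * x + (A + B)))%R by ring.
          rewrite Z. ring. }
        assert (0 <= A * B * (8 * A * B * x ^ 3 + 8 * (A + B) * x ^ 2 + 2 * x))%R.
        { apply Rmult_le_pos; [lra|].
          assert (0 <= (A * B) * x ^ 3)%R by (apply Rmult_le_pos; [lra | apply pow_le, Hx]).
          assert (0 <= (A + B) * x ^ 2)%R by (apply Rmult_le_pos; [lra | apply pow2_ge_0]).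
          lra. }
        assert (0 <= 2 * (A + B) ^ 2 * x)%R.
        { apply Rmult_le_pos; [|lra]. pose proof (pow2_ge_0 (A + B)). lra. }
        lra. }
    destruct xy as [x0 y0]. rewrite x0, y0 in Ht.
    symmetry. apply Ceq_minus. rewrite <- Ht.
    apply injective_projections; simpl; ring.
  - exfalso.
    apply (cubic_no_root_right_half_plane A B (Cr * h)%R (h ^ 2)%R (Cr ^ 2)%R x y); try assumption.
    + apply pow2_gt_0; exact h0.
    + split; assumption.
    + ring.
Qed.

(** * Boundary residuals of stable modes *)

Definition rho (f : CF3) : C := d1 f + d2 f + d3 f.

(* The boundary residual, divided by z = 1/w. *)
Definition resid (b : BC) (w k : C) (phi : CF3) : C :=
  d2 phi - w * ghostC b k (relaxC Cr s2 s3 phi).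

Lemma rho_relaxC (f : CF3) : rho (relaxC Cr s2 s3 f) = rho f.
Proof. unfold rho, relaxC; simpl. field. Qed.

Lemma relaxC_sum (f : CF3) :
  d2 (relaxC Cr s2 s3 f) + d3 (relaxC Cr s2 s3 f) = pX * (d2 f + d3 f) + pV * rho f.
Proof. unfold relaxC, rho, pX, pV; simpl. field. Qed.

Lemma relaxC_diff (f : CF3) :
  d2 (relaxC Cr s2 s3 f) - d3 (relaxC Cr s2 s3 f) = pY * (d2 f - d3 f) + pU * rho f.
Proof. unfold relaxC, rho, pY, pU; simpl. field. Qed.

(** This is the mass balance of one step: collisions preserve [rho], transport only moves
    populations between cells, and bounce-back returns to the domain what leaves it. *)
Lemma resid_bounce_back (w k : C) (phi : CF3) :
  bulk_w w k phi -> (1 - k) * resid BounceBack w k phi = (1 - w) * rho phi.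
Proof.
  intros (_ & H1 & H2 & H3). unfold resid.
  assert (Hm := rho_relaxC phi). unfold rho in Hm at 1.
  set (f := relaxC Cr s2 s3 phi) in *. unfold ghostC.
  transitivity (d2 phi - k * d2 phi - w * d3 f + w * k * d3 f); [ring|].
  rewrite <- H3, H2.
  transitivity (rho phi - (d1 phi + w * d2 f + w * d3 f)); [unfold rho; ring|].
  rewrite H1. transitivity (rho phi - w * (d1 f + d2 f + d3 f)); [ring|].
  rewrite Hm. ring.
Qed.

Lemma resid_two_steps (w k : C) (phi : CF3) :
  bulk_w w k phi -> resid TwoStepsAntiBounceBack w k phi = rho phi.
Proof.
  intros (_ & H1 & _ & H3). unfold resid.
  set (f := relaxC Cr s2 s3 phi) in *. unfold ghostC.
  transitivity (d2 phi + w * d1 f + w * k * d3 f); [ring|].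
  rewrite <- H1, <- H3. unfold rho; ring.
Qed.

Lemma resid_extrapolation (sigma : nat) (w k : C) (phi : CF3) :
  (1 <= sigma <= 4)%nat -> bulk_w w k phi ->
  resid (Extrapolation sigma) w k phi = (1 - k) ^ sigma * d2 phi.
Proof.
  intros Hs (_ & _ & H2 & _). unfold resid.
  set (f := relaxC Cr s2 s3 phi) in *. unfold ghostC.
  (* The binomial theorem for [(1 - k) ^ sigma], with the constant term removed and a factor [k]
     taken out. *)
  assert (Hsum : k * Csum sigma (fun j => RtoC ((-1) ^ j * Binomial.C sigma (S j)) * Defs.Cpow k j)
    = 1 - (1 - k) ^ sigma).
  { assert (B11 : Binomial.C 1 1 = 1%R) by (unfold Binomial.C; simpl; field).
    assert (B21 : Binomial.C 2 1 = 2%R) by (unfold Binomial.C; simpl; field).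
    assert (B22 : Binomial.C 2 2 = 1%R) by (unfold Binomial.C; simpl; field).
    assert (B31 : Binomial.C 3 1 = 3%R) by (unfold Binomial.C; simpl; field).
    assert (B32 : Binomial.C 3 2 = 3%R) by (unfold Binomial.C; simpl; field).
    assert (B33 : Binomial.C 3 3 = 1%R) by (unfold Binomial.C; simpl; field).
    assert (B41 : Binomial.C 4 1 = 4%R) by (unfold Binomial.C; simpl; field).
    assert (B42 : Binomial.C 4 2 = 6%R) by (unfold Binomial.C; simpl; field).
    assert (B43 : Binomial.C 4 3 = 4%R) by (unfold Binomial.C; simpl; field).
    assert (B44 : Binomial.C 4 4 = 1%R) by (unfold Binomial.C; simpl; field).
    destruct sigma as [|[|[|[|[|sigma]]]]]; try lia; cbn [Csum Defs.Cpow];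
    rewrite ?B11, ?B21, ?B22, ?B31, ?B32, ?B33, ?B41, ?B42, ?B43, ?B44,
      ?RtoC_mult, ?RtoC_pow, ?RtoC_opp; ring. }
  assert (Hlin : forall N (u : nat -> C) (a : C),
    Csum N (fun j => u j * a) = Csum N u * a).
  { induction N as [|N IH]; intros u a; simpl; [ring | rewrite IH; ring]. }
  rewrite Hlin.
  set (Z := Csum sigma _) in *.
  transitivity (d2 phi - Z * (w * d2 f)); [ring|].
  rewrite <- H2. transitivity (d2 phi * (1 - k * Z)); [ring|].
  rewrite Hsum. ring.
Qed.

Lemma Cmult_cancel_l (a s t : C) : a <> 0 -> a * s = a * t -> s = t.
Proof.
  intros Ha E. apply Ceq_minus. destruct (Cmult_eq_0 a (s - t)) as [|]; [|tauto|assumption].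
  transitivity (a * s - a * t); [ring | rewrite E; ring].
Qed.

(** The alternatives are the relations imposed by the homogeneous boundary conditions. Under each of
    them [d2 phi] and [d3 phi] are multiples of the relaxed third population, so its vanishing would
    kill the mode. *)
Lemma bulk_w_d3_relaxC_neq_0 (w k : C) (phi : CF3) :
  (Cmod w <= 1)%R -> bulk_w w k phi -> d2 phi = 0 \/ d2 phi = w * d3 (relaxC Cr s2 s3 phi)
    \/ d2 phi = - w * d3 (relaxC Cr s2 s3 phi) ->
  d3 (relaxC Cr s2 s3 phi) <> 0.
Proof.
  intros Hw Hb H E. apply (bulk_w_pair_neq_0 _ _ _ Hw Hb).
  destruct Hb as (_ & _ & _ & H3). rewrite E in H, H3. split.
  - destruct H as [-> | [-> | ->]]; ring.
  - rewrite H3; ring.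
Qed.

Lemma pX_bound : (Cmod pX < 1)%R.
Proof. unfold pX. rewrite Cmod_R. destruct (adm_s3 Hadm). apply Rabs_def1; lra. Qed.

Lemma Cmod_mult_lt_1 (x y : C) : (Cmod x < 1)%R -> (Cmod y <= 1)%R -> (Cmod (x * y) < 1)%R.
Proof.
  intros Hx Hy. rewrite Cmod_mult. pose proof (Cmod_ge_0 x). pose proof (Cmod_ge_0 y). nra.
Qed.

(** A massless stable mode satisfies bounce-back by the mass balance. The relaxation of [m3] then
    becomes [(1 + k) (1 - pX w) = 0] after division by the relaxed third population, which |k| < 1
    and |pX| < 1 forbid. *)
Lemma stable_mode_rho_neq_0 (w k : C) (phi : CF3) :
  w <> 0 -> (Cmod w <= 1)%R -> (Cmod k < 1)%R -> bulk_w w k phi -> rho phi <> 0.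
Proof.
  intros Hw0 Hw Hk Hb E.
  assert (I := resid_bounce_back _ _ _ Hb). rewrite E in I.
  replace ((1 - w) * 0) with (RtoC 0) in I by ring.
  apply Cmult_eq_0 in I. destruct I as [I|I]; [exact (Cmod_1_sub_neq_0 _ Hk I)|].
  unfold resid, ghostC in I. apply Ceq_minus in I.
  assert (N := bulk_w_d3_relaxC_neq_0 _ _ _ Hw Hb (or_intror (or_introl I))).
  destruct Hb as (_ & _ & H2 & H3).
  assert (S := relaxC_sum phi). rewrite E in S.
  set (f := relaxC Cr s2 s3 phi) in *.
  assert (A2 : d2 f = k * d3 f).
  { apply (Cmult_cancel_l w); [exact Hw0|]. rewrite <- H2, I. ring. }
  rewrite A2, I, H3 in S.
  assert (Z : (1 - - k) * ((1 - pX * w) * d3 f) = 0).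
  { apply Ceq_minus in S. rewrite <- S. ring. }
  apply Cmult_eq_0 in Z. destruct Z as [Z|Z].
  - revert Z. apply Cmod_1_sub_neq_0. rewrite Cmod_opp. exact Hk.
  - apply Cmult_eq_0 in Z. destruct Z as [Z|Z]; [|exact (N Z)].
    revert Z. apply Cmod_1_sub_neq_0, Cmod_mult_lt_1; [apply pX_bound | exact Hw].
Qed.

(** If [d2 phi = 0], eliminating the populations leaves two equations in [w] and [x = w k]. [X1] is
    affine in [x] with real coefficients, so [x] is real, and [X2] then reads [w n2 = n1] with
    [n1 > |n2|], against |w| <= 1. *)
Lemma stable_mode_d2_neq_0 (w k : C) (phi : CF3) :
  (Cmod w <= 1)%R -> (Cmod k < 1)%R -> bulk_w w k phi -> d2 phi <> 0.
Proof.
  intros Hw Hk Hb E.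
  assert (N := bulk_w_d3_relaxC_neq_0 _ _ _ Hw Hb (or_introl E)).
  assert (I := resid_bounce_back _ _ _ Hb). unfold resid, ghostC in I.
  assert (Hnz := bulk_w_pair_neq_0 _ _ _ Hw Hb).
  destruct Hb as (_ & _ & H2 & H3).
  destruct (Ceq_dec w 0) as [w0|w0].
  { apply Hnz. split; [exact E|]. rewrite H3, w0. ring. }
  assert (S := relaxC_sum phi). assert (D := relaxC_diff phi).
  set (f := relaxC Cr s2 s3 phi) in *.
  assert (A2 : d2 f = 0).
  { apply (Cmult_cancel_l w); [exact w0|]. rewrite <- H2, E. ring. }
  rewrite A2, E in S, D. rewrite E in I.
  set (x := w * k) in *.
  assert (S' : d3 f * (1 - pX * x) = pV * rho phi).
  { transitivity (0 + d3 f - pX * (0 + x * d3 f)); [ring|]. rewrite S, H3. ring. }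
  assert (D' : d3 f * (1 - pY * x) = - pU * rho phi).
  { transitivity (- (0 - d3 f) + pY * (0 - x * d3 f)); [ring|]. rewrite D, H3. ring. }
  assert (X1 : pU * (1 - pX * x) + pV * (1 - pY * x) = 0).
  { apply (Cmult_cancel_l (d3 f)); [exact N|].
    transitivity (pU * (d3 f * (1 - pX * x)) + pV * (d3 f * (1 - pY * x))); [ring|].
    rewrite S', D'; ring. }
  assert (X2 : (1 - w) * (1 - pX * x) + (w - x) * pV = 0).
  { apply (Cmult_cancel_l (d3 f)); [exact N|].
    transitivity ((1 - w) * (d3 f * (1 - pX * x)) + pV * (w - x) * d3 f); [ring|].
    rewrite S'. transitivity (pV * ((1 - w) * rho phi) + pV * (w - x) * d3 f); [ring|].
    rewrite <- I. unfold x. ring. }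
  assert (Hx : (Cmod x < 1)%R).
  { unfold x. rewrite Cmult_comm. apply Cmod_mult_lt_1; assumption. }
  apply Cmod_lt_1_iff in Hx. apply Cmod_le_1_iff in Hw. clear - X1 X2 Hx Hw Hadm.
  destruct (adm_s2 Hadm). destruct (adm_s3 Hadm). destruct Cr_sqr_bounds.
  destruct (adm_Cr Hadm). pose proof (adm_Cr0 Hadm).
  unfold pX, pY, pU, pV in *.
  destruct x as [a b]. destruct w as [p q].
  pose proof (f_equal Re X1) as R1. pose proof (f_equal Im X1) as I1.
  pose proof (f_equal Re X2) as R2. pose proof (f_equal Im X2) as I2.
  simpl in R1, I1, R2, I2, Hx, Hw. clear X1 X2.
  (* [m] is the slope of [X1] in [x], up to sign. If it vanished, the constant term would vanish
     too, and both together give [s2 s3 Cr (1 + Cr) = 0]. *)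
  set (m := (s2 * Cr * (1 - s3) + s3 * Cr ^ 2 * (1 - s2))%R).
  assert (Hm : m <> 0%R).
  { intros Em.
    assert (K : (s2 * Cr + s3 * Cr ^ 2 = m * a)%R) by (unfold m; simpl; lra).
    rewrite Em, Rmult_0_l in K.
    assert (K2 : (s2 * s3 * Cr * (1 + Cr) = 0)%R).
    { replace (s2 * s3 * Cr * (1 + Cr))%R with
        (s3 * (s2 * Cr + s3 * Cr ^ 2) + s2 * (s2 * Cr + s3 * Cr ^ 2) -
           (s2 + s3 - 1) * (s2 * Cr + s3 * Cr ^ 2) - m)%R by (unfold m; ring).
      rewrite K, Em. ring. }
    revert K2. repeat apply Rmult_integral_contrapositive_currified; lra. }
  assert (Hb : b = 0%R).
  { apply Rmult_eq_reg_l with m; [|exact Hm]. unfold m; simpl; lra. }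
  rewrite Hb in *.
  set (v := (s3 * Cr ^ 2)%R) in *.
  assert (Hv : (0 < v)%R) by (unfold v; apply Rmult_lt_0_compat; lra).
  assert (Ha : (-1 < a < 1)%R) by nra.
  set (n1 := (1 - (1 - s3) * a - v * a)%R).
  set (n2 := (1 - (1 - s3) * a - v)%R).
  assert (E1 : (p * n2 = n1)%R) by (unfold n1, n2, v; simpl; lra).
  assert (N1 : (0 < n1 - n2)%R).
  { unfold n1, n2. replace (1 - (1 - s3) * a - v * a - (1 - (1 - s3) * a - v))%R
      with (v * (1 - a))%R by ring. apply Rmult_lt_0_compat; lra. }
  assert (N2 : (0 < n1 + n2)%R).
  { replace (n1 + n2)%R with ((1 + a) * (s3 * (1 - Cr ^ 2)) + (1 - a) * (2 - s3))%R
      by (unfold n1, n2, v; ring).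
    assert (0 < (1 + a) * (s3 * (1 - Cr ^ 2)))%R
      by (apply Rmult_lt_0_compat; [lra | apply Rmult_lt_0_compat; lra]).
    assert (0 < (1 - a) * (2 - s3))%R by (apply Rmult_lt_0_compat; lra). lra. }
  assert (-1 <= p <= 1)%R by nra. nra.
Qed.

(** As [rho] is nonzero, the mass balance forces [w = 1]. There the mode relations reduce to the
    equation [K] for [k], whose two terms have positive real parts when [Cr > 0] and |k| < 1. *)
Lemma stable_mode_bounce_back (w k : C) (phi : CF3) :
  w <> 0 -> (Cmod w <= 1)%R -> (Cmod k < 1)%R -> bulk_w w k phi ->
  resid BounceBack w k phi = 0 -> w = 1 /\ (Cr < 0)%R.
Proof.
  intros Hw0 Hw Hk Hb E.
  assert (I := resid_bounce_back _ _ _ Hb). rewrite E in I.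
  assert (Hr := stable_mode_rho_neq_0 _ _ _ Hw0 Hw Hk Hb).
  assert (W1 : w = 1).
  { symmetry. apply Ceq_minus. symmetry in I.
    replace ((1 - k) * 0) with (RtoC 0) in I by ring.
    apply Cmult_eq_0 in I. tauto. }
  split; [exact W1|].
  destruct (Rlt_le_dec Cr 0) as [|Hc]; [assumption | exfalso].
  unfold resid, ghostC in E. apply Ceq_minus in E.
  assert (N := bulk_w_d3_relaxC_neq_0 _ _ _ Hw Hb (or_intror (or_introl E))).
  destruct Hb as (_ & _ & H2 & H3).
  assert (S := relaxC_sum phi). assert (D := relaxC_diff phi).
  set (f := relaxC Cr s2 s3 phi) in *. rewrite W1 in *.
  assert (A2 : d2 f = k * d3 f).
  { transitivity (1 * d2 f); [ring|]. rewrite <- H2, E. ring. }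
  rewrite A2, E, H3 in S, D.
  assert (K : (1 + k) * (1 - pX) * pU + (1 - k) * (1 + pY) * pV = 0).
  { apply (Cmult_cancel_l (d3 f)); [exact N|].
    transitivity (pU * (k * d3 f + d3 f - pX * (1 * d3 f + 1 * k * d3 f)) -
      pV * (k * d3 f - d3 f - pY * (1 * d3 f - 1 * k * d3 f))); [ring|].
    rewrite S, D. ring. }
  clear - K Hadm Hc Hk. apply Cmod_lt_1_iff in Hk.
  destruct (adm_s2 Hadm). destruct (adm_s3 Hadm). destruct Cr_sqr_bounds.
  pose proof (adm_Cr0 Hadm).
  unfold pX, pY, pU, pV in *. destruct k as [a b].
  pose proof (f_equal Re K) as R1. simpl in R1, Hk. clear K.
  assert (-1 < a < 1)%R by nra.
  assert (P1 : (0 < (1 + a) * (s3 * (s2 * Cr)))%R)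
    by (repeat apply Rmult_lt_0_compat; lra).
  assert (P2 : (0 < (1 - a) * ((2 - s2) * (s3 * Cr ^ 2)))%R)
    by (repeat apply Rmult_lt_0_compat; lra).
  simpl in P2. lra.
Qed.

(** After elimination [k] drops out, and what remains is the quadratic factor in [w] met in
    [disp_minus_1]. *)
Lemma stable_mode_anti_bounce_back (w k : C) (phi : CF3) :
  w <> 0 -> (Cmod w <= 1)%R -> (Cmod k < 1)%R -> bulk_w w k phi ->
  resid AntiBounceBack w k phi <> 0.
Proof.
  intros Hw0 Hw Hk Hb E.
  assert (I := resid_bounce_back _ _ _ Hb).
  unfold resid, ghostC in E, I.
  assert (E' : d2 phi = - w * d3 (relaxC Cr s2 s3 phi)).
  { apply Ceq_minus. rewrite <- E. ring. }
  assert (N := bulk_w_d3_relaxC_neq_0 _ _ _ Hw Hb (or_intror (or_intror E'))).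
  destruct Hb as (_ & _ & H2 & H3).
  assert (S := relaxC_sum phi).
  set (f := relaxC Cr s2 s3 phi) in *.
  assert (A2 : d2 f = - k * d3 f).
  { apply (Cmult_cancel_l w); [exact Hw0|]. rewrite <- H2, E'. ring. }
  rewrite A2, E', H3 in S. rewrite E' in I.
  assert (N1 := Cmod_1_sub_neq_0 _ Hk).
  assert (J : 1 + RtoC (2 * s3 * Cr ^ 2 - s3) * w + RtoC (- (1 - s3)) * w * w = 0).
  { apply (Cmult_cancel_l ((1 - k) * d3 f)).
    { intros Z. apply Cmult_eq_0 in Z. tauto. }
    replace (RtoC (2 * s3 * Cr ^ 2 - s3)) with (2 * pV + pX - 1)
      by (unfold pV, pX; rewrite !RtoC_minus, !RtoC_mult; ring).
    replace (RtoC (- (1 - s3))) with (- pX) by (unfold pX; rewrite RtoC_opp; ring).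
    transitivity ((1 - w) * (- k * d3 f + d3 f - pX * (- w * d3 f + w * k * d3 f))
      + 2 * pV * w * (1 - k) * d3 f); [ring|].
    rewrite S.
    transitivity (pV * ((1 - w) * rho phi) + 2 * pV * w * (1 - k) * d3 f); [ring|].
    rewrite <- I. ring. }
  revert J. destruct (adm_s3 Hadm). destruct Cr_sqr_bounds.
  apply jury_quadratic; [| |exact Hw]; apply Rabs_def1; nra.
Qed.

(** At [w = k = 1] the mode is fixed by the relaxation, and nonzero rates allow this only at
    equilibrium. *)
Lemma equilibrium_mode (phi : CF3) :
  bulk_w 1 1 phi ->
  rho phi <> 0 /\ d2 phi + d3 phi = RtoC (Cr ^ 2) * rho phi /\
  d2 phi - d3 phi = RtoC Cr * rho phi.
Proof.
  intros Hb. destruct (adm_s2 Hadm). destruct (adm_s3 Hadm).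
  assert (Hw : (Cmod 1 <= 1)%R) by (rewrite Cmod_1; lra).
  assert (Hnz := bulk_w_pair_neq_0 _ _ _ Hw Hb).
  destruct Hb as (_ & _ & B2 & B3).
  assert (S := relaxC_sum phi). assert (D := relaxC_diff phi).
  set (f := relaxC Cr s2 s3 phi) in *.
  replace (1 * d2 phi) with (d2 phi) in B2 by ring.
  replace (1 * d2 f) with (d2 f) in B2 by ring.
  replace (1 * 1 * d3 f) with (d3 f) in B3 by ring.
  rewrite <- B2, <- B3 in S, D.
  assert (S' : d2 phi + d3 phi = RtoC (Cr ^ 2) * rho phi).
  { apply (Cmult_cancel_l (RtoC s3)).
    { intros Z. apply RtoC_inj in Z. lra. }
    transitivity ((d2 phi + d3 phi) - pX * (d2 phi + d3 phi)).
    { unfold pX. rewrite RtoC_minus. ring. }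
    rewrite S at 1. unfold pV. rewrite RtoC_mult. ring. }
  assert (D' : d2 phi - d3 phi = RtoC Cr * rho phi).
  { apply (Cmult_cancel_l (RtoC s2)).
    { intros Z. apply RtoC_inj in Z. lra. }
    transitivity ((d2 phi - d3 phi) - pY * (d2 phi - d3 phi)).
    { unfold pY. rewrite RtoC_minus. ring. }
    rewrite D at 1. unfold pU. rewrite RtoC_mult. ring. }
  split; [|split; assumption].
  intros E. rewrite E in S', D'. apply Hnz.
  split; apply (Cmult_cancel_l 2).
  - intros Z; apply RtoC_inj in Z; lra.
  - transitivity ((d2 phi + d3 phi) + (d2 phi - d3 phi)); [ring|]. rewrite S', D'; ring.
  - intros Z; apply RtoC_inj in Z; lra.
  - transitivity ((d2 phi + d3 phi) - (d2 phi - d3 phi)); [ring|]. rewrite S', D'; ring.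
Qed.

(** * Stable roots and their limits *)

Lemma Clim_dd (w : nat -> C) (l : C) : Clim w l -> Clim (fun n => dd (w n)) (dd l).
Proof. intros H. unfold dd. clim. Qed.

Lemma Clim_qa (w : nat -> C) (l : C) : Clim w l -> Clim (fun n => qa (w n)) (qa l).
Proof. intros H. unfold qa, de, dd, tx, Cdiv. clim. Qed.

Lemma Clim_qb (w : nat -> C) (l : C) : Clim w l -> Clim (fun n => qb (w n)) (qb l).
Proof. intros H. unfold qb, dd, tx, Cdiv. clim. Qed.

Lemma Clim_qc (w : nat -> C) (l : C) : Clim w l -> Clim (fun n => qc (w n)) (qc l).
Proof. intros H. unfold qc, al, dd, tx, Cdiv. clim. Qed.

Lemma Clim_disp (w k : nat -> C) (l m : C) :
  Clim w l -> Clim k m -> Clim (fun n => disp (w n) (k n)) (disp l m).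
Proof.
  intros H K. assert (A := Clim_qa _ _ H). assert (B := Clim_qb _ _ H).
  assert (D := Clim_qc _ _ H). unfold disp. clim.
Qed.

Lemma disp_zero_limit (w k : nat -> C) (l m : C) :
  Clim w l -> Clim k m -> (forall n, disp (w n) (k n) = 0) -> disp l m = 0.
Proof.
  intros H K E. apply (Clim_unique (fun n => disp (w n) (k n))).
  - apply Clim_disp; assumption.
  - apply Clim_ext with (fun _ => RtoC 0); [intros n; symmetry; apply E | apply Clim_const].
Qed.

Lemma Clim_Cmod_le (u : nat -> C) (l : C) (M : R) :
  Clim u l -> (forall n, (Cmod (u n) <= M)%R) -> (Cmod l <= M)%R.
Proof.
  intros H B.
  apply (is_lim_seq_le (fun n => Cmod (u n)) (fun _ => M) (Cmod l) M);
    [exact B | apply Clim_Cmod, H | apply is_lim_seq_const].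
Qed.

Lemma root_split_symbol_cont : Rcont (fun w => root_split (qa w) (qb w) (qc w)).
Proof.
  intros u l H. unfold root_split.
  assert (A := Clim_qa _ _ H). assert (B := Clim_qb _ _ H). assert (D := Clim_qc _ _ H).
  assert (SQ : forall (v : nat -> C) m, Clim v m ->
    is_lim_seq (fun n => Cmod (v n) ^ 2)%R (Cmod m ^ 2)%R).
  { intros v m Hv. apply Clim_Cmod in Hv.
    apply is_lim_seq_ext with (fun n => Cmod (v n) * Cmod (v n))%R; [intros n; simpl; ring|].
    replace (Cmod m ^ 2)%R with (Cmod m * Cmod m)%R by ring.
    apply is_lim_seq_mult'; assumption. }
  unfold Rdiv. apply is_lim_seq_minus'; [apply is_lim_seq_plus'; apply SQ; assumption|].
  apply is_lim_seq_mult'; [|apply is_lim_seq_const].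
  apply is_lim_seq_plus'; [apply SQ; assumption|].
  apply Clim_Cmod. clim.
Qed.

Lemma root_split_symbol_neg (w : C) :
  (Cmod w < 1)%R -> (root_split (qa w) (qb w) (qc w) < 0)%R.
Proof.
  intros Hw. set (f := fun t : R => root_split (qa (RtoC t * w)) (qb (RtoC t * w)) (qc (RtoC t * w))).
  assert (Hf : continuity f).
  { apply seq_continuity. intros u x Hu. apply (root_split_symbol_cont (fun n => RtoC (u n) * w)).
    apply Clim_mult; [apply Clim_RtoC, Hu | apply Clim_const]. }
  assert (Z : forall t, (0 <= t <= 1)%R -> f t <> 0%R).
  { intros t Ht E. set (w' := RtoC t * w).
    assert (Hw' : (Cmod w' < 1)%R).
    { unfold w'. rewrite Cmod_mult, Cmod_R, Rabs_pos_eq by lra. pose proof (Cmod_ge_0 w). nra. }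
    destruct (quadratic_split (qa w') (qb w') (qc w')) as (x1 & y1 & x2 & y2 & Ea & Eb & Ec).
    unfold f in E. fold w' in E. rewrite Ea, Eb, Ec, root_split_factor in E.
    assert (D : forall k, disp w' k = (x1 * k - y1) * (x2 * k - y2)).
    { intros k. unfold disp. rewrite Ea, Eb, Ec. ring. }
    assert (K : exists k, Cmod k = 1%R /\ disp w' k = 0).
    { assert (aux : forall x y, (Cmod x ^ 2 - Cmod y ^ 2 = 0)%R ->
        exists k, Cmod k = 1%R /\ x * k - y = 0).
      { intros x y Exy.
        destruct (Ceq_dec x 0) as [-> | Hx].
        - rewrite Cmod_0 in Exy. exists 1. split; [apply Cmod_1|].
          assert (y = 0) as ->; [|ring]. apply Cmod_eq_0. pose proof (Cmod_ge_0 y). nra.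
        - exists (y / x). split; [|field; exact Hx].
          assert (Hx' := proj1 (Cmod_gt_0 x) Hx).
          rewrite Cmod_div by exact Hx.
          assert (Cmod y = Cmod x) as ->; [|field; lra].
          pose proof (Cmod_ge_0 y). nra. }
      apply Rmult_integral in E. destruct E as [E|E]; apply aux in E; destruct E as (k & K1 & K2);
      exists k; (split; [exact K1|]); rewrite D, K2; ring. }
    destruct K as (k & K1 & K2).
    destruct (disp_unit_circle w' k (Rlt_le _ _ Hw') K1 K2) as [E1 _].
    rewrite E1, Cmod_1 in Hw'. lra. }
  (* At [w = 0] the symbol is [- k]: one root is 0, the other is infinite. *)
  assert (F0 : (f 0 < 0)%R).
  { unfold f. replace (RtoC 0 * w) with (RtoC 0) by ring. unfold root_split.
    replace (qa 0) with (RtoC 0) by (unfold qa; ring).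
    replace (qc 0) with (RtoC 0) by (unfold qc; ring).
    replace (qb 0) with (RtoC (-1)) by (unfold qb, dd; ring).
    replace (RtoC (-1) * RtoC (-1) - 4 * 0 * 0) with (RtoC 1) by ring.
    rewrite Cmod_0, Cmod_R, Cmod_1, Rabs_left by lra. lra. }
  replace (root_split (qa w) (qb w) (qc w)) with (f 1%R)
    by (unfold f; replace (1 * w) with w by ring; reflexivity).
  destruct (Rlt_le_dec (f 1%R) 0) as [|F1]; [assumption|exfalso].
  destruct (IVT_gen f 0 1 0 Hf) as (t & Ht & E).
  - rewrite Rmin_left, Rmax_right by lra. lra.
  - rewrite Rmin_left, Rmax_right in Ht by lra. exact (Z t Ht E).
Qed.

(* disp w k' = (k' - k) (qa w k' - v): one root inside the unit circle, one outside. *)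
Definition is_split (w k v : C) : Prop :=
  qb w = - (v + k * qa w) /\ qc w = k * v.

Lemma is_split_disp (w k v x : C) : is_split w k v -> disp w x = (x - k) * (qa w * x - v).
Proof. intros [E1 E2]. unfold disp. rewrite E1, E2. ring. Qed.

Lemma is_split_root_split (w k v : C) :
  is_split w k v ->
  (root_split (qa w) (qb w) (qc w) = (1 - Cmod k ^ 2) * (Cmod (qa w) ^ 2 - Cmod v ^ 2))%R.
Proof.
  intros [E1 E2]. rewrite E1, E2.
  replace (- (v + k * qa w)) with (- (1 * v + qa w * k)) by ring.
  replace (root_split (qa w)) with (root_split (1 * qa w)) by (f_equal; ring).
  rewrite root_split_factor, Cmod_1. ring.
Qed.

Lemma stable_split (w : C) :
  (Cmod w < 1)%R -> exists k v, (Cmod k < 1)%R /\ (Cmod (qa w) < Cmod v)%R /\ is_split w k v.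
Proof.
  intros Hw. assert (N := root_split_symbol_neg w Hw).
  destruct (quadratic_split (qa w) (qb w) (qc w)) as (x1 & y1 & x2 & y2 & Ea & Eb & Ec).
  assert (aux : forall x1 y1 x2 y2, qa w = x1 * x2 -> qb w = - (x1 * y2 + x2 * y1) ->
     qc w = y1 * y2 -> (Cmod y1 < Cmod x1)%R -> (Cmod x2 < Cmod y2)%R ->
     exists k v, (Cmod k < 1)%R /\ (Cmod (qa w) < Cmod v)%R /\ is_split w k v).
  { clear. intros x1 y1 x2 y2 Ea Eb Ec H1 H2.
    pose proof (Cmod_ge_0 y1). pose proof (Cmod_ge_0 x2).
    assert (Hx : x1 <> 0) by (apply Cmod_gt_0; lra).
    exists (y1 / x1), (x1 * y2). split; [|split; [|split]].
    - rewrite Cmod_div by exact Hx. apply Rmult_lt_reg_r with (Cmod x1); [lra|].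
      unfold Rdiv. rewrite Rmult_assoc, Rinv_l by lra. lra.
    - rewrite Ea, !Cmod_mult. apply Rmult_lt_compat_l; lra.
    - rewrite Ea, Eb. field. exact Hx.
    - rewrite Ec. field. exact Hx. }
  assert (N' := N). rewrite Ea, Eb, Ec, root_split_factor in N'.
  pose proof (Cmod_ge_0 x1). pose proof (Cmod_ge_0 y1).
  pose proof (Cmod_ge_0 x2). pose proof (Cmod_ge_0 y2).
  assert (sq : forall p q, (0 <= p)%R -> (0 <= q)%R -> (p ^ 2 - q ^ 2 < 0)%R -> (p < q)%R)
    by (intros; nra).
  destruct (Rlt_le_dec (Cmod x2 ^ 2 - Cmod y2 ^ 2) 0) as [L|L].
  - apply (aux x1 y1 x2 y2); try assumption; [|apply sq; assumption].
    apply sq; try assumption. nra.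
  - apply (aux x2 y2 x1 y1); try assumption.
    + rewrite Ea; ring.
    + rewrite Eb; ring.
    + rewrite Ec; ring.
    + apply sq; try assumption. nra.
    + apply sq; try assumption. nra.
Qed.

Lemma stable_root_unique (w k v x : C) :
  (Cmod (qa w) < Cmod v)%R -> is_split w k v -> (Cmod x <= 1)%R -> disp w x = 0 -> x = k.
Proof.
  intros Hv Hs Hx E. rewrite (is_split_disp _ _ _ _ Hs) in E.
  apply Cmult_eq_0 in E. destruct E as [E|E]; [apply Ceq_minus, E | exfalso].
  apply Ceq_minus in E. apply (f_equal Cmod) in E. rewrite Cmod_mult in E.
  pose proof (Cmod_ge_0 (qa w)). pose proof (Cmod_ge_0 x). nra.
Qed.

Lemma stable_root_split (w k : C) :
  (Cmod w < 1)%R -> (Cmod k < 1)%R -> disp w k = 0 ->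
  exists v, (Cmod (qa w) < Cmod v)%R /\ is_split w k v.
Proof.
  intros Hw Hk E. destruct (stable_split w Hw) as (k' & v & K1 & K2 & K3).
  rewrite (stable_root_unique _ _ _ _ K2 K3 (Rlt_le _ _ Hk) E). exists v. split; assumption.
Qed.

(** At [w = 1] the quadratic is [(k - 1) (a k - c)]. Since [c + a > 0] and [c - a] has the sign of
    [Cr], the root other than 1 lies outside the unit circle for [Cr > 0] and inside for
    [Cr < 0]. *)
Lemma symbol_at_1 :
  exists a c : R, qa 1 = RtoC a /\ qc 1 = RtoC c /\ qb 1 = - (RtoC c + 1 * qa 1) /\
    (c - a = s2 * s3 * Cr)%R /\ (0 < c + a)%R.
Proof.
  destruct (adm_s2 Hadm). destruct (adm_s3 Hadm). destruct Cr_sqr_bounds.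
  set (x := (1 - s3)%R). set (y := (1 - s2)%R). set (u := (s2 * Cr)%R).
  set (v := (s3 * Cr ^ 2)%R).
  exists (((x + y) * v + (v - u) * s3) / 2)%R, (((x + y) * v + (v + u) * s3) / 2)%R.
  assert (Ed : dd 1 = RtoC v) by (unfold dd, pV; fold v; ring).
  assert (Et : tx 1 = RtoC s3)
    by (unfold tx, pX; rewrite RtoC_minus; ring).
  assert (Ea : qa 1 = RtoC (((x + y) * v + (v - u) * s3) / 2)).
  { unfold qa, de. rewrite Ed, Et.
    rewrite RtoC_div by lra. rewrite RtoC_plus, !RtoC_mult, RtoC_plus, RtoC_minus.
    unfold pX, pY, pU, pV. fold x y u v. ring. }
  assert (Ec : qc 1 = RtoC (((x + y) * v + (v + u) * s3) / 2)).
  { unfold qc, al. rewrite Ed, Et.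
    rewrite RtoC_div by lra. rewrite RtoC_plus, !RtoC_mult, !RtoC_plus.
    unfold pX, pY, pU, pV. fold x y u v. ring. }
  split; [exact Ea|]. split; [exact Ec|]. split; [|split].
  - rewrite <- Ec. unfold qa, qb, qc, al, de. rewrite Ed, Et.
    unfold pX, pY, pU, pV. fold x y u v.
    replace (RtoC s3) with (1 - RtoC x) by (unfold x; rewrite RtoC_minus; ring). field.
  - unfold u, v. field.
  - replace (((x + y) * v + (v + u) * s3) / 2 + ((x + y) * v + (v - u) * s3) / 2)%R
      with (v * (2 - s2))%R by (unfold x, y; field).
    apply Rmult_lt_0_compat; [unfold v; apply Rmult_lt_0_compat; lra | lra].
Qed.

Lemma is_split_at_1 : is_split 1 1 (qc 1).
Proof.
  destruct symbol_at_1 as (a & c & Ea & Ec & Eb & _ & _). rewrite Ec.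
  split; [exact Eb | rewrite Ec; ring].
Qed.

Lemma split_at_1_pos : (0 < Cr)%R -> (Cmod (qa 1) < Cmod (qc 1))%R.
Proof.
  intros HC. destruct symbol_at_1 as (a & c & Ea & Ec & _ & D & S).
  destruct (adm_s2 Hadm). destruct (adm_s3 Hadm).
  rewrite Ea, Ec, !Cmod_R.
  assert (0 < s2 * s3 * Cr)%R by (repeat apply Rmult_lt_0_compat; assumption).
  rewrite (Rabs_pos_eq c) by lra. apply Rabs_def1; lra.
Qed.

Lemma split_at_1_neg : (Cr < 0)%R -> (Cmod (qc 1) < Cmod (qa 1))%R.
Proof.
  intros HC. destruct symbol_at_1 as (a & c & Ea & Ec & _ & D & S).
  destruct (adm_s2 Hadm). destruct (adm_s3 Hadm).
  rewrite Ea, Ec, !Cmod_R.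
  assert (0 < s2 * s3 * - Cr)%R by (repeat apply Rmult_lt_0_compat; lra).
  rewrite (Rabs_pos_eq a) by lra. apply Rabs_def1; lra.
Qed.

(* For Cr < 0 the root through (1, 1) is the outer one. *)
Lemma stable_limit_at_1 (w k : nat -> C) :
  (forall n, (Cmod (w n) < 1)%R /\ (Cmod (k n) < 1)%R /\ disp (w n) (k n) = 0) ->
  Clim w 1 -> Clim k 1 -> (0 < Cr)%R.
Proof.
  intros H Lw Lk. pose proof (adm_Cr0 Hadm).
  destruct (Rlt_le_dec 0 Cr) as [|HC]; [assumption|exfalso].
  assert (N := split_at_1_neg ltac:(lra)).
  assert (B : forall n, (Cmod (qa (w n)) <= Cmod (- qb (w n) - k n * qa (w n)))%R).
  { intros n. destruct (H n) as (H1 & H2 & H3).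
    destruct (stable_root_split _ _ H1 H2 H3) as (v & V1 & [V2 V3]).
    replace (- qb (w n) - k n * qa (w n)) with v by (rewrite V2; ring). lra. }
  assert (A := Clim_qa _ _ Lw). assert (D := Clim_qb _ _ Lw).
  assert (L : (Cmod (qa 1) <= Cmod (- qb 1 - 1 * qa 1))%R).
  { apply (is_lim_seq_le _ _ (Cmod (qa 1)) (Cmod (- qb 1 - 1 * qa 1)) B).
    - apply Clim_Cmod, A.
    - apply Clim_Cmod. clim. }
  destruct is_split_at_1 as [E _].
  replace (- qb 1 - 1 * qa 1) with (qc 1) in L by (rewrite E; ring). lra.
Qed.

Lemma stable_limit (w k : nat -> C) (l m : C) :
  (forall n, (Cmod (w n) < 1)%R /\ (Cmod (k n) < 1)%R /\ disp (w n) (k n) = 0) ->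
  Clim w l -> Clim k m ->
  (Cmod l <= 1)%R /\ disp l m = 0 /\
  ((Cmod m < 1)%R \/ l = 1 /\ m = 1 /\ (0 < Cr)%R).
Proof.
  intros H Lw Lk.
  assert (Hl : (Cmod l <= 1)%R) by (apply (Clim_Cmod_le _ _ _ Lw); intros n; apply Rlt_le, H).
  assert (Hm : (Cmod m <= 1)%R) by (apply (Clim_Cmod_le _ _ _ Lk); intros n; apply Rlt_le, H).
  assert (E : disp l m = 0) by (apply (disp_zero_limit _ _ _ _ Lw Lk); intros n; apply H).
  split; [exact Hl|]. split; [exact E|].
  destruct (Rlt_le_dec (Cmod m) 1) as [|G]; [now left | right].
  destruct (disp_unit_circle l m Hl (Rle_antisym _ _ Hm G) E) as [-> ->].
  split; [reflexivity|]. split; [reflexivity|]. apply (stable_limit_at_1 w k); assumption.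
Qed.

Lemma relaxC_scale3 (s : C) (f : CF3) :
  relaxC Cr s2 s3 (scale3 s f) = scale3 s (relaxC Cr s2 s3 f).
Proof. unfold relaxC, scale3; simpl. f_equal; field. Qed.

Lemma resid_scale3 (b : BC) (w k s : C) (f : CF3) :
  resid b w k (scale3 s f) = s * resid b w k f.
Proof.
  unfold resid. rewrite relaxC_scale3, ghostC_scale3. simpl. ring.
Qed.

Lemma bulk_w_scale3 (w k s : C) (f : CF3) :
  s <> 0 -> bulk_w w k f -> bulk_w w k (scale3 s f).
Proof.
  intros Hs (H0 & H1 & H2 & H3). unfold bulk_w. rewrite relaxC_scale3.
  split; [|split; [|split]].
  - intros E. apply (Rlt_irrefl 0).
    replace 0%R with (norm1 (scale3 s f)) at 2 by (rewrite E; apply norm1_0).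
    rewrite norm1_scale3. apply Rmult_lt_0_compat; [apply Cmod_gt_0, Hs | apply norm1_pos, H0].
  - change (s * d1 f = w * (s * d1 (relaxC Cr s2 s3 f))). rewrite H1 at 1. ring.
  - change (k * (s * d2 f) = w * (s * d2 (relaxC Cr s2 s3 f))).
    transitivity (s * (k * d2 f)); [ring | rewrite H2; ring].
  - change (s * d3 f = w * k * (s * d3 (relaxC Cr s2 s3 f))). rewrite H3 at 1. ring.
Qed.

Lemma Clim3_relaxC (f : nat -> CF3) (l : CF3) :
  Clim3 f l -> Clim3 (fun n => relaxC Cr s2 s3 (f n)) (relaxC Cr s2 s3 l).
Proof.
  intros (H1 & H2 & H3). split; [|split].
  - rewrite relaxC_d1. eapply Clim_ext; [intros n; symmetry; apply relaxC_d1|]. clim.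
  - rewrite relaxC_d2. eapply Clim_ext; [intros n; symmetry; apply relaxC_d2|]. unfold Cdiv. clim.
  - rewrite relaxC_d3. eapply Clim_ext; [intros n; symmetry; apply relaxC_d3|]. unfold Cdiv. clim.
Qed.

Lemma Clim_Cpow (k : nat -> C) (m : C) (j : nat) :
  Clim k m -> Clim (fun n => Defs.Cpow (k n) j) (Defs.Cpow m j).
Proof. intros H. induction j as [|j IH]; simpl; clim. Qed.

Lemma Clim_ghostC (b : BC) (k : nat -> C) (m : C) (f : nat -> CF3) (l : CF3) :
  Clim k m -> Clim3 f l -> Clim (fun n => ghostC b (k n) (f n)) (ghostC b m l).
Proof.
  intros Hk (H1 & H2 & H3). destruct b; simpl; clim.
  induction sigma as [|N IH] in |- * at 1 3; simpl; [clim|].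
  apply Clim_plus; [exact IH|]. assert (P := Clim_Cpow _ _ N Hk). clim.
Qed.

Lemma Clim_resid (b : BC) (w k : nat -> C) (p q : C) (f : nat -> CF3) (l : CF3) :
  Clim w p -> Clim k q -> Clim3 f l ->
  Clim (fun n => resid b (w n) (k n) (f n)) (resid b p q l).
Proof.
  intros Hw Hk Hf. unfold resid.
  assert (G := Clim_ghostC b _ _ _ _ Hk (Clim3_relaxC _ _ Hf)). destruct Hf as (_ & H2 & _).
  clim.
Qed.

Lemma bulk_w_limit (w k : nat -> C) (p q : C) (f : nat -> CF3) (l : CF3) :
  Clim w p -> Clim k q -> Clim3 f l -> (forall n, bulk_w (w n) (k n) (f n)) ->
  l <> mkCF3 0 0 0 -> bulk_w p q l.
Proof.
  intros Hw Hk Hf B Hl. destruct (Clim3_relaxC _ _ Hf) as (R1 & R2 & R3).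
  destruct Hf as (H1 & H2 & H3).
  split; [exact Hl|]. split; [|split].
  - apply (Clim_unique _ _ _ H1). eapply Clim_ext; [intros n; symmetry; apply (B n)|]. clim.
  - apply (Clim_unique (fun n => k n * d2 (f n))); [clim|].
    eapply Clim_ext; [intros n; symmetry; apply (B n)|]. clim.
  - apply (Clim_unique _ _ _ H3). eapply Clim_ext; [intros n; symmetry; apply (B n)|]. clim.
Qed.

(** * Uniform Kreiss-Lopatinskii bounds *)

Definition supported (b : BC) : Prop :=
  match b with Extrapolation sigma => (1 <= sigma <= 4)%nat | _ => True end.

Definition well_posed (b : BC) : Prop :=
  match b with
  | BounceBack => (0 < Cr)%R
  | Extrapolation sigma => (1 <= sigma <= 4)%nat /\ (Cr < 0)%R
  | _ => True
  end.

Lemma resid_neq_0 (b : BC) (w k : C) (f : CF3) :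
  supported b -> (Cmod w <= 1)%R -> (Cmod k < 1)%R -> bulk_w w k f ->
  (b = BounceBack -> w <> 1 \/ (0 < Cr)%R) -> resid b w k f <> 0.
Proof.
  intros Hs Hw Hk B HB.
  assert (N2 := stable_mode_d2_neq_0 _ _ _ Hw Hk B).
  destruct (Ceq_dec w 0) as [-> | Hw0].
  { unfold resid. intros E. apply N2. rewrite <- E. ring. }
  destruct b.
  - intros E. destruct (stable_mode_bounce_back _ _ _ Hw0 Hw Hk B E) as [E1 E2].
    destruct (HB eq_refl); [contradiction | lra].
  - apply (stable_mode_anti_bounce_back _ _ _ Hw0 Hw Hk B).
  - rewrite (resid_two_steps _ _ _ B). apply (stable_mode_rho_neq_0 _ _ _ Hw0 Hw Hk B).
  - rewrite (resid_extrapolation _ _ _ _ Hs B).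
    apply Cmult_neq_0; [|exact N2]. apply Cpow_nz, Cmod_1_sub_neq_0, Hk.
  - unfold resid, ghostC. intros E. apply N2. rewrite <- E. ring.
Qed.

(** Only for [Cr > 0] is (1, 1) a limit of stable pairs. The mode there is the equilibrium, so each
    residual is an explicit nonzero multiple of [rho]. *)
Lemma resid_at_1_neq_0 (b : BC) (f : CF3) :
  well_posed b -> (0 < Cr)%R -> bulk_w 1 1 f -> resid b 1 1 f <> 0.
Proof.
  intros Hs HC B. destruct (equilibrium_mode _ B) as (N & S & D).
  destruct (adm_Cr Hadm).
  assert (R3 : d3 (relaxC Cr s2 s3 f) = d3 f)
    by (symmetry; etransitivity; [apply (proj2 (proj2 (proj2 B))) | ring]).
  assert (NZ : forall x : R, x <> 0%R -> RtoC x * rho f <> 0).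
  { intros x Hx. apply Cmult_neq_0; [|exact N]. intros E. apply RtoC_inj in E. lra. }
  destruct b.
  - unfold resid, ghostC. rewrite R3.
    replace (d2 f - 1 * d3 f) with (d2 f - d3 f) by ring. rewrite D. apply NZ. lra.
  - unfold resid, ghostC. rewrite R3.
    replace (d2 f - 1 * - d3 f) with (d2 f + d3 f) by ring. rewrite S. apply NZ.
    apply Rgt_not_eq, pow_lt, HC.
  - rewrite (resid_two_steps _ _ _ B). exact N.
  - destruct Hs; lra.
  - unfold resid, ghostC.
    replace (d2 f - 1 * 0) with (RtoC (/ 2) * ((d2 f + d3 f) + (d2 f - d3 f)))
      by (rewrite RtoC_inv by lra; field).
    rewrite S, D.
    replace (RtoC (/ 2) * (RtoC (Cr ^ 2) * rho f + RtoC Cr * rho f))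
      with (RtoC (/ 2 * (Cr ^ 2 + Cr)) * rho f) by (rewrite RtoC_mult, RtoC_plus; ring).
    apply NZ. apply Rgt_not_eq, Rmult_lt_0_compat; [lra|].
    pose proof (pow_lt Cr 2 HC). lra.
Qed.

(** Modes of norm 1 violating the bound accumulate at a mode of zero residual. [Dom] is either the
    open unit disc or a smaller closed disc; the last premise of the second hypothesis carries a
    bound |w| <= r valid on [Dom] over to the limit point. *)
Lemma resid_lower_bound (Dom : C -> Prop) (b : BC) :
  (forall w, Dom w -> (Cmod w < 1)%R) ->
  (forall w k f, (Cmod w <= 1)%R -> bulk_w w k f ->
     (Cmod k < 1)%R \/ w = 1 /\ k = 1 /\ (0 < Cr)%R ->
     (forall r, (forall w', Dom w' -> (Cmod w' <= r)%R) -> (Cmod w <= r)%R) ->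
     resid b w k f <> 0) ->
  exists c, (0 < c)%R /\ forall w k f, Dom w -> (Cmod k < 1)%R -> bulk_w w k f ->
    (c * norm1 f <= Cmod (resid b w k f))%R.
Proof.
  intros HD Hlim. apply NNPP. intros N.
  assert (S : forall n : nat, exists wkf : C * C * CF3,
    Dom (fst (fst wkf)) /\ (Cmod (snd (fst wkf)) < 1)%R /\
    bulk_w (fst (fst wkf)) (snd (fst wkf)) (snd wkf) /\
    norm1 (snd wkf) = 1%R /\
    (Cmod (resid b (fst (fst wkf)) (snd (fst wkf)) (snd wkf)) <= / (INR n + 1))%R).
  { intros n. apply NNPP. intros N2. apply N. exists (/ (INR n + 1))%R.
    split; [apply inv_INR_pos|].
    intros w k f Hw Hk B. apply Rnot_lt_le. intros L. apply N2.
    assert (P := norm1_pos f (proj1 B)).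
    assert (Ns : RtoC (/ norm1 f) <> 0).
    { intros E. apply RtoC_inj in E. apply Rinv_neq_0_compat in E; [exact E | lra]. }
    assert (Ms : Cmod (RtoC (/ norm1 f)) = (/ norm1 f)%R).
    { rewrite Cmod_R. apply Rabs_pos_eq, Rlt_le, Rinv_0_lt_compat, P. }
    exists (w, k, scale3 (RtoC (/ norm1 f)) f). simpl.
    split; [exact Hw|]. split; [exact Hk|]. split; [apply bulk_w_scale3; assumption|].
    split; [rewrite norm1_scale3, Ms; field; lra|].
    rewrite resid_scale3, Cmod_mult, Ms.
    apply Rmult_le_reg_l with (norm1 f); [exact P|].
    rewrite <- Rmult_assoc, Rinv_r by lra. lra. }
  destruct (choice_sequence _ S) as [u Hu]. cbv beta in Hu.
  clear S N.
  set (w := fun n => fst (fst (u n))) in *. set (k := fun n => snd (fst (u n))) in *.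
  set (f := fun n => snd (u n)) in *.
  assert (Hu' : forall n, Dom (w n) /\ (Cmod (k n) < 1)%R /\ bulk_w (w n) (k n) (f n) /\
    norm1 (f n) = 1%R /\ (Cmod (resid b (w n) (k n) (f n)) <= / (INR n + 1))%R) by exact Hu.
  clear Hu. clearbody w k f. clear u.
  destruct (bounded_extraction_list
    (w :: k :: (fun n => d1 (f n)) :: (fun n => d2 (f n)) :: (fun n => d3 (f n)) :: nil))
    as (psi & Hpsi & L).
  { intros v Hv. exists 1%R. intros n. destruct (Hu' n) as (D1 & D2 & _ & D3 & _).
    unfold norm1 in D3. pose proof (Cmod_ge_0 (d1 (f n))). pose proof (Cmod_ge_0 (d2 (f n))).
    pose proof (Cmod_ge_0 (d3 (f n))). specialize (HD _ D1).
    destruct Hv as [<-|[<-|[<-|[<-|[<-|[]]]]]]; lra. }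
  destruct (L w) as [p Lw]; [simpl; tauto|].
  destruct (L k) as [q Lk]; [simpl; tauto|].
  destruct (L (fun n => d1 (f n))) as [f1 L1]; [simpl; tauto|].
  destruct (L (fun n => d2 (f n))) as [f2 L2]; [simpl; tauto|].
  destruct (L (fun n => d3 (f n))) as [f3 L3]; [simpl; tauto|].
  set (l := mkCF3 f1 f2 f3).
  assert (Lf : Clim3 (fun n => f (psi n)) l) by (split; [exact L1 | split; [exact L2 | exact L3]]).
  assert (Nl : norm1 l = 1%R).
  { assert (E : is_lim_seq (fun n => norm1 (f (psi n))) (norm1 l)).
    { unfold norm1. repeat apply is_lim_seq_plus'; apply Clim_Cmod; assumption. }
    apply is_lim_seq_unique in E.
    rewrite (Lim_seq_ext _ (fun _ => 1%R)) in E by (intros n; apply (Hu' (psi n))).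
    rewrite Lim_seq_const in E. now injection E. }
  assert (Bl : bulk_w p q l).
  { apply (bulk_w_limit _ _ _ _ _ _ Lw Lk Lf); [intros n; apply (Hu' (psi n))|].
    intros E. rewrite E, norm1_0 in Nl. lra. }
  destruct (stable_limit (fun n => w (psi n)) (fun n => k (psi n)) p q) as (P1 & P2 & P3);
    [ | exact Lw | exact Lk | ].
  { intros n. destruct (Hu' (psi n)) as (D1 & D2 & D3 & _). specialize (HD _ D1).
    split; [exact HD|]. split; [exact D2|].
    apply (bulk_w_disp _ _ _ (Rlt_le _ _ HD) D3). }
  apply (Hlim p q l P1 Bl P3).
  - intros r Hr. apply (Clim_Cmod_le _ _ _ Lw). intros n. apply Hr, (Hu' (psi n)).
  - apply Cmod_eq_0. apply Rle_antisym; [|apply Cmod_ge_0].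
    assert (E := Clim_Cmod _ _ (Clim_resid b _ _ _ _ _ _ Lw Lk Lf)).
    apply (is_lim_seq_le _ (fun n => / (INR (psi n) + 1))%R _ 0%R) with (2 := E).
    + intros n. apply (Hu' (psi n)).
    + apply (is_lim_seq_extraction (fun n => / (INR n + 1))%R); [exact Hpsi|].
      apply is_lim_seq_inv_INR.
Qed.

Lemma uniform_kreiss_lopatinskii (b : BC) :
  well_posed b ->
  exists c, (0 < c)%R /\ forall w k f, (Cmod w < 1)%R -> (Cmod k < 1)%R -> bulk_w w k f ->
    (c * norm1 f <= Cmod (resid b w k f))%R.
Proof.
  intros Hb. apply (resid_lower_bound (fun w => (Cmod w < 1)%R)); [tauto|].
  intros w k f Hw B [Hk | (-> & -> & HC)] _.
  - apply resid_neq_0; try assumption.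
    + destruct b; simpl in *; tauto.
    + intros ->. right. exact Hb.
  - apply resid_at_1_neq_0; assumption.
Qed.

(** This covers the unstable conditions too, because their degenerate points lie on |w| = 1. It is
    used to obtain finiteness for fixed [r], with no control of the constant as [r] tends to 1. *)
Lemma kreiss_lopatinskii_disc (b : BC) (r : R) :
  supported b -> (r < 1)%R ->
  exists c, (0 < c)%R /\ forall w k f, (Cmod w <= r)%R -> (Cmod k < 1)%R -> bulk_w w k f ->
    (c * norm1 f <= Cmod (resid b w k f))%R.
Proof.
  intros Hb Hr. apply (resid_lower_bound (fun w => (Cmod w <= r)%R)); [intros; lra|].
  intros w k f Hw B HL Hcl.
  assert (Hwr : (Cmod w <= r)%R) by (apply Hcl; tauto).
  destruct HL as [Hk | (-> & _)]; [|rewrite Cmod_1 in Hwr; lra].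
  apply resid_neq_0; try assumption.
  intros _. left. intros ->. rewrite Cmod_1 in Hwr. lra.
Qed.

(** * Quantitative bounds on the symbol and on the stable root *)

Lemma dd_lower_bound : exists c, (0 < c)%R /\ forall w, (Cmod w <= 1)%R -> (c <= Cmod (dd w))%R.
Proof.
  destruct (Rcont_neg_disc (fun w => - Cmod (dd w))%R 1) as (c & Hc & H).
  - intros u l Hu. exact (proj1 (is_lim_seq_opp _ _) (Clim_Cmod _ _ (Clim_dd _ _ Hu))).
  - intros w Hw. pose proof (proj1 (Cmod_gt_0 _) (dd_neq_0 w Hw)). lra.
  - exists c. split; [exact Hc|]. intros w Hw. specialize (H w Hw). lra.
Qed.

Lemma symbol_upper_bound :
  exists M, (1 <= M)%R /\ forall w, (Cmod w <= 1)%R ->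
    (Cmod (al w) <= M /\ Cmod (be w) <= M /\ Cmod (ga w) <= M /\ Cmod (de w) <= M /\
     Cmod (dd w) <= M /\ Cmod (qa w) + Cmod (qb w) <= M)%R.
Proof.
  destruct (Rcont_bounded_disc (fun w => Cmod (al w) + Cmod (be w) + Cmod (ga w) + Cmod (de w)
     + Cmod (dd w) + (Cmod (qa w) + Cmod (qb w)))%R 1) as (M & HM & H).
  - intros u l Hu.
    assert (A1 : Clim (fun n => al (u n)) (al l)) by (unfold al, dd, tx, Cdiv; clim).
    assert (A2 : Clim (fun n => be (u n)) (be l)) by (unfold be, dd, tx, Cdiv; clim).
    assert (A3 : Clim (fun n => ga (u n)) (ga l)) by (unfold ga, dd, tx, Cdiv; clim).
    assert (A4 : Clim (fun n => de (u n)) (de l)) by (unfold de, dd, tx, Cdiv; clim).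
    assert (A5 := Clim_dd _ _ Hu). assert (A6 := Clim_qa _ _ Hu). assert (A7 := Clim_qb _ _ Hu).
    apply Clim_Cmod in A1, A2, A3, A4, A5, A6, A7.
    apply is_lim_seq_plus';
      [do 4 (apply is_lim_seq_plus'; [|assumption]); assumption
      | apply is_lim_seq_plus'; assumption].
  - exists (Rmax 1 M). split; [apply Rmax_l|]. intros w Hw. specialize (H w Hw).
    pose proof (Rmax_r 1 M).
    pose proof (Cmod_ge_0 (al w)). pose proof (Cmod_ge_0 (be w)). pose proof (Cmod_ge_0 (ga w)).
    pose proof (Cmod_ge_0 (de w)). pose proof (Cmod_ge_0 (dd w)).
    pose proof (Cmod_ge_0 (qa w)). pose proof (Cmod_ge_0 (qb w)).
    repeat split; lra.
Qed.

Lemma disc_split_gap (r : R) :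
  (r < 1)%R ->
  exists c, (0 < c < 1)%R /\ forall w k v, (Cmod w <= r)%R -> (Cmod k < 1)%R ->
    (Cmod (qa w) < Cmod v)%R -> is_split w k v ->
    (Cmod k <= 1 - c)%R /\ (Cmod (qa w) <= (1 - c) * Cmod v)%R /\ (c <= Cmod v)%R.
Proof.
  intros Hr.
  destruct (Rcont_neg_disc _ r root_split_symbol_cont) as (c0 & Hc0 & H0).
  { intros w Hw. apply root_split_symbol_neg. lra. }
  destruct symbol_upper_bound as (M & HM1 & HM).
  (* With [p = |k|], [a = |qa w|], [q = |v| <= M], everything follows from
     [c0 <= (1 - p ^ 2) (q ^ 2 - a ^ 2)]: [1 - p >= c0 / (2 M ^ 2)], [q - a >= c0 / (2 M)] and
     [q >= sqrt c0]. The [/ 2] keeps [c < 1]. *)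
  set (c := Rmin (/ 2) (Rmin (c0 / (2 * M ^ 2)) (sqrt c0))).
  assert (P1 : (0 < c0 / (2 * M ^ 2))%R) by (apply Rdiv_lt_0_compat; [lra|]; nra).
  assert (P2 : (0 < sqrt c0)%R) by (apply sqrt_lt_R0, Hc0).
  assert (C1 : (c <= / 2)%R) by apply Rmin_l.
  assert (C2 : (c <= c0 / (2 * M ^ 2))%R)
    by (eapply Rle_trans; [apply Rmin_r | apply Rmin_l]).
  assert (C3 : (c <= sqrt c0)%R) by (eapply Rle_trans; [apply Rmin_r | apply Rmin_r]).
  assert (Hc : (0 < c)%R) by (unfold c; repeat apply Rmin_glb_lt; lra).
  exists c. split; [lra|]. intros w k v Hw Hk Hv Hs.
  specialize (H0 w Hw). rewrite (is_split_root_split _ _ _ Hs) in H0.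
  destruct (HM w) as (_ & _ & _ & _ & _ & HM2); [lra|].
  assert (Vb : (Cmod v <= M)%R).
  { replace v with (- (qb w + k * qa w)) by (rewrite (proj1 Hs); ring).
    rewrite Cmod_opp. eapply Rle_trans; [apply Cmod_triangle|]. rewrite Cmod_mult.
    pose proof (Cmod_ge_0 (qa w)). nra. }
  pose proof (Cmod_ge_0 k). pose proof (Cmod_ge_0 (qa w)).
  set (a := Cmod (qa w)) in *. set (p := Cmod k) in *. set (q := Cmod v) in *.
  assert (E : (c0 <= (1 - p ^ 2) * (q ^ 2 - a ^ 2))%R) by lra.
  assert (C2' : (c * (2 * M ^ 2) <= c0)%R).
  { apply Rmult_le_compat_r with (r := (2 * M ^ 2)%R) in C2; [|nra].
    unfold Rdiv in C2. rewrite Rmult_assoc, Rinv_l in C2 by nra. lra. }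
  assert (Q2 : (q ^ 2 - a ^ 2 <= M ^ 2)%R) by nra.
  assert (Q3 : (0 < q ^ 2 - a ^ 2)%R) by nra.
  assert (Q4 : (c0 <= q ^ 2 - a ^ 2)%R) by nra.
  split; [|split].
  - assert ((1 - p ^ 2) * (q ^ 2 - a ^ 2) <= 2 * (1 - p) * M ^ 2)%R.
    { apply Rle_trans with ((2 * (1 - p)) * (q ^ 2 - a ^ 2))%R.
      - apply Rmult_le_compat_r; [lra | nra].
      - apply Rmult_le_compat_l; lra. }
    assert (0 < M ^ 2)%R by nra.
    apply Rmult_le_reg_r with (2 * M ^ 2)%R; [lra|]. lra.
  - assert (c0 <= (q - a) * (2 * M))%R by nra.
    assert (c * q * (2 * M) <= c0)%R by nra.
    apply Rmult_le_reg_r with (2 * M)%R; lra.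
  - apply Rle_trans with (1 := C3). apply Rsqr_incr_0_var; [|lra].
    rewrite Rsqr_sqrt by lra. unfold Rsqr. nra.
Qed.

Lemma unit_circle_root (w : C) :
  Cmod w = 1%R -> exists k, (Cmod k <= 1)%R /\ disp w k = 0.
Proof.
  intros Hw. set (t := fun n : nat => (1 - / (INR n + 1))%R).
  assert (Ht : forall n, (0 <= t n < 1)%R).
  { intros n. unfold t. pose proof (pos_INR n).
    assert (0 < / (INR n + 1) <= 1)%R; [|lra].
    split; [apply Rinv_0_lt_compat; lra|]. rewrite <- Rinv_1. apply Rinv_le_contravar; lra. }
  assert (S : forall n, exists k, (Cmod k < 1)%R /\ disp (RtoC (t n) * w) k = 0).
  { intros n. destruct (stable_split (RtoC (t n) * w)) as (k & v & K1 & _ & K3).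
    - rewrite Cmod_mult, Hw, Cmod_R, Rabs_pos_eq by apply Ht. specialize (Ht n). lra.
    - exists k. split; [exact K1|]. rewrite (is_split_disp _ _ _ _ K3). ring. }
  destruct (choice_sequence _ S) as [k Hk]. cbv beta in Hk.
  destruct (bounded_extraction k 1%R) as (psi & l & Hpsi & Hl).
  { intros n. apply Rlt_le, Hk. }
  exists l. split; [apply (Clim_Cmod_le _ _ _ Hl); intros n; apply Rlt_le, Hk|].
  apply (disp_zero_limit (fun n => RtoC (t (psi n)) * w) (fun n => k (psi n)));
    [ | exact Hl | intros n; apply Hk].
  assert (G : Clim (fun n => RtoC (t (psi n)) * w) (1 * w));
    [|replace (1 * w) with w in G by ring; exact G].
  apply Clim_mult; [|apply Clim_const].
  apply (Clim_RtoC (fun n => t (psi n))). apply (is_lim_seq_extraction t); [exact Hpsi|].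
  unfold t. replace (Finite 1) with (Finite (1 - 0)) by (f_equal; ring).
  apply is_lim_seq_minus'; [apply is_lim_seq_const|].
  apply is_lim_seq_inv_INR.
Qed.

(** For [Cr > 0] the other root at [w = 1] lies outside the closed disc. So [qa 1 * k - qc 1] is at
    least [g] in modulus for |k| <= 1, and [k - 1] is controlled by the variation of the
    coefficients. *)
Lemma root_near_1 (w k : nat -> C) :
  (0 < Cr)%R -> Clim w 1 ->
  (forall n, (Cmod (k n) <= 1)%R /\ disp (w n) (k n) = 0) -> Clim k 1.
Proof.
  intros HC Hw Hk.
  set (g := (Cmod (qc 1) - Cmod (qa 1))%R).
  assert (Hg : (0 < g)%R) by (unfold g; pose proof (split_at_1_pos HC); lra).
  set (e := fun n => (Cmod (qa 1 - qa (w n)) + Cmod (qb 1 - qb (w n)) + Cmod (qc 1 - qc (w n)))%R).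
  assert (He : is_lim_seq e 0%R).
  { assert (Z : forall (f : C -> C), Clim (fun n => f (w n)) (f 1) ->
      is_lim_seq (fun n => Cmod (f 1 - f (w n))) 0%R).
    { intros f Hf. replace 0%R with (Cmod (f 1 - f 1))
        by (replace (f 1 - f 1) with (RtoC 0) by ring; apply Cmod_0).
      apply Clim_Cmod. clim. }
    replace (Finite 0) with (Finite (0 + 0 + 0)) by (f_equal; ring).
    unfold e. apply is_lim_seq_plus'; [apply is_lim_seq_plus'|]; apply Z;
    [apply Clim_qa | apply Clim_qb | apply Clim_qc]; exact Hw. }
  apply Clim_of_Cmod.
  apply is_lim_seq_le_le with (fun _ => 0%R) (fun n => / g * e n)%R.
  - intros n. split; [apply Cmod_ge_0|]. destruct (Hk n) as [K1 K2].
    assert (E : (k n - 1) * (qa 1 * k n - qc 1) =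
      (qa 1 - qa (w n)) * (k n * k n) + (qb 1 - qb (w n)) * k n + (qc 1 - qc (w n))).
    { rewrite <- (is_split_disp _ _ _ _ is_split_at_1).
      transitivity (disp 1 (k n) - disp (w n) (k n)); [rewrite K2; ring | unfold disp; ring]. }
    apply Rmult_le_reg_l with g; [exact Hg|].
    rewrite <- Rmult_assoc, Rinv_r, Rmult_1_l by lra.
    apply Rle_trans with (Cmod ((k n - 1) * (qa 1 * k n - qc 1))).
    + rewrite Cmod_mult, Rmult_comm. apply Rmult_le_compat_l; [apply Cmod_ge_0|].
      assert (T := Cmod_triangle (qc 1 - qa 1 * k n) (qa 1 * k n)).
      replace (qc 1 - qa 1 * k n + qa 1 * k n) with (qc 1) in T by ring.
      replace (qa 1 * k n - qc 1) with (- (qc 1 - qa 1 * k n)) by ring.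
      rewrite Cmod_opp. rewrite Cmod_mult in T. pose proof (Cmod_ge_0 (qa 1)). unfold g. nra.
    + rewrite E. eapply Rle_trans; [apply Cmod_triangle|]. unfold e.
      apply Rplus_le_compat_r. eapply Rle_trans; [apply Cmod_triangle|].
      rewrite !Cmod_mult. pose proof (Cmod_ge_0 (k n)).
      pose proof (Cmod_ge_0 (qa 1 - qa (w n))). pose proof (Cmod_ge_0 (qb 1 - qb (w n))).
      assert (Cmod (k n) * Cmod (k n) <= 1)%R by nra. nra.
  - apply is_lim_seq_const.
  - replace (Finite 0) with (Finite (/ g * 0)) by (f_equal; ring).
    apply is_lim_seq_mult'; [apply is_lim_seq_const | exact He].
Qed.

(** The divided difference of [disp] in [w]; it replaces differentiation and the implicit function
    theorem. *)
Definition disp_dw (w w' k : C) : C :=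
  ((pX + pY + pV - pU) / 2 * k * k + (1 - pV) * k + (pX + pY + pV + pU) / 2)
  + (w + w') * (- (((pX + pY) * (1 - pV) + (pV - pU) * pX) / 2 * k * k)
     - pY * (pX + pV) * k - ((pX + pY) * (1 - pV) + (pV + pU) * pX) / 2)
  + (w * w + w * w' + w' * w') * (pX * pY * k).

Lemma disp_difference (w w' k k' : C) :
  disp w k - disp w' k' =
  (k - k') * (qa w * (k + k') + qb w) + (w - w') * disp_dw w w' k'.
Proof. unfold disp, disp_dw, qa, qb, qc, al, de, dd, tx. field. Qed.

(** These are the partial derivatives of [disp] in [k] and [w] at (1, 1); their quotient gives
    [dk / dw = 1 / Cr], the transport at velocity [Cr]. *)
Lemma disp_derivatives_at_1 :
  qa 1 * (1 + 1) + qb 1 = - RtoC (s2 * s3 * Cr) /\ disp_dw 1 1 1 = RtoC (s2 * s3).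
Proof.
  split.
  - destruct symbol_at_1 as (a & c & Ea & _ & Eb & D & _).
    rewrite Eb, Ea, <- D, RtoC_minus. ring.
  - transitivity ((1 - pX) * (1 - pY)); [unfold disp_dw; field|].
    unfold pX, pY. rewrite RtoC_mult, !RtoC_minus. ring.
Qed.

(* Near (1, 1) the stable root is compared with the root at w / |w|, which lies in the closed disc. *)
Lemma stable_root_gap :
  exists c, (0 < c)%R /\ forall w k, (Cmod w < 1)%R -> (Cmod k < 1)%R -> disp w k = 0 ->
    (c * (1 - Cmod w) <= 1 - Cmod k)%R.
Proof.
  apply NNPP. intros N.
  assert (S : forall n : nat, exists wk : C * C,
    (Cmod (fst wk) < 1)%R /\ (Cmod (snd wk) < 1)%R /\ disp (fst wk) (snd wk) = 0 /\
    (1 - Cmod (snd wk) <= / (INR n + 1) * (1 - Cmod (fst wk)))%R).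
  { intros n. apply NNPP. intros N2. apply N. exists (/ (INR n + 1))%R.
    split; [apply inv_INR_pos|].
    intros w k Hw Hk E. apply Rnot_lt_le. intros L. apply N2. exists (w, k). simpl.
    repeat split; try assumption; lra. }
  destruct (choice_sequence _ S) as [u Hu]. cbv beta in Hu.
  clear S N.
  destruct (bounded_extraction_list ((fun n => fst (u n)) :: (fun n => snd (u n)) :: nil))
    as (psi & Hpsi & L).
  { intros v Hv. exists 1%R. intros n. destruct (Hu n) as (D1 & D2 & _).
    destruct Hv as [<-|[<-|[]]]; lra. }
  destruct (L (fun n => fst (u n))) as [l Ll]; [simpl; tauto|].
  destruct (L (fun n => snd (u n))) as [m Lm]; [simpl; tauto|].
  destruct (stable_limit (fun n => fst (u (psi n))) (fun n => snd (u (psi n))) l m)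
    as (P1 & P2 & P3); [intros n; repeat split; apply (Hu (psi n)) | exact Ll | exact Lm |].
  assert (Lim0 : is_lim_seq (fun n => / (INR (psi n) + 1))%R 0%R).
  { apply (is_lim_seq_extraction (fun n => / (INR n + 1))%R); [exact Hpsi|].
    apply is_lim_seq_inv_INR. }
  assert (Pinv : forall n, (0 < / (INR n + 1))%R)
    by (intros n; apply inv_INR_pos).
  assert (M1 : (1 <= Cmod m)%R).
  { assert (G : Rbar_le (1 - 0)%R (Cmod m)); [|simpl in G; lra].
    apply (is_lim_seq_le (fun n => 1 - / (INR (psi n) + 1))%R (fun n => Cmod (snd (u (psi n))))).
    - intros n. destruct (Hu (psi n)) as (_ & _ & _ & H).
      specialize (Pinv (psi n)). pose proof (Cmod_ge_0 (fst (u (psi n)))). nra.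
    - apply is_lim_seq_minus'; [apply is_lim_seq_const | exact Lim0].
    - apply Clim_Cmod, Lm. }
  destruct P3 as [P3 | (-> & -> & HC)]; [lra|].
  assert (LC := Clim_Cmod _ _ Ll). rewrite Cmod_1 in LC.
  destruct (proj2 (is_lim_seq_spec _ _) LC (mkposreal (1 / 2) ltac:(lra))) as [n0 Hn0].
  simpl in Hn0.
  set (phi := fun n => psi (n + n0)%nat).
  set (w := fun n => fst (u (phi n))). set (k := fun n => snd (u (phi n))).
  assert (Lw : Clim w 1) by (apply (Clim_extraction _ _ _ (extraction_shift n0)) in Ll; exact Ll).
  assert (Lk : Clim k 1) by (apply (Clim_extraction _ _ _ (extraction_shift n0)) in Lm; exact Lm).
  assert (Lim1 : is_lim_seq (fun n => / (INR (phi n) + 1))%R 0%R)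
    by (apply (is_lim_seq_extraction _ _ _ (extraction_shift n0)) in Lim0; exact Lim0).
  assert (Hw0 : forall n, (1 / 2 < Cmod (w n) < 1)%R).
  { intros n. split; [|apply Hu]. specialize (Hn0 (n + n0)%nat ltac:(lia)).
    apply Rabs_def2 in Hn0. unfold w, phi. lra. }
  set (w' := fun n => RtoC (/ Cmod (w n)) * w n).
  assert (Hw' : forall n, Cmod (w' n) = 1%R).
  { intros n. unfold w'. specialize (Hw0 n). rewrite Cmod_mult, Cmod_R, Rabs_pos_eq.
    - field. lra.
    - apply Rlt_le, Rinv_0_lt_compat. lra. }
  assert (Lw' : Clim w' 1).
  { replace (RtoC 1) with (RtoC (/ Cmod 1) * 1) by (rewrite Cmod_1, Rinv_1; ring).
    apply Clim_mult; [|exact Lw]. apply (Clim_RtoC (fun n => / Cmod (w n))%R).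
    apply (is_lim_seq_inv _ (Cmod 1)); [apply Clim_Cmod, Lw|].
    rewrite Cmod_1. intros E. injection E. lra. }
  assert (K : forall n, exists x, (Cmod x <= 1)%R /\ disp (w' n) x = 0)
    by (intros n; apply unit_circle_root, Hw').
  destruct (choice_sequence _ K) as [k' Hk']. cbv beta in Hk'.
  assert (Lk' : Clim k' 1) by (apply (root_near_1 w'); assumption).
  destruct disp_derivatives_at_1 as [E1 E2].
  destruct (adm_s2 Hadm). destruct (adm_s3 Hadm).
  assert (Hs : (0 < s2 * s3)%R) by (apply Rmult_lt_0_compat; assumption).
  set (Dk := fun n => qa (w n) * (k n + k' n) + qb (w n)).
  set (Dw := fun n => disp_dw (w n) (w' n) (k' n)).
  assert (LDk : Clim Dk (- RtoC (s2 * s3 * Cr))).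
  { rewrite <- E1. unfold Dk. assert (A := Clim_qa _ _ Lw). assert (B := Clim_qb _ _ Lw). clim. }
  assert (LDw : Clim Dw (RtoC (s2 * s3))).
  { rewrite <- E2. unfold Dw, disp_dw, Cdiv. clim. }
  (* (k - k') Dk = (1 - |w|) w' Dw with Dw / Dk -> - 1 / Cr; Er measures the error of this limit. *)
  set (Er := fun n => Dk n * k' n + RtoC Cr * (w' n * Dw n)).
  assert (LEr : Clim Er 0).
  { replace (RtoC 0) with (- RtoC (s2 * s3 * Cr) * 1 + RtoC Cr * (1 * RtoC (s2 * s3)))
      by (rewrite (RtoC_mult (s2 * s3) Cr); ring).
    unfold Er. clim. }
  assert (I : forall n, RtoC Cr * (Dk n * k n) =
    RtoC (Cr - (1 - Cmod (w n))) * (Dk n * k' n) + RtoC (1 - Cmod (w n)) * Er n).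
  { intros n. assert (D := disp_difference (w n) (w' n) (k n) (k' n)).
    rewrite (proj2 (Hk' n)) in D.
    replace (disp (w n) (k n)) with (RtoC 0) in D by (symmetry; apply (Hu (phi n))).
    fold (Dk n) in D. fold (Dw n) in D.
    assert (Ew : w n = RtoC (Cmod (w n)) * w' n).
    { unfold w'. rewrite RtoC_inv by (specialize (Hw0 n); lra). field.
      intros Z. apply RtoC_inj in Z. specialize (Hw0 n). lra. }
    assert (Ew2 : w n - w' n = - (RtoC (1 - Cmod (w n)) * w' n)).
    { rewrite RtoC_minus. rewrite Ew at 1. ring. }
    rewrite Ew2 in D.
    assert (D2 : Dk n * k n = Dk n * k' n + RtoC (1 - Cmod (w n)) * w' n * Dw n).
    { transitivity ((k n - k' n) * Dk n + - (RtoC (1 - Cmod (w n)) * w' n) * Dw n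
        + Dk n * k' n + RtoC (1 - Cmod (w n)) * w' n * Dw n); [ring|].
      rewrite <- D. ring. }
    rewrite D2. unfold Er. rewrite (RtoC_minus Cr). ring. }
  (* Write [s = 1 - |w|] and [i] for the inverse integer. Moduli in [I], with |k'| <= 1 and |k| >= 1
     - i s, leave a multiple of [s]; dividing by [s] gives a bound whose limit contradicts [Dk]
     tending to [- s2 s3 Cr], which is nonzero. *)
  assert (Q : forall n, (1 - Cmod (w n) <= Cr)%R ->
    (Cmod (Dk n) <= Cr * / (INR (phi n) + 1) * Cmod (Dk n) + Cmod (Er n))%R).
  { intros n Hn. specialize (I n). apply (f_equal Cmod) in I.
    assert (J := Cmod_triangle (RtoC (Cr - (1 - Cmod (w n))) * (Dk n * k' n))
       (RtoC (1 - Cmod (w n)) * Er n)).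
    rewrite <- I in J. rewrite !Cmod_mult, !Cmod_R in J.
    specialize (Hw0 n). rewrite !Rabs_pos_eq in J by lra.
    destruct (Hk' n) as [Hk1 _].
    assert (Hk : (1 - Cmod (k n) <= / (INR (phi n) + 1) * (1 - Cmod (w n)))%R) by apply (Hu (phi n)).
    set (s := (1 - Cmod (w n))%R) in *. set (i := (/ (INR (phi n) + 1))%R) in *.
    pose proof (Cmod_ge_0 (Dk n)).
    assert (J1 : ((Cr - s) * (Cmod (Dk n) * Cmod (k' n)) <= (Cr - s) * Cmod (Dk n))%R)
      by (apply Rmult_le_compat_l; [lra | nra]).
    assert (J2 : (Cr * (Cmod (Dk n) * (1 - i * s)) <= Cr * (Cmod (Dk n) * Cmod (k n)))%R).
    { apply Rmult_le_compat_l; [lra|]. apply Rmult_le_compat_l; lra. }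
    apply Rmult_le_reg_l with s; [unfold s; lra|]. lra. }
  assert (F : (Cmod (- RtoC (s2 * s3 * Cr)) <= Cr * 0 * Cmod (- RtoC (s2 * s3 * Cr)) + Cmod 0)%R).
  { assert (LC2 := Clim_Cmod _ _ Lw). rewrite Cmod_1 in LC2.
    destruct (proj2 (is_lim_seq_spec _ _) LC2 (mkposreal Cr HC)) as [n1 Hn1]. simpl in Hn1.
    assert (LDkC := Clim_Cmod _ _ LDk).
    apply (is_lim_seq_le_loc (fun n => Cmod (Dk n))
      (fun n => Cr * / (INR (phi n) + 1) * Cmod (Dk n) + Cmod (Er n))%R
      (Cmod (- RtoC (s2 * s3 * Cr))) (Cr * 0 * Cmod (- RtoC (s2 * s3 * Cr)) + Cmod 0)%R).
    - exists n1. intros n Hn. apply Q. specialize (Hn1 n Hn). apply Rabs_def2 in Hn1. lra.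
    - exact LDkC.
    - apply is_lim_seq_plus'; [|apply Clim_Cmod, LEr].
      apply is_lim_seq_mult'; [|exact LDkC].
      apply is_lim_seq_mult'; [apply is_lim_seq_const | exact Lim1]. }
  rewrite Cmod_opp, Cmod_R, Cmod_0 in F.
  assert (0 < s2 * s3 * Cr)%R by (apply Rmult_lt_0_compat; assumption).
  rewrite Rabs_pos_eq in F by lra. lra.
Qed.

(** * The resolvent problem *)

Lemma relaxC_add3 (f g : CF3) :
  relaxC Cr s2 s3 (add3 f g) = add3 (relaxC Cr s2 s3 f) (relaxC Cr s2 s3 g).
Proof. unfold relaxC, add3; simpl. f_equal; field. Qed.

Lemma relaxC_bound :
  exists K, (0 <= K)%R /\ forall f, (norm1 (relaxC Cr s2 s3 f) <= K * norm1 f)%R.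
Proof.
  set (M := (Cmod (1 - pV) + Cmod (1 - pX - pV) + Cmod pX + Cmod pY + Cmod (pV + pU)
    + Cmod (pV - pU) + Cmod (/ 2))%R).
  pose proof (Cmod_ge_0 (1 - pV)). pose proof (Cmod_ge_0 (1 - pX - pV)).
  pose proof (Cmod_ge_0 pX). pose proof (Cmod_ge_0 pY). pose proof (Cmod_ge_0 (pV + pU)).
  pose proof (Cmod_ge_0 (pV - pU)). pose proof (Cmod_ge_0 (/ 2)).
  assert (HM : (0 <= M)%R) by (unfold M; lra).
  exists (M + M + (M + M + M) * M + (M + M + M) * M)%R. split; [nra|].
  intros f. set (n := norm1 f).
  assert (N : (Cmod (d1 f) <= n /\ Cmod (d2 f) <= n /\ Cmod (d3 f) <= n /\
     Cmod (d2 f + d3 f) <= n /\ Cmod (d2 f - d3 f) <= n /\ Cmod (d1 f + d2 f + d3 f) <= n)%R).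
  { unfold n, norm1. pose proof (Cmod_ge_0 (d1 f)). pose proof (Cmod_ge_0 (d2 f)).
    pose proof (Cmod_ge_0 (d3 f)). pose proof (Cmod_triangle (d2 f) (d3 f)).
    pose proof (Cmod_minus_le (d2 f) (d3 f) _ _ (Rle_refl _) (Rle_refl _)).
    pose proof (Cmod_triangle (d1 f + d2 f) (d3 f)). pose proof (Cmod_triangle (d1 f) (d2 f)).
    repeat split; lra. }
  destruct N as (N1 & N2 & N3 & N4 & N5 & N6).
  assert (B : forall a b c : C, (Cmod a <= M)%R -> (Cmod b <= M)%R -> (Cmod c <= M)%R ->
     (Cmod ((a * (d2 f + d3 f) + b * (d2 f - d3 f) + c * (d1 f + d2 f + d3 f)) / 2)
       <= (M + M + M) * M * n)%R).
  { intros a b c Ha Hb Hc. unfold Cdiv.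
    replace ((M + M + M) * M * n)%R with ((M * n + M * n + M * n) * M)%R by ring.
    apply Cmod_mult_le; [|unfold M; lra].
    repeat apply Cmod_plus_le; apply Cmod_mult_le; assumption. }
  replace ((M + M + (M + M + M) * M + (M + M + M) * M) * n)%R with
    ((M * n + M * n) + (M + M + M) * M * n + (M + M + M) * M * n)%R by ring.
  unfold norm1. apply Rplus_le_compat; [apply Rplus_le_compat|].
  - rewrite relaxC_d1. apply Cmod_plus_le; apply Cmod_mult_le; try assumption; unfold M; lra.
  - rewrite relaxC_d2. apply B; unfold M; lra.
  - rewrite relaxC_d3.
    replace ((pX * (d2 f + d3 f) - pY * (d2 f - d3 f) + (pV - pU) * (d1 f + d2 f + d3 f)) / 2)
      with ((pX * (d2 f + d3 f) + (- pY) * (d2 f - d3 f) + (pV - pU) * (d1 f + d2 f + d3 f)) / 2)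
      by field.
    apply B; rewrite ?Cmod_opp; unfold M; lra.
Qed.

(* The resolvent problem F = w T F + w G delta + e for the time stepping T with boundary source G. *)
Definition resolvent_eq (b : BC) (w G : C) (F e : nat -> CF3) : Prop :=
  (forall j, d1 (F j) = w * d1 (relaxC Cr s2 s3 (F j)) + d1 (e j)) /\
  (forall j, d2 (F (S j)) = w * d2 (relaxC Cr s2 s3 (F j)) + d2 (e (S j))) /\
  (forall j, d3 (F j) = w * d3 (relaxC Cr s2 s3 (F (S j))) + d3 (e j)) /\
  d2 (F O) = w * (ghostS b (fun j => relaxC Cr s2 s3 (F j)) + G) + d2 (e O).

Section Resolvent.
Variables (w k r3 v : C) (d0 M R0 c : R).
Hypothesis Hw : (Cmod w <= 1)%R.
Hypothesis Hk1 : dd w * k = w * (al w + be w * r3).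
Hypothesis Hk2 : dd w * r3 = w * k * (ga w + de w * r3).
Hypothesis Hv : is_split w k v.
Hypothesis Hd0 : (0 < d0)%R.
Hypothesis Hdd : (d0 <= Cmod (dd w))%R.
Hypothesis HM : (1 <= M)%R.
Hypothesis HMbe : (Cmod (be w) <= M)%R.
Hypothesis HMga : (Cmod (ga w) <= M)%R.
Hypothesis HMde : (Cmod (de w) <= M)%R.
Hypothesis HMdd : (Cmod (dd w) <= M)%R.
Hypothesis HMp : (Cmod ((pV + pU) / 2) <= M)%R.
Hypothesis HMm : (Cmod ((pV - pU) / 2) <= M)%R.
Hypothesis HM1 : (Cmod (1 - pX - pV) <= M)%R.
Hypothesis HR0 : (Cmod r3 <= R0)%R.
Hypothesis Hc : (0 < c < 1)%R.
Hypothesis Hkc : (Cmod k <= 1 - c)%R.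
Hypothesis Hqa : (Cmod (qa w) <= (1 - c) * Cmod v)%R.
Hypothesis Hvc : (c <= Cmod v)%R.

(** The gap [c] is absent on purpose: this constant multiplies the boundary term and must survive
    [r] tending to 1. The constants that contain [c] multiply only the source [e]. *)
Definition cst_norm : R := ((1 + M / d0) * (1 + R0) + / d0 + 1)%R.

Let cst_norm_ge_0 : (0 <= cst_norm)%R.
Proof.
  unfold cst_norm. assert (0 < / d0)%R by (apply Rinv_0_lt_compat, Hd0).
  assert (0 < M / d0)%R by (apply Rdiv_lt_0_compat; lra). pose proof (Cmod_ge_0 r3).
  assert (0 <= (1 + M / d0) * (1 + R0))%R by (apply Rmult_le_pos; lra). lra.
Qed.

Lemma norm1_from_pair (f : CF3) (y e : C) :
  dd w * d1 f = w * (1 - pX - pV) * (d2 f + d3 f) + e -> d3 f = y + r3 * d2 f ->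
  (norm1 f <= cst_norm * (Cmod (d2 f) + Cmod y + Cmod e))%R.
Proof.
  intros H1 H3. pose proof (Cmod_ge_0 r3). pose proof (Cmod_ge_0 y).
  pose proof (Cmod_ge_0 e). pose proof (Cmod_ge_0 (d2 f)).
  assert (Pd : (0 < / d0)%R) by (apply Rinv_0_lt_compat, Hd0).
  assert (B3 : (Cmod (d3 f) <= Cmod y + R0 * Cmod (d2 f))%R).
  { rewrite H3. apply Cmod_plus_le; [lra|]. apply Cmod_mult_le; lra. }
  assert (B1 : (Cmod (d1 f) <= / d0 * (M * (Cmod (d2 f) + Cmod (d3 f)) + Cmod e))%R).
  { apply Rmult_le_reg_l with d0; [exact Hd0|].
    rewrite <- Rmult_assoc, Rinv_r, Rmult_1_l by lra.
    apply Rle_trans with (Cmod (dd w * d1 f)).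
    - rewrite Cmod_mult. apply Rmult_le_compat_r; [apply Cmod_ge_0 | exact Hdd].
    - rewrite H1. apply Cmod_plus_le; [|lra]. apply Cmod_mult_le; [|apply Cmod_triangle].
      rewrite <- (Rmult_1_l M). apply Cmod_mult_le; assumption. }
  set (a := Cmod (d2 f)) in *. set (p := Cmod y) in *. set (q := Cmod e) in *.
  unfold norm1. fold a.
  assert (S23 : (a + Cmod (d3 f) <= (1 + R0) * (a + p))%R) by nra.
  apply Rle_trans with ((1 + M / d0) * ((1 + R0) * (a + p)) + / d0 * q)%R.
  - apply Rle_trans with ((1 + M / d0) * (a + Cmod (d3 f)) + / d0 * q)%R.
    + unfold Rdiv. lra.
    + apply Rplus_le_compat_r, Rmult_le_compat_l; [|exact S23].
      assert (0 < M / d0)%R by (apply Rdiv_lt_0_compat; lra). lra.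
  - unfold cst_norm.
    assert (0 <= (1 + M / d0) * (1 + R0))%R.
    { assert (0 < M / d0)%R by (apply Rdiv_lt_0_compat; lra). apply Rmult_le_pos; lra. }
    nra.
Qed.

Variables (F e : nat -> CF3).
Hypothesis HF1 : forall j, d1 (F j) = w * d1 (relaxC Cr s2 s3 (F j)) + d1 (e j).
Hypothesis HF2 : forall j, d2 (F (S j)) = w * d2 (relaxC Cr s2 s3 (F j)) + d2 (e (S j)).
Hypothesis HF3 : forall j, d3 (F j) = w * d3 (relaxC Cr s2 s3 (F (S j))) + d3 (e j).

(* y vanishes on the stable mode, so it is governed by the outer root v / qa w. *)
Let y (j : nat) : C := d3 (F j) - r3 * d2 (F j).
Let n (j : nat) : R := norm1 (e j).
Let h2 (j : nat) : C := w * ((pV + pU) / 2) * d1 (e j) + dd w * d2 (e (S j)).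
Let h3 (j : nat) : C := w * ((pV - pU) / 2) * d1 (e (S j)) + dd w * d3 (e j).

Lemma resolvent_d1 (j : nat) :
  dd w * d1 (F j) = w * (1 - pX - pV) * (d2 (F j) + d3 (F j)) + d1 (e j).
Proof.
  assert (H := HF1 j). rewrite relaxC_d1 in H. unfold dd.
  transitivity (d1 (F j) - (1 - pV) * w * d1 (F j)); [ring|]. rewrite H at 1. ring.
Qed.

Lemma resolvent_d2 (j : nat) :
  dd w * d2 (F (S j)) = dd w * k * d2 (F j) + w * be w * y j + h2 j.
Proof.
  rewrite HF2, Hk1.
  transitivity (w * (dd w * d2 (relaxC Cr s2 s3 (F j))) + dd w * d2 (e (S j))); [ring|].
  rewrite (dd_relaxC_d2 _ _ _ (resolvent_d1 j)). unfold y, h2. ring.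
Qed.

Lemma resolvent_d3 (j : nat) :
  dd w * d3 (F j) = w * (ga w + de w * r3) * d2 (F (S j)) + w * de w * y (S j) + h3 j.
Proof.
  rewrite HF3 at 1.
  transitivity (w * (dd w * d3 (relaxC Cr s2 s3 (F (S j)))) + dd w * d3 (e j)); [ring|].
  rewrite (dd_relaxC_d3 _ _ _ (resolvent_d1 (S j))). unfold y, h3. ring.
Qed.

(** Diagonalisation of the spatial recursion: [y] follows the outer root [v / qa w], so it is solved
    backwards, with contraction factor |qa w| / |v|. *)
Lemma resolvent_y (j : nat) :
  dd w * (v * y j) = dd w * (qa w * y (S j)) + (w * (ga w + de w * r3) * h2 j + dd w * h3 j).
Proof.
  assert (K : dd w * v = dd w * dd w - w * w * be w * (ga w + de w * r3)).
  { destruct Hv as [V _].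
    transitivity (- (dd w * qb w) - (dd w * k) * qa w); [rewrite V; ring|].
    rewrite Hk1. unfold qa, qb, al, be, ga, de. field. }
  transitivity ((dd w * v) * y j); [ring|]. rewrite K.
  transitivity (dd w * (dd w * d3 (F j)) - dd w * (dd w * r3) * d2 (F j)
    - w * w * be w * (ga w + de w * r3) * y j); [unfold y; ring|].
  rewrite resolvent_d3, Hk2.
  transitivity (w * (ga w + de w * r3) * (dd w * d2 (F (S j))) + dd w * (w * de w * y (S j) + h3 j)
    - dd w * (w * k * (ga w + de w * r3)) * d2 (F j) - w * w * be w * (ga w + de w * r3) * y j); [ring|].
  rewrite resolvent_d2. unfold qa. ring.
Qed.

Let n_ge_0 (j : nat) : (0 <= n j)%R := norm1_ge_0 (e j).

Let comp_le (j : nat) : (Cmod (d1 (e j)) <= n j /\ Cmod (d2 (e j)) <= n j /\ Cmod (d3 (e j)) <= n j)%R.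
Proof.
  unfold n, norm1. pose proof (Cmod_ge_0 (d1 (e j))).
  pose proof (Cmod_ge_0 (d2 (e j))). pose proof (Cmod_ge_0 (d3 (e j))). lra.
Qed.

Let h2_le (j : nat) : (Cmod (h2 j) <= M * (n j + n (S j)))%R.
Proof.
  unfold h2. rewrite Rmult_plus_distr_l. apply Cmod_plus_le.
  - apply Cmod_mult_le; [|apply comp_le]. rewrite <- (Rmult_1_l M).
    apply Cmod_mult_le; assumption.
  - apply Cmod_mult_le; [assumption | apply comp_le].
Qed.

Let h3_le (j : nat) : (Cmod (h3 j) <= M * (n j + n (S j)))%R.
Proof.
  unfold h3. rewrite Rplus_comm, Rmult_plus_distr_l. apply Cmod_plus_le.
  - apply Cmod_mult_le; [|apply comp_le]. rewrite <- (Rmult_1_l M).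
    apply Cmod_mult_le; assumption.
  - apply Cmod_mult_le; [assumption | apply comp_le].
Qed.

Definition cst_y : R := ((M * (1 + R0) * M + M * M) / d0 / c)%R.

Lemma resolvent_y_step (j : nat) :
  (Cmod (y j) <= (1 - c) * Cmod (y (S j)) + cst_y * (n j + n (S j)))%R.
Proof.
  assert (E := f_equal Cmod (resolvent_y j)). rewrite !Cmod_mult in E.
  set (H := (w * (ga w + de w * r3) * h2 j + dd w * h3 j)) in *.
  assert (BH : (Cmod H <= (M * (1 + R0) * M + M * M) * (n j + n (S j)))%R).
  { unfold H. rewrite Rmult_plus_distr_r. apply Cmod_plus_le.
    - rewrite Rmult_assoc. apply Cmod_mult_le; [|apply h2_le].
      rewrite <- (Rmult_1_l (M * (1 + R0))). apply Cmod_mult_le; [exact Hw|].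
      replace (M * (1 + R0))%R with (M + M * R0)%R by ring.
      apply Cmod_plus_le; [assumption | apply Cmod_mult_le; assumption].
    - rewrite Rmult_assoc. apply Cmod_mult_le; [assumption | apply h3_le]. }
  assert (T := Cmod_triangle (dd w * (qa w * y (S j))) H).
  rewrite <- E in T. rewrite !Cmod_mult in T.
  set (D := Cmod (dd w)) in *. set (V := Cmod v) in *. set (Y := Cmod (y j)) in *.
  set (Y1 := Cmod (y (S j))) in *. set (s := (n j + n (S j))%R) in *.
  set (B := (M * (1 + R0) * M + M * M)%R) in *.
  assert (HY1 : (0 <= Y1)%R) by apply Cmod_ge_0.
  assert (HY : (0 <= Y)%R) by apply Cmod_ge_0.
  assert (Hs : (0 <= s)%R) by (unfold s; pose proof (n_ge_0 j); pose proof (n_ge_0 (S j)); lra).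
  assert (HB : (0 <= B)%R) by (unfold B; pose proof (Cmod_ge_0 r3); apply Rplus_le_le_0_compat; repeat apply Rmult_le_pos; lra).
  assert (HDV : (d0 * c <= D * V)%R) by (apply Rmult_le_compat; lra).
  assert (Hdc : (0 < d0 * c)%R) by (apply Rmult_lt_0_compat; lra).
  assert (T2 : (D * V * Y <= D * V * ((1 - c) * Y1) + B * s)%R).
  { apply Rle_trans with (D * (Cmod (qa w) * Y1) + B * s)%R; [lra|].
    apply Rplus_le_compat_r. rewrite !Rmult_assoc. apply Rmult_le_compat_l; [lra|].
    rewrite <- Rmult_assoc, (Rmult_comm V). apply Rmult_le_compat_r; assumption. }
  assert (Bs : (0 <= B * s)%R) by (apply Rmult_le_pos; assumption).
  assert (T3 : (D * V * (Y - (1 - c) * Y1) <= B * s)%R) by lra.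
  replace (cst_y * s)%R with (B * s / (d0 * c))%R by (unfold cst_y; fold B; field; lra).
  destruct (Rle_lt_dec (Y - (1 - c) * Y1) 0) as [L|L].
  - assert (0 <= B * s / (d0 * c))%R
      by (apply Rmult_le_pos; [exact Bs | apply Rlt_le, Rinv_0_lt_compat, Hdc]). lra.
  - assert (Y - (1 - c) * Y1 <= B * s / (d0 * c))%R; [|lra].
    apply Rmult_le_reg_l with (d0 * c)%R; [exact Hdc|].
    replace (d0 * c * (B * s / (d0 * c)))%R with (B * s)%R by (field; lra).
    apply Rle_trans with (2 := T3). apply Rmult_le_compat_r; lra.
Qed.

Definition cst_d2 : R := (M / d0)%R.

Lemma resolvent_d2_step (s : C) (D : nat -> C) :
  (forall j, D j = d2 (F j) - s * Defs.Cpow k j) -> forall j,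
  (Cmod (D (S j)) <= Cmod k * Cmod (D j) + cst_d2 * (Cmod (y j) + (n j + n (S j))))%R.
Proof.
  intros HD j.
  assert (E : dd w * D (S j) = dd w * (k * D j) + (w * be w * y j + h2 j)).
  { rewrite !HD. transitivity (dd w * d2 (F (S j)) - dd w * (s * Defs.Cpow k (S j))); [ring|].
    rewrite resolvent_d2. simpl. ring. }
  assert (B : (Cmod (w * be w * y j + h2 j) <= M * (Cmod (y j) + (n j + n (S j))))%R).
  { rewrite Rmult_plus_distr_l. apply Cmod_plus_le; [|apply h2_le].
    apply Cmod_mult_le; [|lra]. rewrite <- (Rmult_1_l M). apply Cmod_mult_le; assumption. }
  assert (T := Cmod_triangle (dd w * (k * D j)) (w * be w * y j + h2 j)).
  rewrite <- E, !Cmod_mult in T.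
  set (q := Cmod (w * be w * y j + h2 j)) in *.
  assert (Hq : (0 <= q)%R) by apply Cmod_ge_0.
  set (p := Cmod (D (S j))) in *. set (p' := (Cmod k * Cmod (D j))%R) in *.
  assert (Cmod (dd w) * (p - p') <= q)%R by lra.
  assert (p - p' <= q / d0)%R.
  { apply Rmult_le_reg_l with d0; [exact Hd0|].
    replace (d0 * (q / d0))%R with q by (field; lra).
    destruct (Rle_lt_dec (p - p') 0); nra. }
  assert (q / d0 <= cst_d2 * (Cmod (y j) + (n j + n (S j))))%R; [|lra].
  unfold cst_d2, Rdiv. rewrite Rmult_assoc, (Rmult_comm (/ d0)), <- Rmult_assoc.
  apply Rmult_le_compat_r; [apply Rlt_le, Rinv_0_lt_compat, Hd0 | exact B].
Qed.

Variable J : nat.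
Hypothesis HFJ : forall j, (J <= j)%nat -> norm1 (F j) = 0%R.
Hypothesis HeJ : forall j, (J <= j)%nat -> norm1 (e j) = 0%R.

Let Se : R := fsum J (fun j => n j ^ 2)%R.

Let shift_sum (u : nat -> R) : u J = 0%R -> (fsum J (fun j => u (S j) ^ 2) <= fsum J (fun j => u j ^ 2))%R.
Proof.
  intros H. rewrite (fsum_shift J (fun j => u j ^ 2)%R), fsum_S, H. pose proof (pow2_ge_0 (u O)). lra.
Qed.

Let yJ (j : nat) : (J <= j)%nat -> y j = 0.
Proof.
  intros Hj. assert (H := HFJ j Hj). unfold norm1 in H.
  pose proof (Cmod_ge_0 (d1 (F j))). pose proof (Cmod_ge_0 (d2 (F j))).
  pose proof (Cmod_ge_0 (d3 (F j))).
  unfold y. rewrite (Cmod_eq_0 (d2 (F j))), (Cmod_eq_0 (d3 (F j))) by lra. ring.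
Qed.

Definition cst_sy : R := (4 * (cst_y / c) ^ 2)%R.

Lemma resolvent_y_sum : (fsum J (fun j => Cmod (y j) ^ 2) <= cst_sy * Se)%R.
Proof.
  eapply Rle_trans.
  - apply (backward_recursion_l2 J (1 - c) (fun j => Cmod (y j)) (fun j => cst_y * (n j + n (S j)))%R).
    + lra.
    + intros; apply Cmod_ge_0.
    + rewrite yJ, Cmod_0 by lia. reflexivity.
    + exact resolvent_y_step.
  - replace (1 - (1 - c))%R with c by ring.
    apply Rle_trans with (fsum J (fun j => cst_y ^ 2 * (2 * n j ^ 2 + 2 * n (S j) ^ 2))%R / c ^ 2)%R.
    + apply Rmult_le_compat_r; [apply Rlt_le, Rinv_0_lt_compat, pow_lt; lra|].
      apply fsum_le. intros m _. rewrite Rpow_mult_distr.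
      apply Rmult_le_compat_l; [apply pow2_ge_0|].
      pose proof (pow2_ge_0 (n m - n (S m))). lra.
    + rewrite fsum_scal, fsum_plus, !fsum_scal. fold Se.
      assert (Q := shift_sum n (HeJ J (le_n J))). fold Se in Q.
      replace (cst_sy * Se)%R with (cst_y ^ 2 * (2 * Se + 2 * Se) / c ^ 2)%R
        by (unfold cst_sy; field; lra).
      apply Rmult_le_compat_r; [apply Rlt_le, Rinv_0_lt_compat, pow_lt; lra|].
      apply Rmult_le_compat_l; [apply pow2_ge_0 | lra].
Qed.

Let Y_le (j : nat) : (Cmod (y j) <= sqrt (cst_sy * Se))%R.
Proof.
  destruct (Nat.lt_ge_cases j J) as [L|L].
  - rewrite <- (sqrt_pow2 (Cmod (y j))) by apply Cmod_ge_0.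
    apply sqrt_le_1_alt. eapply Rle_trans; [|apply resolvent_y_sum].
    apply (fsum_term_le J j (fun j => Cmod (y j) ^ 2)%R); [intros; apply pow2_ge_0 | exact L].
  - rewrite yJ, Cmod_0 by exact L. apply sqrt_pos.
Qed.

Let N_le (j : nat) : (n j <= sqrt Se)%R.
Proof.
  destruct (Nat.lt_ge_cases j J) as [L|L].
  - rewrite <- (sqrt_pow2 (n j)) by apply n_ge_0.
    apply sqrt_le_1_alt.
    apply (fsum_term_le J j (fun j => n j ^ 2)%R); [intros; apply pow2_ge_0 | exact L].
  - unfold n. rewrite HeJ by exact L. apply sqrt_pos.
Qed.

Let sum3 (a b d : R) : ((a + b + d) ^ 2 <= 3 * (a ^ 2 + b ^ 2 + d ^ 2))%R.
Proof.
  pose proof (pow2_ge_0 (a - b)). pose proof (pow2_ge_0 (a - d)). pose proof (pow2_ge_0 (b - d)). lra.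
Qed.

Definition cst_sum : R :=
  (3 * cst_norm ^ 2 * ((cst_d2 / c) ^ 2 * (3 * (cst_sy + 2)) + cst_sy + 1))%R.

Lemma resolvent_sum :
  (fsum J (fun j => norm1 (F j) ^ 2)
    <= 3 * cst_norm ^ 2 * (Cmod (d2 (F O)) ^ 2 / (1 - Cmod k)) + cst_sum * Se)%R.
Proof.
  assert (S2 : (fsum J (fun j => Cmod (d2 (F j)) ^ 2) <= Cmod (d2 (F O)) ^ 2 / (1 - Cmod k)
     + (cst_d2 / c) ^ 2 * (3 * (cst_sy + 2)) * Se)%R).
  { eapply Rle_trans.
    - apply (forward_recursion_l2 J (Cmod k) (fun j => Cmod (d2 (F j)))
        (fun j => cst_d2 * (Cmod (y j) + (n j + n (S j))))%R).
      + pose proof (Cmod_ge_0 k). lra.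
      + intros; apply Cmod_ge_0.
      + intros j. apply (resolvent_d2_step 0 (fun j => d2 (F j))). intros; ring.
    - apply Rplus_le_compat_l.
      apply Rle_trans with (fsum J (fun j => cst_d2 ^ 2 *
        (3 * (Cmod (y j) ^ 2 + n j ^ 2 + n (S j) ^ 2))) / c ^ 2)%R.
      + unfold Rdiv. apply Rmult_le_compat.
        * apply fsum_nonneg. intros; apply pow2_ge_0.
        * apply Rlt_le, Rinv_0_lt_compat, pow_lt. lra.
        * apply fsum_le. intros m _. rewrite Rpow_mult_distr.
          apply Rmult_le_compat_l; [apply pow2_ge_0|]. rewrite <- Rplus_assoc. apply sum3.
        * apply Rinv_le_contravar; [apply pow_lt; lra|]. apply pow_incr. lra.
      + rewrite !fsum_scal, !fsum_plus. fold Se.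
        assert (Q := shift_sum n (HeJ J (le_n J))). fold Se in Q.
        assert (Q2 := resolvent_y_sum).
        replace ((cst_d2 / c) ^ 2 * (3 * (cst_sy + 2)) * Se)%R
          with (cst_d2 ^ 2 * (3 * (cst_sy * Se + Se + Se)) / c ^ 2)%R by (field; lra).
        apply Rmult_le_compat_r; [apply Rlt_le, Rinv_0_lt_compat, pow_lt; lra|].
        apply Rmult_le_compat_l; [apply pow2_ge_0 | lra]. }
  apply Rle_trans with (fsum J (fun j => 3 * cst_norm ^ 2 *
    (Cmod (d2 (F j)) ^ 2 + Cmod (y j) ^ 2 + n j ^ 2))%R).
  - apply fsum_le. intros j _.
    assert (B := norm1_from_pair (F j) (y j) (d1 (e j)) (resolvent_d1 j)).
    specialize (B ltac:(unfold y; ring)).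
    apply Rle_trans with ((cst_norm * (Cmod (d2 (F j)) + Cmod (y j) + n j)) ^ 2)%R.
    + apply pow_incr. split; [apply norm1_ge_0|]. eapply Rle_trans; [exact B|].
      apply Rmult_le_compat_l.
      * exact cst_norm_ge_0.
      * pose proof (proj1 (comp_le j)). lra.
    + rewrite Rpow_mult_distr, (Rmult_comm 3), Rmult_assoc.
      apply Rmult_le_compat_l; [apply pow2_ge_0 | apply sum3].
  - rewrite fsum_scal, !fsum_plus. fold Se. assert (Q2 := resolvent_y_sum).
    match goal with |- (_ <= _ * ?x + _)%R =>
      replace (3 * cst_norm ^ 2 * x + cst_sum * Se)%R with
        (3 * cst_norm ^ 2 * (x + ((cst_d2 / c) ^ 2 * (3 * (cst_sy + 2)) + cst_sy + 1) * Se))%R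
        by (unfold cst_sum; ring) end.
    apply Rmult_le_compat_l; [apply Rmult_le_pos; [lra | apply pow2_ge_0]|]. lra.
Qed.

Variable psi : C.
Hypothesis Hpsi : dd w * psi = w * (1 - pX - pV) * (1 + r3).
Let phi : CF3 := mkCF3 psi 1 r3.
Let eta (j : nat) : CF3 := add3 (F j) (scale3 (- (d2 (F O) * Defs.Cpow k j)) phi).

Definition cst_eta (L : R) : R :=
  (cst_norm * (L * (cst_d2 * (sqrt cst_sy + 2)) + sqrt cst_sy + 1))%R.

(** [eta] is [F] minus the multiple of the stable mode with the same incoming population in the
    first cell. So [d2 (eta 0) = 0], and with |k| < 1 the errors add up at most linearly in [j]. *)
Lemma resolvent_eta (j : nat) : (norm1 (eta j) <= cst_eta (INR j) * sqrt Se)%R.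
Proof.
  assert (Hcd : (0 <= cst_d2)%R) by (apply Rlt_le, Rdiv_lt_0_compat; lra).
  assert (SY : forall j, (Cmod (y j) <= sqrt cst_sy * sqrt Se)%R).
  { intros i. rewrite <- sqrt_mult_alt; [apply Y_le|]. unfold cst_sy. pose proof (pow2_ge_0 (cst_y / c)). lra. }
  assert (HD : forall i, (Cmod (d2 (eta i)) <= INR i * (cst_d2 * (sqrt cst_sy + 2)) * sqrt Se)%R).
  { induction i as [|i IH].
    - replace (d2 (eta O)) with (RtoC 0) by (simpl; ring). rewrite Cmod_0. simpl. lra.
    - eapply Rle_trans.
      + apply (resolvent_d2_step (d2 (F O)) (fun j => d2 (eta j))). intros m. simpl. ring.
      + rewrite S_INR.
        assert (Cmod k * Cmod (d2 (eta i)) <= Cmod (d2 (eta i)))%R.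
        { pose proof (Cmod_ge_0 (d2 (eta i))). pose proof (Cmod_ge_0 k). nra. }
        assert (cst_d2 * (Cmod (y i) + (n i + n (S i))) <= cst_d2 * ((sqrt cst_sy + 2) * sqrt Se))%R.
        { apply Rmult_le_compat_l; [exact Hcd|]. specialize (SY i).
          pose proof (N_le i). pose proof (N_le (S i)). lra. }
        lra. }
  assert (B := norm1_from_pair (eta j) (y j) (d1 (e j))).
  eapply Rle_trans; [apply B|].
  - transitivity (dd w * d1 (F j) - d2 (F O) * Defs.Cpow k j * (dd w * psi)); [simpl; ring|].
    rewrite resolvent_d1, Hpsi. simpl. ring.
  - unfold y. simpl. ring.
  - unfold cst_eta. rewrite Rmult_assoc. apply Rmult_le_compat_l.
    + exact cst_norm_ge_0.
    + specialize (HD j). specialize (SY j). pose proof (N_le j). pose proof (proj1 (comp_le j)). lra.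
Qed.

(** Inserting the stable mode plus [eta] into the boundary condition leaves the residual times the
    amplitude [d2 (F O)]; the part due to [eta] is of the size of the source [e]. *)
Lemma resolvent_boundary (b : BC) (G : C) (KR Kb : R) (L : nat) :
  (0 <= KR)%R -> (forall f, (norm1 (relaxC Cr s2 s3 f) <= KR * norm1 f)%R) ->
  (0 <= Kb)%R ->
  (forall fs B, (forall j, (j <= L)%nat -> (norm1 (fs j) <= B)%R) -> (Cmod (ghostS b fs) <= Kb * B)%R) ->
  d2 (F O) = w * (ghostS b (fun j => relaxC Cr s2 s3 (F j)) + G) + d2 (e O) ->
  (Cmod (d2 (F O) * resid b w k phi - w * G) <=
     (1 + Kb * (KR * cst_eta (INR L))) * sqrt Se)%R.
Proof.
  intros HKR0 HKR HKb0 HKb HF0.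
  assert (E : ghostS b (fun j => relaxC Cr s2 s3 (F j)) =
    d2 (F O) * ghostC b k (relaxC Cr s2 s3 phi) + ghostS b (fun j => relaxC Cr s2 s3 (eta j))).
  { assert (Z : ghostS b (fun j => relaxC Cr s2 s3 (eta j)) =
      ghostS b (fun j => relaxC Cr s2 s3 (F j)) + - d2 (F O) * ghostC b k (relaxC Cr s2 s3 phi)).
    { rewrite <- (ghostS_mode b k (- d2 (F O))), <- ghostS_add.
      unfold eta.
      assert (X : forall fs gs, (forall j, fs j = gs j) -> ghostS b fs = ghostS b gs).
      { clear. intros fs gs H. destruct b; simpl; rewrite ?H; try reflexivity.
        generalize sigma at 1 3. intros N. induction N as [|N IH]; simpl; [reflexivity|].
        rewrite IH, H. reflexivity. }
      apply X. intros j. rewrite relaxC_add3, relaxC_scale3. f_equal. f_equal. ring. }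
    rewrite Z. ring. }
  rewrite E in HF0.
  replace (d2 (F O) * resid b w k phi - w * G) with
    (d2 (e O) + w * ghostS b (fun j => relaxC Cr s2 s3 (eta j))).
  2:{ unfold resid. change (d2 phi) with (RtoC 1).
      transitivity (d2 (F O) - (d2 (F O) - (d2 (e O) + w * ghostS b (fun j => relaxC Cr s2 s3 (eta j)))));
        [ring|]. rewrite HF0 at 2. ring. }
  rewrite Rmult_plus_distr_r. apply Cmod_plus_le.
  - rewrite Rmult_1_l. eapply Rle_trans; [apply comp_le | apply N_le].
  - rewrite <- (Rmult_1_l (Kb * _ * _)). apply Cmod_mult_le; [exact Hw|].
    rewrite Rmult_assoc. apply HKb. intros j Hj.
    eapply Rle_trans; [apply HKR|]. rewrite Rmult_assoc. apply Rmult_le_compat_l; [exact HKR0|].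
    eapply Rle_trans; [apply resolvent_eta|]. apply Rmult_le_compat_r; [apply sqrt_pos|].
    unfold cst_eta. apply Rmult_le_compat_l.
    + exact cst_norm_ge_0.
    + assert (0 <= cst_d2 * (sqrt cst_sy + 2))%R.
      { apply Rmult_le_pos; [apply Rlt_le, Rdiv_lt_0_compat; lra|]. pose proof (sqrt_pos cst_sy). lra. }
      apply le_INR in Hj. nra.
Qed.
End Resolvent.

(** The order of quantifiers carries the argument: [K0] and [cg] are chosen before [r], whereas
    [C0], which multiplies only the terms in [e], may blow up as [r] tends to 1. *)
Lemma resolvent_estimates (b : BC) :
  exists K0 cg, (0 < K0)%R /\ (0 < cg)%R /\ forall r, (r < 1)%R -> exists C0, (0 <= C0)%R /\
  forall w, (Cmod w <= r)%R -> exists k phi,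
    (Cmod k < 1)%R /\ bulk_w w k phi /\ d2 phi = 1 /\ (cg * (1 - Cmod w) <= 1 - Cmod k)%R /\
    forall F e G J, resolvent_eq b w G F e ->
      (forall j, (J <= j)%nat -> norm1 (F j) = 0%R) ->
      (forall j, (J <= j)%nat -> norm1 (e j) = 0%R) ->
      (Cmod (d2 (F O) * resid b w k phi - w * G) <= C0 * sqrt (fsum J (fun j => norm1 (e j) ^ 2)))%R /\
      (norm1 (add3 (F O) (scale3 (- d2 (F O)) phi)) <= C0 * sqrt (fsum J (fun j => norm1 (e j) ^ 2)))%R /\
      (fsum J (fun j => norm1 (F j) ^ 2) <= K0 * (Cmod (d2 (F O)) ^ 2 / (1 - Cmod k))
         + C0 * fsum J (fun j => norm1 (e j) ^ 2))%R.
Proof.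
  destruct dd_lower_bound as (d0 & Hd0 & Hdd).
  destruct symbol_upper_bound as (M0 & HM0 & HM).
  (* For kinetic Dirichlet the residual is [d2 phi]. Its lower bound is used, whatever [b] is, to
     bound the ratio of [d3 phi] to [d2 phi] uniformly in the open unit disc. *)
  destruct (uniform_kreiss_lopatinskii KineticDirichlet I) as (ck & Hck & HKD).
  destruct stable_root_gap as (cg & Hcg & Hgap).
  destruct relaxC_bound as (KR & HKR0 & HKR).
  destruct (ghostS_bound b) as (Kb & L & HKb0 & HKb).
  set (M := (M0 + Cmod ((pV + pU) / 2) + Cmod ((pV - pU) / 2) + Cmod (1 - pX - pV))%R).
  pose proof (Cmod_ge_0 ((pV + pU) / 2)). pose proof (Cmod_ge_0 ((pV - pU) / 2)).
  pose proof (Cmod_ge_0 (1 - pX - pV)).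
  set (R0 := (/ ck)%R).
  assert (HR0 : (0 < R0)%R) by (apply Rinv_0_lt_compat, Hck).
  exists (3 * cst_norm d0 M R0 ^ 2 + 1)%R, cg.
  split; [pose proof (pow2_ge_0 (cst_norm d0 M R0)); lra|]. split; [exact Hcg|].
  intros r Hr. destruct (disc_split_gap r Hr) as (c & Hc & Hsplit).
  set (Ce := cst_eta d0 M R0 c).
  exists (Rabs (1 + Kb * (KR * Ce (INR L))) + Rabs (Ce (INR 0)) + Rabs (cst_sum d0 M R0 c))%R.
  pose proof (Rle_abs (1 + Kb * (KR * Ce (INR L)))). pose proof (Rle_abs (Ce (INR 0))).
  pose proof (Rle_abs (cst_sum d0 M R0 c)).
  pose proof (Rabs_pos (1 + Kb * (KR * Ce (INR L)))). pose proof (Rabs_pos (Ce (INR 0))).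
  pose proof (Rabs_pos (cst_sum d0 M R0 c)).
  split; [lra|]. intros w Hw.
  assert (Hw1 : (Cmod w < 1)%R) by lra.
  destruct (stable_split w Hw1) as (k & v & Hk & Hv & Hs).
  assert (Hdisp : disp w k = 0) by (rewrite (is_split_disp _ _ _ _ Hs); ring).
  destruct (bulk_w_exists w k (Rlt_le _ _ Hw1) Hdisp) as (f0 & B0).
  assert (N0 := stable_mode_d2_neq_0 _ _ _ (Rlt_le _ _ Hw1) Hk B0).
  set (phi := scale3 (/ d2 f0) f0).
  assert (B : bulk_w w k phi).
  { apply bulk_w_scale3; [|exact B0]. intros E. apply C1_nz.
    rewrite <- (Cinv_l _ N0), E. ring. }
  assert (P2 : d2 phi = 1) by (simpl; apply Cinv_l, N0).
  exists k, phi. split; [exact Hk|]. split; [exact B|]. split; [exact P2|].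
  split; [apply (Hgap w k Hw1 Hk Hdisp)|].
  intros F e G J (E1 & E2 & E3 & E4) SF SE.
  destruct (HM w (Rlt_le _ _ Hw1)) as (_ & HMbe & HMga & HMde & HMdd & _).
  destruct (bulk_w_pair _ _ _ B) as [Q2 Q3]. assert (Q1 := bulk_w_d1 _ _ _ B).
  rewrite P2 in Q1, Q2, Q3.
  destruct (Hsplit w k v Hw Hk Hv Hs) as (G1 & G2 & G3).
  assert (Hr3 : (Cmod (d3 phi) <= R0)%R).
  { specialize (HKD w k phi Hw1 Hk B). unfold resid, ghostC in HKD.
    rewrite P2 in HKD. replace (1 - w * 0) with (RtoC 1) in HKD by ring.
    rewrite Cmod_1 in HKD.
    apply Rmult_le_reg_l with ck; [exact Hck|]. unfold R0. rewrite Rinv_r by lra.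
    apply Rle_trans with (2 := HKD). apply Rmult_le_compat_l; [lra|].
    unfold norm1. pose proof (Cmod_ge_0 (d1 phi)). pose proof (Cmod_ge_0 (d2 phi)). lra. }
  assert (A1 : dd w * k = w * (al w + be w * d3 phi))
    by (transitivity (dd w * (k * 1)); [ring | rewrite Q2; ring]).
  assert (A2 : dd w * d3 phi = w * k * (ga w + de w * d3 phi)) by (rewrite Q3 at 1; ring).
  assert (Ephi : phi = mkCF3 (d1 phi) 1 (d3 phi)).
  { unfold phi in *. unfold scale3 in *. simpl in *. rewrite P2. reflexivity. }
  assert (U1 : (Cmod w <= 1)%R) by lra.
  assert (U2 : (d0 <= Cmod (dd w))%R) by (apply Hdd; exact U1).
  assert (U3 : (1 <= M)%R) by (unfold M; lra).
  assert (U4 : (Cmod (be w) <= M)%R) by (unfold M; lra).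
  assert (U5 : (Cmod (ga w) <= M)%R) by (unfold M; lra).
  assert (U6 : (Cmod (de w) <= M)%R) by (unfold M; lra).
  assert (U7 : (Cmod (dd w) <= M)%R) by (unfold M; lra).
  assert (U8 : (Cmod ((pV + pU) / 2) <= M)%R) by (unfold M; lra).
  assert (U9 : (Cmod ((pV - pU) / 2) <= M)%R) by (unfold M; lra).
  assert (U10 : (Cmod (1 - pX - pV) <= M)%R) by (unfold M; lra).
  set (Se := fsum J (fun j => norm1 (e j) ^ 2)%R).
  assert (HSe : (0 <= Se)%R) by (apply fsum_nonneg; intros; apply pow2_ge_0).
  pose proof (sqrt_pos Se).
  assert (T1 := resolvent_boundary w k (d3 phi) v d0 M R0 c U1 A1 A2 Hs Hd0 U2 U3 U4 U5 U6 U7 U8 U9 U10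
    Hr3 Hc G1 G2 G3 F e E1 E2 E3 J SF SE (d1 phi) Q1 b G KR Kb L HKR0 HKR HKb0 HKb E4).
  assert (T2 := resolvent_eta w k (d3 phi) v d0 M R0 c U1 A1 A2 Hs Hd0 U2 U3 U4 U5 U6 U7 U8 U9 U10
    Hr3 Hc G1 G2 G3 F e E1 E2 E3 J SF SE (d1 phi) Q1 O).
  assert (T3 := resolvent_sum w k (d3 phi) v d0 M R0 c U1 A1 A2 Hs Hd0 U2 U3 U4 U5 U6 U7 U8 U9 U10
    Hr3 Hc G1 G2 G3 F e E1 E2 E3 J SF SE).
  cbv beta in T1, T2, T3. fold Se in T1, T2, T3. fold Ce in T1, T2. rewrite <- Ephi in T1, T2.
  change (Defs.Cpow k 0) with (RtoC 1) in T2.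
  replace (d2 (F O) * 1) with (d2 (F O)) in T2 by ring.
  split; [|split].
  - eapply Rle_trans; [exact T1|]. apply Rmult_le_compat_r; lra.
  - eapply Rle_trans; [exact T2|]. apply Rmult_le_compat_r; lra.
  - eapply Rle_trans; [exact T3|]. apply Rplus_le_compat.
    + apply Rmult_le_compat_r; [|lra].
      apply Rmult_le_pos; [apply pow2_ge_0 | apply Rlt_le, Rinv_0_lt_compat; lra].
    + apply Rmult_le_compat_r; [exact HSe | lra].
Qed.

(** * Truncated generating functions in time *)

Section Time.
Variable b : BC.
Variable g : nat -> R.
Local Notation f := (traj Cr s2 s3 b g).

Fixpoint gen (w : C) (N j : nat) : CF3 :=
  match N with
  | O => mkCF3 0 0 0
  | S n => add3 (gen w n j) (scale3 (w ^ n) (toC (f n j)))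
  end.

Definition gen_end (w : C) (N j : nat) : CF3 := scale3 (- w ^ N) (toC (f N j)).

Definition gen_src (w : C) (N : nat) : C := Csum N (fun n => w ^ n * RtoC (g n)).

(** One time step multiplied by [w] shifts the partial sum by one index; with zero initial data only
    the end term is left over. *)
Lemma gen_resolvent_eq (w : C) (N : nat) :
  resolvent_eq b w (gen_src w N) (gen w N) (gen_end w N).
Proof.
  assert (Z : relaxC Cr s2 s3 (mkCF3 0 0 0) = mkCF3 0 0 0)
    by (unfold relaxC; simpl; f_equal; field).
  assert (ZG : ghostS b (fun _ => mkCF3 0 0 0) = 0).
  { rewrite (ghostS_ext b _ (fun j => scale3 0 (mkCF3 0 0 0)))
      by (intros; unfold scale3; simpl; f_equal; ring).
    rewrite ghostS_scale. ring. }
  induction N as [|N (I1 & I2 & I3 & I4)].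
  - unfold resolvent_eq. cbn [gen]. rewrite Z.
    split; [|split; [|split]]; intros;
    unfold gen_end, scale3, toC; simpl traj; unfold F3zero; cbn [d1 d2 d3 c1 c2 c3]; try ring.
    rewrite ZG. unfold gen_src; simpl. ring.
  - assert (A : forall j, relaxC Cr s2 s3 (gen w (S N) j) =
      add3 (relaxC Cr s2 s3 (gen w N j)) (scale3 (w ^ N) (toC (relax Cr s2 s3 (f N j)))))
      by (intros j; cbn [gen]; rewrite relaxC_add3, relaxC_scale3, toC_relax; reflexivity).
    split; [|split; [|split]].
    + intros j. rewrite A. specialize (I1 j). revert I1.
      unfold gen_end. cbn [gen add3 scale3 toC d1]. intros ->.
      change (c1 (f (S N) j)) with (c1 (relax Cr s2 s3 (f N j))). simpl. ring.
    + intros j. rewrite A. specialize (I2 j). revert I2.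
      unfold gen_end. cbn [gen add3 scale3 toC d2]. intros ->.
      change (c2 (f (S N) (S j))) with (c2 (relax Cr s2 s3 (f N j))). simpl. ring.
    + intros j. rewrite A. specialize (I3 j). revert I3.
      unfold gen_end. cbn [gen add3 scale3 toC d3]. intros ->.
      change (c3 (f (S N) j)) with (c3 (relax Cr s2 s3 (f N (S j)))). simpl. ring.
    + rewrite (ghostS_ext b _ _ A), ghostS_add, ghostS_scale.
      revert I4. unfold gen_end. cbn [gen add3 scale3 toC d2]. intros ->.
      change (c2 (f (S N) O)) with (ghost b (fun i => relax Cr s2 s3 (f N i)) (g N)).
      rewrite ghostS_toC. unfold gen_src. simpl Csum.
      change (w ^ S N) with (w * w ^ N). ring.
Qed.

Lemma gen_components (w : C) (N j : nat) :
  d1 (gen w N j) = Csum N (fun n => w ^ n * RtoC (c1 (f n j))) /\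
  d2 (gen w N j) = Csum N (fun n => w ^ n * RtoC (c2 (f n j))) /\
  d3 (gen w N j) = Csum N (fun n => w ^ n * RtoC (c3 (f n j))).
Proof.
  induction N as [|N (I1 & I2 & I3)]; [simpl; tauto|].
  cbn [gen add3 scale3 toC d1 d2 d3 Csum]. rewrite I1, I2, I3. tauto.
Qed.

Lemma scale3_toC_zero (s : C) : norm1 (scale3 s (toC F3zero)) = 0%R.
Proof. rewrite norm1_scale3. unfold norm1; simpl. rewrite Cmod_0. ring. Qed.

Lemma gen_support (w : C) (N j : nat) : (N <= j)%nat -> norm1 (gen w N j) = 0%R.
Proof.
  intros Hj. assert (H : gen w N j = mkCF3 0 0 0); [|rewrite H; apply norm1_0].
  induction N as [|N IH]; [reflexivity|]. cbn [gen]. rewrite IH by lia.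
  rewrite (traj_support Cr s2 s3 b g N j) by lia.
  unfold add3, scale3, toC, F3zero; simpl. f_equal; ring.
Qed.

Lemma gen_end_support (w : C) (N j : nat) : (N <= j)%nat -> norm1 (gen_end w N j) = 0%R.
Proof.
  intros Hj. unfold gen_end. rewrite (traj_support Cr s2 s3 b g N j) by lia.
  apply scale3_toC_zero.
Qed.

Definition energy (J n : nat) : R := fsum J (fun j => sqr (f n j)).

Lemma gen_end_sum (w : C) (N J : nat) :
  (fsum J (fun j => norm1 (gen_end w N j) ^ 2) <= 3 * (Cmod w ^ (2 * N) * energy J N))%R.
Proof.
  unfold energy. rewrite <- !fsum_scal. apply fsum_le. intros j _.
  eapply Rle_trans; [apply norm1_le_sq3|]. unfold gen_end.
  rewrite sq3_scale_toC, Cmod_opp, Cmod_pow, <- pow_mult. rewrite (Nat.mul_comm N 2). lra.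
Qed.

Lemma gen_parseval (M N J : nat) (r : R) :
  (N <= M)%nat ->
  fsum M (fun m => fsum J (fun j => sq3 (gen (RtoC r * cis (node M m)) N j)))
  = (INR M * fsum N (fun n => r ^ (2 * n) * energy J n))%R.
Proof.
  intros HN. rewrite fsum_swap.
  rewrite (fsum_ext J _ (fun j => INR M * fsum N (fun n => r ^ (2 * n) * sqr (f n j)))%R).
  - rewrite fsum_scal, fsum_swap. f_equal. apply fsum_ext. intros n _.
    rewrite fsum_scal. reflexivity.
  - intros j _. unfold sq3.
    rewrite (fsum_ext M _ (fun m =>
       Cmod (Csum N (fun n => (RtoC r * cis (node M m)) ^ n * RtoC (c1 (f n j)))%C) ^ 2
     + Cmod (Csum N (fun n => (RtoC r * cis (node M m)) ^ n * RtoC (c2 (f n j)))%C) ^ 2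
     + Cmod (Csum N (fun n => (RtoC r * cis (node M m)) ^ n * RtoC (c3 (f n j)))%C) ^ 2)%R).
    + rewrite !fsum_plus, !parseval_nodes by exact HN.
      rewrite <- !Rmult_plus_distr_l, <- !fsum_plus. f_equal. apply fsum_ext.
      intros n _. unfold sqr. ring.
    + intros m _. destruct (gen_components (RtoC r * cis (node M m)) N j) as (-> & -> & ->).
      reflexivity.
Qed.
End Time.

Open Scope R_scope.

(** * Estimates in time *)

Lemma energy_ge_0 (b : BC) (g : nat -> R) (J n : nat) : 0 <= energy b g J n.
Proof. apply fsum_nonneg. intros; apply sqr_ge_0. Qed.

Lemma energy_support (b : BC) (g : nat -> R) (J n : nat) :
  (n <= J)%nat -> energy b g J n = energy b g n n.
Proof.
  intros H. induction H as [|J H IH]; [reflexivity|].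
  rewrite <- IH. unfold energy. rewrite fsum_S, (traj_support Cr s2 s3 b g n J) by lia.
  unfold sqr, F3zero; simpl. ring.
Qed.

(** [K] is fixed before [r] and [c0]. In the constant of the source, [c0 ^ 2] comes from the
    boundary residual and [1 - p] from the distance of the stable root to the unit circle; [C0]
    absorbs the rest. *)
Lemma energy_step (b : BC) :
  exists K, 0 < K /\ forall r c0, 0 < r < 1 -> 0 < c0 ->
  (forall w k f, Cmod w <= r -> Cmod k < 1 -> bulk_w w k f ->
     c0 * norm1 f <= Cmod (resid b w k f)) ->
  exists C0, 0 < C0 /\ forall p g N, 0 < p <= r ->
    wsum (fun n => energy b g n n) p N <=
    K / (c0 ^ 2 * (1 - p)) * fsum N (fun n => p ^ (2 * n) * g n ^ 2)
      + C0 * (p ^ (2 * N) * energy b g N N).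
Proof.
  destruct (resolvent_estimates b) as (K0 & cg & HK0 & Hcg & H).
  exists (2 * K0 / cg). split; [apply Rdiv_lt_0_compat; lra|].
  intros r c0 Hr Hc0 Hres.
  destruct (H r (proj2 Hr)) as (C1 & HC1 & HC). clear H.
  set (C2 := 2 * K0 / cg * C1 ^ 2 / (c0 ^ 2 * (1 - r)) + C1).
  assert (Hc02 : 0 < c0 ^ 2) by (apply pow_lt, Hc0).
  assert (HC2 : 0 <= C2).
  { unfold C2. apply Rplus_le_le_0_compat; [|exact HC1].
    apply Rmult_le_pos; [apply Rmult_le_pos; [|apply pow2_ge_0]|].
    - apply Rlt_le, Rdiv_lt_0_compat; lra.
    - apply Rlt_le, Rinv_0_lt_compat, Rmult_lt_0_compat; lra. }
  exists (3 * C2 + 1). split; [lra|]. intros p g N Hp.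
  set (E := fun n => energy b g n n).
  assert (Point : forall w, Cmod w = p ->
    fsum N (fun j => sq3 (gen b g w N j)) <=
      2 * K0 / cg / (c0 ^ 2 * (1 - p)) * Cmod (gen_src g w N) ^ 2
      + 3 * C2 * (p ^ (2 * N) * E N)).
  { intros w Hw.
    destruct (HC w) as (k & phi & Hk & B & P2 & Hgap & Hest); [lra|].
    destruct (Hest (gen b g w N) (gen_end b g w N) (gen_src g w N) N) as (T1 & _ & T3).
    { apply gen_resolvent_eq. }
    { intros; apply gen_support; assumption. }
    { intros; apply gen_end_support; assumption. }
    assert (HSe := gen_end_sum b g w N N). rewrite Hw in HSe. fold (E N) in HSe.
    set (Se := fsum N (fun j => norm1 (gen_end b g w N j) ^ 2)) in *.
    assert (HSe0 : 0 <= Se) by (apply fsum_nonneg; intros; apply pow2_ge_0).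
    set (F0 := d2 (gen b g w N 0)) in *. set (G := gen_src g w N) in *.
    assert (Hres' : c0 <= Cmod (resid b w k phi)).
    { apply Rle_trans with (c0 * norm1 phi); [|apply Hres; try assumption; lra].
      rewrite <- (Rmult_1_r c0) at 1. apply Rmult_le_compat_l; [lra|].
      unfold norm1. rewrite P2, Cmod_1. pose proof (Cmod_ge_0 (d1 phi)).
      pose proof (Cmod_ge_0 (d3 phi)). lra. }
    assert (BF : c0 * Cmod F0 <= Cmod G + C1 * sqrt Se).
    { apply Rle_trans with (Cmod (F0 * resid b w k phi)%C).
      - rewrite Cmod_mult, Rmult_comm. apply Rmult_le_compat_l; [apply Cmod_ge_0 | exact Hres'].
      - replace (F0 * resid b w k phi)%C with (w * G + (F0 * resid b w k phi - w * G))%C by ring.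
        apply Cmod_plus_le; [|exact T1]. rewrite Cmod_mult. pose proof (Cmod_ge_0 G). nra. }
    assert (BF2 : c0 ^ 2 * Cmod F0 ^ 2 <= 2 * Cmod G ^ 2 + 2 * C1 ^ 2 * Se).
    { rewrite <- Rpow_mult_distr.
      apply Rle_trans with ((Cmod G + C1 * sqrt Se) ^ 2).
      - apply pow_incr. split; [apply Rmult_le_pos; [lra | apply Cmod_ge_0] | exact BF].
      - rewrite <- (pow2_sqrt Se HSe0) at 2.
        pose proof (pow2_ge_0 (Cmod G - C1 * sqrt Se)). nra. }
    rewrite Hw in Hgap.
    assert (Hcp : 0 < cg * (1 - p)) by (apply Rmult_lt_0_compat; lra).
    assert (BQ : Cmod F0 ^ 2 / (1 - Cmod k) <=
       (2 * Cmod G ^ 2 + 2 * C1 ^ 2 * Se) / c0 ^ 2 / (cg * (1 - p))).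
    { unfold Rdiv at 1 2. apply Rmult_le_compat.
      - apply pow2_ge_0.
      - apply Rlt_le, Rinv_0_lt_compat; lra.
      - apply Rmult_le_reg_l with (c0 ^ 2); [exact Hc02|].
        replace (c0 ^ 2 * ((2 * Cmod G ^ 2 + 2 * C1 ^ 2 * Se) / c0 ^ 2))
          with (2 * Cmod G ^ 2 + 2 * C1 ^ 2 * Se) by (field; lra). exact BF2.
      - apply Rinv_le_contravar; lra. }
    apply Rle_trans with (fsum N (fun j => norm1 (gen b g w N j) ^ 2)).
    { apply fsum_le. intros; apply sq3_le_norm1. }
    eapply Rle_trans; [exact T3|].
    apply Rle_trans with (K0 * ((2 * Cmod G ^ 2 + 2 * C1 ^ 2 * Se) / c0 ^ 2 / (cg * (1 - p))) + C1 * Se).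
    { apply Rplus_le_compat_r, Rmult_le_compat_l; lra. }
    apply Rle_trans with (2 * K0 / cg / (c0 ^ 2 * (1 - p)) * Cmod G ^ 2 + C2 * Se).
    - replace (K0 * ((2 * Cmod G ^ 2 + 2 * C1 ^ 2 * Se) / c0 ^ 2 / (cg * (1 - p))) + C1 * Se)
        with (2 * K0 / cg / (c0 ^ 2 * (1 - p)) * Cmod G ^ 2
           + (2 * K0 / cg * C1 ^ 2 / (c0 ^ 2 * (1 - p)) + C1) * Se) by (field; lra).
      apply Rplus_le_compat_l, Rmult_le_compat_r; [exact HSe0|]. unfold C2.
      apply Rplus_le_compat_r. unfold Rdiv at 1 3. apply Rmult_le_compat_l.
      + apply Rmult_le_pos; [apply Rlt_le, Rdiv_lt_0_compat; lra | apply pow2_ge_0].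
      + apply Rinv_le_contravar; [apply Rmult_lt_0_compat; lra|].
        apply Rmult_le_compat_l; lra.
    - apply Rplus_le_compat_l. rewrite (Rmult_comm 3), Rmult_assoc.
      apply Rmult_le_compat_l; [exact HC2 | exact HSe]. }
  (* Any number of nodes at least [N] is exact; [S N] is also nonzero when [N = 0]. *)
  set (M := S N). assert (HM : 0 < INR M) by (apply lt_0_INR; unfold M; lia).
  apply Rmult_le_reg_l with (INR M); [exact HM|].
  assert (EL : wsum E p N = fsum N (fun n => p ^ (2 * n) * energy b g N n)).
  { apply fsum_ext. intros n Hn. unfold E. rewrite (energy_support b g N n) by lia. reflexivity. }
  rewrite EL, <- (gen_parseval b g M N N p) by (unfold M; lia).
  eapply Rle_trans.
  - apply fsum_le. intros m _. apply Point.
    rewrite Cmod_mult, Cmod_cis, Cmod_R, Rabs_pos_eq; lra.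
  - rewrite fsum_plus, fsum_scal, fsum_const.
    unfold gen_src. rewrite (parseval_nodes M N p g) by (unfold M; lia).
    assert (0 <= INR M * (p ^ (2 * N) * E N)).
    { apply Rmult_le_pos; [lra|]. apply Rmult_le_pos; [apply pow_le; lra | apply energy_ge_0]. }
    unfold E in *. lra.
Qed.

Lemma traj_sup_bound (b : BC) :
  exists Q, 1 <= Q /\ forall g n m, 0 <= m -> (forall j, norm1 (toC (traj Cr s2 s3 b g n j)) <= m) ->
    forall j, norm1 (toC (traj Cr s2 s3 b g (S n) j)) <= Q * (m + Rabs (g n)).
Proof.
  destruct relaxC_bound as (KR & HKR0 & HKR).
  destruct (ghostS_bound b) as (Kb & L & HKb0 & HKb).
  exists (3 * KR + Kb * KR + 1).
  assert (0 <= Kb * KR) by (apply Rmult_le_pos; assumption).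
  split; [lra|].
  intros g n m Hm Hn j. set (f := traj Cr s2 s3 b g n) in *.
  assert (A : forall i, norm1 (toC (relax Cr s2 s3 (f i))) <= KR * m).
  { intros i. rewrite <- toC_relax. eapply Rle_trans; [apply HKR|].
    apply Rmult_le_compat_l; [exact HKR0 | apply Hn]. }
  assert (A' : forall i, Rabs (c1 (relax Cr s2 s3 (f i))) <= KR * m /\
     Rabs (c2 (relax Cr s2 s3 (f i))) <= KR * m /\ Rabs (c3 (relax Cr s2 s3 (f i))) <= KR * m).
  { intros i. specialize (A i). unfold norm1, toC in A; cbn [d1 d2 d3] in A. rewrite !Cmod_R in A.
    pose proof (Rabs_pos (c1 (relax Cr s2 s3 (f i)))). pose proof (Rabs_pos (c2 (relax Cr s2 s3 (f i)))).
    pose proof (Rabs_pos (c3 (relax Cr s2 s3 (f i)))). repeat split; lra. }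
  assert (Gh : Rabs (ghost b (fun i => relax Cr s2 s3 (f i)) (g n)) <= Kb * (KR * m) + Rabs (g n)).
  { rewrite <- Cmod_R, ghostS_toC. apply Cmod_plus_le; [|rewrite Cmod_R; lra].
    apply HKb. intros i _. apply A. }
  change (traj Cr s2 s3 b g (S n)) with (step Cr s2 s3 b f (g n)).
  unfold step, norm1, toC. cbn [d1 d2 d3 c1 c2 c3]. rewrite !Cmod_R.
  assert (C2 : Rabs (match j with O => ghost b (fun i => relax Cr s2 s3 (f i)) (g n)
     | S j' => c2 (relax Cr s2 s3 (f j')) end) <= KR * m + Kb * (KR * m) + Rabs (g n)).
  { pose proof (Rabs_pos (g n)). assert (0 <= KR * m) by (apply Rmult_le_pos; assumption).
    assert (0 <= Kb * (KR * m)) by (apply Rmult_le_pos; assumption).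
    destruct j; [lra|]. pose proof (proj1 (proj2 (A' j))). lra. }
  pose proof (proj1 (A' j)). pose proof (proj2 (proj2 (A' (S j)))).
  pose proof (Rabs_pos (g n)).
  assert (0 <= (3 * KR + Kb * KR) * Rabs (g n)) by (apply Rmult_le_pos; lra). lra.
Qed.

Lemma energy_initial_weight (b : BC) (g : nat -> R) (r H : R) :
  0 < r < 1 -> (forall N, fsum N (fun n => r ^ (2 * n) * g n ^ 2) <= H) ->
  exists r0 B0, 0 < r0 <= r /\ forall N, wsum (fun n => energy b g n n) r0 N <= B0.
Proof.
  intros Hr HH. destruct (traj_sup_bound b) as (Q & HQ & HS).
  assert (H0 : 0 <= H) by (specialize (HH O); simpl in HH; exact HH).
  (* [/ r] dominates the growth of the source, |g n| <= h r^(-n). [2 Q] lets [Q (m + |g n|)] be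
     absorbed in [h D^(n+1)] when [m = h D^n]. *)
  set (D := Rmax (2 * Q) (/ r)). set (h := sqrt H).
  assert (Hh : 0 <= h) by apply sqrt_pos.
  assert (HD1 : 2 * Q <= D) by apply Rmax_l.
  assert (HD2 : / r <= D) by apply Rmax_r.
  assert (HD : 0 < D) by lra.
  assert (Hg : forall n, Rabs (g n) <= h * D ^ n).
  { intros n. apply Rle_trans with (h * (/ r) ^ n).
    - rewrite pow_inv. apply Rmult_le_reg_r with (r ^ n); [apply pow_lt; lra|].
      rewrite Rmult_assoc, Rinv_l, Rmult_1_r by (apply pow_nonzero; lra).
      unfold h. rewrite <- (sqrt_pow2 (Rabs (g n) * r ^ n))
        by (apply Rmult_le_pos; [apply Rabs_pos | apply pow_le; lra]).
      apply sqrt_le_1_alt. rewrite Rpow_mult_distr, pow2_abs, <- pow_mult, (Nat.mul_comm n 2).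
      eapply Rle_trans; [|apply (HH (S n))].
      rewrite Rmult_comm.
      apply (fsum_term_le (S n) n (fun n => r ^ (2 * n) * g n ^ 2)); [|lia].
      intros m. apply Rmult_le_pos; [apply pow_le; lra | apply pow2_ge_0].
    - apply Rmult_le_compat_l; [exact Hh|]. apply pow_incr. split; [|exact HD2].
      apply Rlt_le, Rinv_0_lt_compat; lra. }
  assert (Sup : forall n j, norm1 (toC (traj Cr s2 s3 b g n j)) <= h * D ^ n).
  { induction n as [|n IH]; intros j.
    - unfold norm1; simpl. rewrite Cmod_0. lra.
    - assert (Hm : 0 <= h * D ^ n) by (apply Rmult_le_pos; [exact Hh | apply pow_le; lra]).
      eapply Rle_trans; [apply (HS g n (h * D ^ n) Hm IH)|].
      specialize (Hg n). simpl. nra. }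
  assert (En : forall n, energy b g n n <= INR n * (h * D ^ n) ^ 2).
  { intros n. rewrite <- fsum_const. apply fsum_le. intros j _.
    replace (sqr (traj Cr s2 s3 b g n j)) with (sq3 (toC (traj Cr s2 s3 b g n j))).
    - eapply Rle_trans; [apply sq3_le_norm1|]. apply pow_incr. split; [apply norm1_ge_0 | apply Sup].
    - unfold sq3, sqr, toC; cbn [d1 d2 d3]. rewrite !Cmod_R, !pow2_abs. reflexivity. }
  (* The weighted energy at time [n] is then at most [n 4^(-n) H <= 2^(-n) H], and these terms sum
     to at most [2 H]. *)
  exists (/ (2 * D)), (2 * H).
  assert (HrD : 1 <= r * D).
  { apply Rmult_le_compat_l with (r := r) in HD2; [|lra]. rewrite Rinv_r in HD2; lra. }
  split.
  - split; [apply Rinv_0_lt_compat; lra|].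
    apply Rmult_le_reg_r with (2 * D); [lra|]. rewrite Rinv_l by lra. lra.
  - intros N. unfold wsum.
    assert (T : forall n, (/ (2 * D)) ^ (2 * n) * energy b g n n <= H * (/ 2) ^ n).
    { intros n.
      apply Rle_trans with ((/ (2 * D)) ^ (2 * n) * (INR n * (h * D ^ n) ^ 2)).
      { apply Rmult_le_compat_l; [apply pow_le, Rlt_le, Rinv_0_lt_compat; lra | apply En]. }
      replace ((/ (2 * D)) ^ (2 * n) * (INR n * (h * D ^ n) ^ 2)) with
        (INR n * (/ 2) ^ n * (H * (/ 2) ^ n)).
      2:{ rewrite Rinv_mult, Rpow_mult_distr, !Rpow_mult_distr.
          unfold h. rewrite <- (pow2_sqrt H H0) at 1. rewrite <- pow_mult, (Nat.mul_comm n 2).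
          rewrite (pow_inv D (2 * n)).
          replace (2 * n)%nat with (n + n)%nat by lia. rewrite (pow_add (/ 2)).
          field. apply pow_nonzero. lra. }
      rewrite <- (Rmult_1_l (H * (/ 2) ^ n)) at 2. apply Rmult_le_compat_r.
      - apply Rmult_le_pos; [exact H0 | apply pow_le; lra].
      - assert (P2 : INR n <= 2 ^ n).
        { clear. induction n as [|n IH]; [simpl; lra|]. rewrite S_INR. simpl.
          assert (1 <= 2 ^ n) by (apply pow_R1_Rle; lra). lra. }
        rewrite pow_inv. apply Rmult_le_reg_r with (2 ^ n); [apply pow_lt; lra|].
        rewrite Rmult_assoc, Rinv_l by (apply pow_nonzero; lra). lra. }
    eapply Rle_trans; [apply fsum_le; intros n _; apply T|].
    rewrite fsum_scal.
    assert (G : forall K, fsum K (fun n => (/ 2) ^ n) = 2 - 2 * (/ 2) ^ K).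
    { induction K as [|K IH]; [simpl; lra|]. rewrite fsum_S, IH. simpl. field. }
    rewrite G. assert (0 <= (/ 2) ^ N) by (apply pow_le; lra). nra.
Qed.

(** Finiteness for each fixed [r < 1], for unstable conditions as well. It makes the end term of the
    partial sums vanish in the limit. *)
Lemma energy_weighted_bounded (b : BC) (g : nat -> R) (r H : R) :
  supported b -> 0 < r < 1 -> (forall N, fsum N (fun n => r ^ (2 * n) * g n ^ 2) <= H) ->
  exists B, forall N, wsum (fun n => energy b g n n) r N <= B.
Proof.
  intros Hb Hr HH. destruct (energy_step b) as (K & HK & ES).
  destruct (kreiss_lopatinskii_disc b r Hb (proj2 Hr)) as (c0 & Hc0 & Hres).
  destruct (ES r c0 Hr Hc0 Hres) as (C0 & HC0 & E).
  destruct (energy_initial_weight b g r H Hr HH) as (r0 & B0 & Hr0 & HB0).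
  assert (H0 : 0 <= H) by (specialize (HH O); simpl in HH; exact HH).
  assert (Hc02 : 0 < c0 ^ 2) by (apply pow_lt, Hc0).
  assert (P : 0 <= K / (c0 ^ 2 * (1 - r)) * H).
  { apply Rmult_le_pos; [|exact H0].
    apply Rlt_le, Rdiv_lt_0_compat; [exact HK | apply Rmult_lt_0_compat; lra]. }
  exists (K / (c0 ^ 2 * (1 - r)) * H).
  apply (weight_bootstrap _ r r0 (K / (c0 ^ 2 * (1 - r)) * H) C0 B0); try assumption.
  - intros; apply energy_ge_0.
  - intros p N Hp. eapply Rle_trans; [apply (E p g N Hp)|]. apply Rplus_le_compat_r.
    apply Rmult_le_compat.
    + apply Rlt_le, Rdiv_lt_0_compat; [exact HK | apply Rmult_lt_0_compat; lra].
    + apply fsum_nonneg. intros. apply Rmult_le_pos; [apply pow_le; lra | apply pow2_ge_0].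
    + apply Rmult_le_compat_l; [lra|]. apply Rinv_le_contravar; [apply Rmult_lt_0_compat; lra|].
      apply Rmult_le_compat_l; lra.
    + apply Rle_trans with (2 := HH N). apply fsum_le. intros n _.
      apply Rmult_le_compat_r; [apply pow2_ge_0|]. apply pow_incr. lra.
Qed.

(** Once the weighted sum is known to be bounded, its growth rate is 1, and the dichotomy discards
    [C0] together with the qualitative bound. What remains is the constant of the uniform boundary
    residual. *)
Lemma energy_sharp_bound (b : BC) :
  well_posed b ->
  exists K, 0 < K /\ forall g r H, 0 < r < 1 ->
    (forall N, fsum N (fun n => r ^ (2 * n) * g n ^ 2) <= H) ->
    forall N, wsum (fun n => energy b g n n) r N <= K / (1 - r) * H.
Proof.
  intros Hb. destruct (energy_step b) as (K & HK & ES).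
  destruct (uniform_kreiss_lopatinskii b Hb) as (c0 & Hc0 & Hres).
  assert (Hc02 : 0 < c0 ^ 2) by (apply pow_lt, Hc0).
  exists (K / c0 ^ 2). split; [apply Rdiv_lt_0_compat; assumption|].
  intros g r H Hr HH.
  destruct (ES r c0 Hr Hc0) as (C0 & HC0 & E).
  { intros w k f Hw. apply Hres. lra. }
  assert (Hs : supported b) by (destruct b; simpl in *; tauto).
  destruct (energy_weighted_bounded b g r H Hs Hr HH) as (B & HB).
  assert (H0 : 0 <= H) by (specialize (HH O); simpl in HH; exact HH).
  replace (K / c0 ^ 2 / (1 - r) * H) with (K / (c0 ^ 2 * (1 - r)) * H) by (field; lra).
  assert (P : 0 <= K / (c0 ^ 2 * (1 - r))).
  { apply Rlt_le, Rdiv_lt_0_compat; [exact HK | apply Rmult_lt_0_compat; lra]. }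
  apply growth_dichotomy with C0 B 1; try assumption.
  - apply Rmult_le_pos; assumption.
  - intros N. replace (wsum (fun n => energy b g n n) r (S N) - wsum (fun n => energy b g n n) r N)
      with (r ^ (2 * N) * energy b g N N) by (unfold wsum; rewrite fsum_S; ring).
    eapply Rle_trans; [apply (E r g N)|]; [lra|].
    apply Rplus_le_compat_r, Rmult_le_compat_l; [exact P | apply HH].
  - assert (0 < / C0) by (apply Rinv_0_lt_compat, HC0). lra.
  - intros N. rewrite pow1, Rmult_1_r. apply HB.
Qed.

Lemma well_posed_SS (lam : R) (b : BC) :
  0 < lam -> well_posed b -> SS_estimate lam Cr s2 s3 b.
Proof.
  intros Hl Hb. destruct (energy_sharp_bound b Hb) as (K & HK & H).
  (* 7 comes from [momnorm2_le] and [lam] from [dx = lam dt]. The factor [1 / (1 - r)] is paid for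
     by [alpha / (1 + alpha dt)] through [exp_neg_bounds]. *)
  exists (7 * K * lam). split; [repeat apply Rmult_lt_0_compat; lra|].
  intros alpha g dx Ha Hdx dt.
  assert (Hdt : 0 < dt) by (apply Rdiv_lt_0_compat; assumption).
  assert (Had : 0 < alpha * dt) by (apply Rmult_lt_0_compat; assumption).
  assert (Edx : dx = lam * dt) by (unfold dt; field; lra). clearbody dt.
  destruct (exp_neg_bounds (alpha * dt) Had) as [Hr Hr2].
  set (r := exp (- (alpha * dt))) in *.
  assert (Hw : forall n, exp (-2 * alpha * INR n * dt) = r ^ (2 * n)).
  { intros n. unfold r. rewrite <- exp_INR_mult. f_equal. rewrite mult_INR. simpl. ring. }
  assert (Hc : 0 < alpha / (1 + alpha * dt)) by (apply Rdiv_lt_0_compat; lra).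
  destruct (nnsum_cases (fun n => dt * exp (-2 * alpha * INR n * dt) * g n ^ 2)) as [E | (l & E & Hl')].
  { intros n. apply Rmult_le_pos; [apply Rmult_le_pos; [lra | apply Rlt_le, exp_pos] | apply pow2_ge_0]. }
  { rewrite E, Rbar_mult_pos_p_infty by (repeat apply Rmult_lt_0_compat; lra).
    destruct (Rbar_mult _ _); exact I. }
  rewrite E.
  assert (Hg : forall N, fsum N (fun n => r ^ (2 * n) * g n ^ 2) <= l / dt).
  { intros N. apply Rmult_le_reg_l with dt; [exact Hdt|].
    replace (dt * (l / dt)) with l by (field; lra). rewrite <- fsum_scal.
    apply Rle_trans with (2 := Hl' N). apply Req_le, fsum_ext. intros n _. rewrite Hw. ring. }
  assert (Hl0 : 0 <= l) by (specialize (Hl' O); simpl in Hl'; exact Hl').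
  apply Rbar_le_trans with (Finite (alpha / (1 + alpha * dt) * (7 * dt * dx * (K / (1 - r) * (l / dt))))).
  - apply Rbar_mult_le_finite; [exact Hc|]. apply nnsum2_le. intros N.
    apply Rle_trans with (7 * dt * dx * wsum (fun n => energy b g n n) r N).
    + unfold wsum. rewrite <- fsum_scal. apply fsum_le. intros n Hn.
      rewrite <- (energy_support b g N n) by lia. unfold energy.
      rewrite <- !fsum_scal. apply fsum_le. intros j _. rewrite Hw.
      assert (M := momnorm2_le (traj Cr s2 s3 b g n j)).
      assert (0 <= dt * dx * r ^ (2 * n)).
      { apply Rmult_le_pos; [apply Rmult_le_pos; lra | apply pow_le; lra]. }
      apply Rmult_le_compat_l with (r := dt * dx * r ^ (2 * n)) in M; [|assumption]. lra.
    + apply Rmult_le_compat_l.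
      * apply Rmult_le_pos; [apply Rmult_le_pos|]; lra.
      * apply (H g r (l / dt) Hr Hg).
  - simpl.
    replace (alpha / (1 + alpha * dt) * (7 * dt * dx * (K / (1 - r) * (l / dt))))
      with (7 * K * lam * l * ((alpha * dt / (1 + alpha * dt)) / (1 - r)))
      by (rewrite Edx; field; lra).
    rewrite <- (Rmult_1_r (7 * K * lam * l)) at 2.
    apply Rmult_le_compat_l.
    + apply Rmult_le_pos; [|exact Hl0]. apply Rlt_le. repeat apply Rmult_lt_0_compat; lra.
    + apply Rmult_le_reg_r with (1 - r); [lra|].
      unfold Rdiv at 1. rewrite Rmult_assoc, Rinv_l by lra. lra.
Qed.

Lemma wsum_increment_lim (E : nat -> R) (r B : R) :
  0 < r -> (forall n, 0 <= E n) -> (forall N, wsum E r N <= B) ->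
  is_lim_seq (fun N => r ^ (2 * N) * E N) 0.
Proof.
  intros Hr HE HB.
  assert (I : forall n, wsum E r n <= wsum E r (S n)).
  { intros n. unfold wsum. rewrite fsum_S.
    assert (0 <= r ^ (2 * n) * E n) by (apply Rmult_le_pos; [apply pow_le; lra | apply HE]). lra. }
  destruct (ex_finite_lim_seq_incr (wsum E r) B I HB) as [l L].
  apply is_lim_seq_ext with (fun N => wsum E r (S N) - wsum E r N).
  - intros N. unfold wsum. rewrite fsum_S. ring.
  - replace (Finite 0) with (Finite (l - l)) by (f_equal; ring).
    apply is_lim_seq_minus'; [apply is_lim_seq_incr_1 with (1 := L) | exact L].
Qed.

Lemma fsum_geometric (r : R) (N : nat) : 0 < r < 1 -> fsum N (fun n => r ^ n) = (1 - r ^ N) / (1 - r).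
Proof.
  intros Hr. induction N as [|N IH]; [simpl; field; lra|].
  rewrite fsum_S, IH. simpl. field. lra.
Qed.

Lemma cauchy_schwarz_fsum (N : nat) (w m : nat -> R) :
  (forall n, 0 <= w n) ->
  (fsum N (fun n => w n * m n)) ^ 2 <= fsum N (fun n => w n * m n ^ 2) * fsum N w.
Proof.
  intros H. induction N as [|N IH]; [simpl; lra|]. rewrite !fsum_S.
  assert (Hp : 0 <= fsum N (fun n => w n * m n ^ 2)).
  { apply fsum_nonneg. intros n _. apply Rmult_le_pos; [apply H | apply pow2_ge_0]. }
  assert (Hq : 0 <= fsum N w) by (apply fsum_nonneg; intros; apply H).
  set (a := fsum N (fun n => w n * m n)) in *. set (p := fsum N (fun n => w n * m n ^ 2)) in *.
  set (q := fsum N w) in *. specialize (H N). set (v := w N) in *. set (x := m N) in *.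
  assert (Hs : 0 <= p + x ^ 2 * q).
  { apply Rplus_le_le_0_compat; [exact Hp|]. apply Rmult_le_pos; [apply pow2_ge_0 | exact Hq]. }
  assert (S2 : (2 * a * x) ^ 2 <= (p + x ^ 2 * q) ^ 2).
  { apply Rle_trans with (4 * x ^ 2 * (p * q)).
    - replace ((2 * a * x) ^ 2) with (4 * x ^ 2 * a ^ 2) by ring.
      apply Rmult_le_compat_l; [pose proof (pow2_ge_0 x); lra | exact IH].
    - pose proof (pow2_ge_0 (p - x ^ 2 * q)). lra. }
  assert (L : 2 * a * x <= p + x ^ 2 * q).
  { apply Rnot_lt_le. intros L. nra. }
  apply Rmult_le_compat_l with (r := v) in L; [|exact H]. lra.
Qed.

Lemma rho_toC_gen (b : BC) (g : nat -> R) (r : R) (N : nat) :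
  rho (gen b g (RtoC r) N 0) = RtoC (fsum N (fun n => r ^ n * mom1 (traj Cr s2 s3 b g n 0))).
Proof.
  destruct (gen_components b g (RtoC r) N 0) as (E1 & E2 & E3). unfold rho. rewrite E1, E2, E3.
  induction N as [|N IH]; [simpl; ring|]. simpl Csum. rewrite fsum_S, RtoC_plus, <- IH.
  - unfold mom1. rewrite RtoC_mult, RtoC_pow, !RtoC_plus. ring.
  - apply gen_components.
  - apply gen_components.
  - apply gen_components.
Qed.

Lemma Cmod_rho_le (f : CF3) : Cmod (rho f) <= norm1 f.
Proof.
  unfold rho, norm1. pose proof (Cmod_triangle (d1 f + d2 f) (d3 f)).
  pose proof (Cmod_triangle (d1 f) (d2 f)). lra.
Qed.

(* With a constant unit source, the transform of the mass in the first cell is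
   asymptotically r / (1 - r) * rho phi / resid phi. *)
Lemma first_cell_mass (b : BC) (r Q : R) :
  supported b -> 0 < r < 1 ->
  (forall N, Rabs (fsum N (fun n => r ^ n * mom1 (traj Cr s2 s3 b (fun _ => 1) n 0))) <= Q) ->
  exists k phi, Cmod k < 1 /\ bulk_w (RtoC r) k phi /\
    r / (1 - r) * Cmod (rho phi) <= Q * Cmod (resid b (RtoC r) k phi).
Proof.
  intros Hb Hr HQ. set (g := fun _ : nat => 1).
  destruct (resolvent_estimates b) as (K0 & cg & _ & _ & H).
  destruct (H r (proj2 Hr)) as (C0 & HC0 & HC). clear H.
  set (w := RtoC r). assert (Hw : Cmod w = r) by (unfold w; rewrite Cmod_R; apply Rabs_pos_eq; lra).
  destruct (HC w) as (k & phi & Hk & B & _ & _ & Hest); [lra|].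
  exists k, phi. split; [exact Hk|]. split; [exact B|].
  assert (HG : forall N, fsum N (fun n => r ^ (2 * n) * g n ^ 2) <= 1 / (1 - r ^ 2)).
  { intros N. assert (Hr2 : 0 < r ^ 2 < 1) by (split; [apply pow_lt; lra | nra]).
    apply Rle_trans with (fsum N (fun n => (r ^ 2) ^ n)).
    - apply Req_le, fsum_ext. intros n _. unfold g. rewrite <- pow_mult. ring.
    - rewrite fsum_geometric by exact Hr2. unfold Rdiv. apply Rmult_le_compat_r.
      + apply Rlt_le, Rinv_0_lt_compat. lra.
      + assert (0 <= (r ^ 2) ^ N) by (apply pow_le; lra). lra. }
  destruct (energy_weighted_bounded b g r _ Hb Hr HG) as [B0 HB0].
  assert (L0 := wsum_increment_lim _ r B0 (proj1 Hr) (fun n => energy_ge_0 b g n n) HB0).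
  set (e := fun N => r ^ (2 * N) * energy b g N N) in *.
  assert (Ls : is_lim_seq (fun N => C0 * sqrt (3 * e N) * (Cmod (resid b w k phi) + Cmod (rho phi))) 0).
  { replace (Finite 0) with (Finite (C0 * sqrt (3 * 0) * (Cmod (resid b w k phi) + Cmod (rho phi))))
      by (rewrite Rmult_0_r, sqrt_0; f_equal; ring).
    apply is_lim_seq_mult'; [|apply is_lim_seq_const].
    apply is_lim_seq_mult'; [apply is_lim_seq_const|].
    apply (is_lim_seq_continuous sqrt); [apply continuity_pt_sqrt; lra|].
    apply is_lim_seq_mult'; [apply is_lim_seq_const | exact L0]. }
  assert (Ineq : forall N, r * ((1 - r ^ N) / (1 - r)) * Cmod (rho phi) <=
     Q * Cmod (resid b w k phi)
      + C0 * sqrt (3 * e N) * (Cmod (resid b w k phi) + Cmod (rho phi))).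
  { intros N.
    destruct (Hest (gen b g w N) (gen_end b g w N) (gen_src g w N) N) as (T1 & T2 & _).
    { apply gen_resolvent_eq. }
    { intros; apply gen_support; assumption. }
    { intros; apply gen_end_support; assumption. }
    assert (HSe := gen_end_sum b g w N N). rewrite Hw in HSe. fold (e N) in HSe.
    apply sqrt_le_1_alt in HSe.
    apply Rmult_le_compat_l with (r := C0) in HSe; [|exact HC0].
    set (Se := sqrt (fsum N (fun j => norm1 (gen_end b g w N j) ^ 2))) in *.
    set (F0 := gen b g w N 0) in *. set (x := resid b w k phi) in *.
    assert (EG : gen_src g w N = RtoC ((1 - r ^ N) / (1 - r))).
    { rewrite <- fsum_geometric by exact Hr. unfold gen_src, g, w. clear.
      induction N as [|N IH]; simpl; [reflexivity|].
      rewrite IH, RtoC_plus, RtoC_pow. ring. }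
    assert (T3 : Cmod (rho F0 - d2 F0 * rho phi) <= C0 * Se).
    { eapply Rle_trans; [|exact T2].
      replace (rho F0 - d2 F0 * rho phi)%C with (rho (add3 F0 (scale3 (- d2 F0) phi)))
        by (unfold rho, add3, scale3; simpl; ring).
      apply Cmod_rho_le. }
    assert (HR : Cmod (rho F0) <= Q).
    { unfold F0, w. rewrite rho_toC_gen, Cmod_R. apply HQ. }
    (* The unknown amplitude [d2 F0] cancels between the boundary estimate and the estimate of the
       first cell. *)
    assert (Id : (w * gen_src g w N * rho phi = rho F0 * x
       - (rho F0 - d2 F0 * rho phi) * x - (d2 F0 * x - w * gen_src g w N) * rho phi)%C) by ring.
    apply (f_equal Cmod) in Id. rewrite EG in Id at 1. unfold w in Id at 1.
    rewrite !Cmod_mult, !Cmod_R in Id.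
    assert (HrN : 0 <= r ^ N <= 1).
    { split; [apply pow_le; lra|]. rewrite <- (pow1 N). apply pow_incr. lra. }
    rewrite (Rabs_pos_eq r) in Id by lra.
    rewrite Rabs_pos_eq in Id
      by (apply Rmult_le_pos; [lra | apply Rlt_le, Rinv_0_lt_compat; lra]).
    rewrite Id.
    eapply Rle_trans; [apply Cmod_minus_le; [apply Cmod_minus_le|]; apply Rle_refl|].
    rewrite !Cmod_mult.
    pose proof (Cmod_ge_0 x). pose proof (Cmod_ge_0 (rho phi)).
    assert (Cmod (rho F0) * Cmod x <= Q * Cmod x) by (apply Rmult_le_compat_r; assumption).
    assert (Cmod (rho F0 - d2 F0 * rho phi) * Cmod x <= C0 * sqrt (3 * e N) * Cmod x)
      by (apply Rmult_le_compat_r; lra).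
    assert (Cmod (d2 F0 * x - w * gen_src g w N) * Cmod (rho phi) <= C0 * sqrt (3 * e N) * Cmod (rho phi))
      by (apply Rmult_le_compat_r; lra).
    lra. }
  apply (is_lim_seq_le _ _ (r * ((1 - 0) / (1 - r)) * Cmod (rho phi))
      (Q * Cmod (resid b w k phi) + 0)) in Ineq.
  - simpl in Ineq. replace (r * ((1 - 0) / (1 - r))) with (r / (1 - r)) in Ineq by (field; lra).
    fold w. lra.
  - apply is_lim_seq_mult'; [|apply is_lim_seq_const].
    apply is_lim_seq_mult'; [apply is_lim_seq_const|].
    apply is_lim_seq_mult'; [|apply is_lim_seq_const].
    apply is_lim_seq_minus'; [apply is_lim_seq_const|].
    apply is_lim_seq_geom. rewrite Rabs_pos_eq; lra.
  - apply is_lim_seq_plus'; [apply is_lim_seq_const | exact Ls].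
Qed.

(** * Instability *)

(** With [r = exp (-2 alpha)], the estimate and Cauchy-Schwarz in time with weights [r ^ n] bound
    the transform of the first-cell mass by order (1 - r)^(-3/2). [first_cell_mass] with a residual
    of order [1 - r] demands (1 - r)^(-2). *)
Lemma degenerate_resid_not_SSOO (lam c : R) (b : BC) :
  0 < lam -> 0 < c -> supported b ->
  (forall r k phi, 0 < r < 1 -> Cmod k < 1 -> bulk_w (RtoC r) k phi ->
     Cmod (resid b (RtoC r) k phi) <= c * (1 - r) * Cmod (rho phi)) ->
  ~ SSOO_estimate lam Cr s2 s3 b.
Proof.
  intros Hl Hc Hb Hdeg (K & HK & H).
  (* [alpha <= 1 / 4] gives [r >= 1 / 2]. The argument ends with [r ^ 2 lam <= 8 K c ^ 2 alpha], and
     the second bound makes the right side at most [lam / 8]. *)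
  set (alpha := Rmin (1 / 4) (lam / (64 * K * c ^ 2))).
  assert (HKc : 0 < 64 * K * c ^ 2) by (apply Rmult_lt_0_compat; [lra | apply pow_lt, Hc]).
  assert (Ha : 0 < alpha) by (apply Rmin_glb_lt; [lra | apply Rdiv_lt_0_compat; assumption]).
  assert (Ha1 : alpha <= 1 / 4) by apply Rmin_l.
  assert (Ha2 : 64 * K * c ^ 2 * alpha <= lam).
  { apply Rle_trans with (64 * K * c ^ 2 * (lam / (64 * K * c ^ 2))).
    - apply Rmult_le_compat_l; [lra | apply Rmin_r].
    - right. field. split; [|lra]. lra. }
  clearbody alpha.
  (* Taking [dx = lam] normalises the time step to 1. *)
  specialize (H alpha (fun _ => 1) lam Ha Hl). cbv zeta in H.
  replace (lam / lam) with 1 in H by (field; lra).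
  set (r := exp (- (2 * alpha))).
  destruct (exp_neg_bounds (2 * alpha) ltac:(lra)) as [Hr _]. fold r in Hr.
  assert (Hr2 : 1 - 2 * alpha <= r).
  { unfold r. pose proof (exp_ineq1_le (- (2 * alpha))). lra. }
  assert (Hw : forall n, exp (-2 * alpha * INR n * 1) = r ^ n).
  { intros n. unfold r. rewrite <- exp_INR_mult. f_equal. ring. }
  assert (Hgeo : forall N, fsum N (fun n => r ^ n) <= 1 / (1 - r)).
  { intros N. rewrite fsum_geometric by exact Hr. unfold Rdiv. apply Rmult_le_compat_r.
    - apply Rlt_le, Rinv_0_lt_compat. lra.
    - assert (0 <= r ^ N) by (apply pow_le; lra). lra. }
  assert (HR : Rbar_le
    (Rbar_mult K (nnsum (fun n => 1 * exp (-2 * alpha * INR n * 1) * 1 ^ 2))) (K * (1 / (1 - r)))).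
  { apply Rbar_mult_le_finite; [exact HK|]. apply nnsum_le. intros N.
    apply Rle_trans with (2 := Hgeo N). apply Req_le, fsum_ext. intros n _. rewrite Hw. ring. }
  assert (H' := Rbar_le_trans _ _ _ H HR). clear H HR.
  set (m := fun n => mom1 (traj Cr s2 s3 b (fun _ => 1) n 0)).
  assert (Ha3 : 0 < alpha / (1 + alpha * 1)) by (apply Rdiv_lt_0_compat; lra).
  set (u := fun n j => 1 * lam * exp (-2 * alpha * INR n * 1)
      * mom1 (traj Cr s2 s3 b (fun _ => 1) n j) ^ 2) in *.
  assert (Hu : forall n j, 0 <= u n j).
  { intros n j. unfold u. apply Rmult_le_pos; [|apply pow2_ge_0].
    apply Rmult_le_pos; [lra | apply Rlt_le, exp_pos]. }
  destruct (nnsum2_cases u Hu) as [E | (l & E & Hlim)]; rewrite E in H'.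
  { rewrite Rbar_mult_pos_p_infty in H' by exact Ha3. exact H'. }
  simpl in H'.
  set (X := 2 * K / (alpha * (1 - r))).
  assert (HlX : l <= X).
  { apply Rmult_le_reg_l with (alpha / (1 + alpha * 1)); [exact Ha3|].
    apply Rle_trans with (1 := H'). unfold X.
    replace (alpha / (1 + alpha * 1) * (2 * K / (alpha * (1 - r))))
      with (2 / (1 + alpha) * (K * (1 / (1 - r)))) by (field; lra).
    rewrite <- (Rmult_1_l (K * (1 / (1 - r)))) at 1. apply Rmult_le_compat_r.
    - apply Rmult_le_pos; [lra | apply Rlt_le, Rdiv_lt_0_compat; lra].
    - apply Rmult_le_reg_r with (1 + alpha); [lra|].
      unfold Rdiv. rewrite Rmult_assoc, Rinv_l by lra. lra. }
  assert (HX0 : 0 < X) by (apply Rdiv_lt_0_compat; [|apply Rmult_lt_0_compat]; lra).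
  assert (Hm : forall N, fsum N (fun n => r ^ n * m n ^ 2) <= X / lam).
  { intros N. apply Rmult_le_reg_l with lam; [exact Hl|].
    replace (lam * (X / lam)) with X by (field; lra). apply Rle_trans with (2 := HlX).
    apply Rle_trans with (2 := Hlim N). rewrite <- fsum_scal.
    destruct N as [|N]; [simpl; lra|]. apply fsum_le. intros n _.
    apply Rle_trans with (u n O).
    - unfold u. rewrite Hw. unfold m. lra.
    - apply (fsum_term_le (S N) 0 (u n)); [apply Hu | lia]. }
  set (Q := sqrt (X / lam * (1 / (1 - r)))).
  assert (HQ : forall N, Rabs (fsum N (fun n => r ^ n * m n)) <= Q).
  { intros N. unfold Q. rewrite <- sqrt_Rsqr_abs. apply sqrt_le_1_alt.
    unfold Rsqr. replace (fsum N (fun n => r ^ n * m n) * fsum N (fun n => r ^ n * m n))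
      with (fsum N (fun n => r ^ n * m n) ^ 2) by ring.
    eapply Rle_trans; [apply (cauchy_schwarz_fsum N (fun n => r ^ n) m)|].
    - intros n. apply pow_le. lra.
    - apply Rmult_le_compat; [| | apply Hm | apply Hgeo]; apply fsum_nonneg; intros n _;
      [apply Rmult_le_pos; [apply pow_le; lra | apply pow2_ge_0] | apply pow_le; lra]. }
  destruct (first_cell_mass b r Q Hb Hr HQ) as (k & phi & Hk & B & I).
  assert (D := Hdeg r k phi Hr Hk B).
  assert (HQ0 : 0 <= Q) by apply sqrt_pos.
  assert (Hrho : 0 < Cmod (rho phi)).
  { apply Cmod_gt_0. apply (stable_mode_rho_neq_0 (RtoC r) k phi); try assumption.
    - intros Z. apply RtoC_inj in Z. lra.
    - rewrite Cmod_R, Rabs_pos_eq; lra. }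
  apply Rmult_le_compat_l with (r := Q) in D; [|exact HQ0].
  assert (I2 : r / (1 - r) <= Q * (c * (1 - r))).
  { apply Rmult_le_reg_r with (Cmod (rho phi)); [exact Hrho|]. lra. }
  assert (I3 : r <= Q * (c * (1 - r) ^ 2)).
  { apply Rmult_le_compat_r with (r := 1 - r) in I2; [|lra].
    replace (r / (1 - r) * (1 - r)) with r in I2 by (field; lra). lra. }
  assert (I4 : r ^ 2 <= Q ^ 2 * (c * (1 - r) ^ 2) ^ 2).
  { rewrite <- Rpow_mult_distr. apply pow_incr. lra. }
  unfold Q in I4. rewrite pow2_sqrt in I4.
  2:{ apply Rmult_le_pos; apply Rlt_le, Rdiv_lt_0_compat; lra. }
  replace (X / lam * (1 / (1 - r)) * (c * (1 - r) ^ 2) ^ 2)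
    with (2 * K * c ^ 2 * ((1 - r) * (1 - r)) / (alpha * lam)) in I4 by (unfold X; field; lra).
  assert (I5 : r ^ 2 * (alpha * lam) <= 2 * K * c ^ 2 * ((1 - r) * (1 - r))).
  { apply Rmult_le_compat_r with (r := alpha * lam) in I4; [|apply Rlt_le, Rmult_lt_0_compat; lra].
    replace (2 * K * c ^ 2 * ((1 - r) * (1 - r)) / (alpha * lam) * (alpha * lam))
      with (2 * K * c ^ 2 * ((1 - r) * (1 - r))) in I4 by (field; lra). exact I4. }
  assert (I6 : (1 - r) * (1 - r) <= 2 * alpha * (2 * alpha)) by (apply Rmult_le_compat; lra).
  assert (HKc2 : 0 < 2 * K * c ^ 2) by lra.
  apply Rmult_le_compat_l with (r := 2 * K * c ^ 2) in I6; [|lra].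
  assert (I7 : r ^ 2 * lam <= 8 * K * c ^ 2 * alpha).
  { apply Rmult_le_reg_r with alpha; [exact Ha|]. lra. }
  assert (1 / 4 <= r ^ 2) by nra.
  nra.
Qed.

(** For [Cr < 0] every limit of stable roots lies strictly inside the unit disc. Dividing the mass
    balance by [1 - k] then shows that the bounce-back residual is of order [1 - w]. *)
Lemma stable_root_away_from_1 :
  Cr < 0 -> exists c, 0 < c /\ forall w k, Cmod w < 1 -> Cmod k < 1 -> disp w k = 0 ->
    c <= Cmod (1 - k).
Proof.
  intros HC. apply NNPP. intros N.
  assert (S : forall n : nat, exists wk : C * C, Cmod (fst wk) < 1 /\ Cmod (snd wk) < 1 /\
    disp (fst wk) (snd wk) = 0 /\ Cmod (snd wk - 1) <= / (INR n + 1)).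
  { intros n. apply NNPP. intros N2. apply N. exists (/ (INR n + 1)).
    split; [apply inv_INR_pos|].
    intros w k Hw Hk E. apply Rnot_lt_le. intros L. apply N2. exists (w, k). simpl.
    repeat split; try assumption.
    replace (k - 1)%C with (- (1 - k))%C by ring. rewrite Cmod_opp. lra. }
  destruct (choice_sequence _ S) as [u Hu]. cbv beta in Hu.
  clear S N.
  assert (Lk : Clim (fun n => snd (u n)) 1).
  { apply Clim_of_Cmod. apply is_lim_seq_le_le with (fun _ => 0) (fun n => / (INR n + 1)).
    - intros n. split; [apply Cmod_ge_0 | apply Hu].
    - apply is_lim_seq_const.
    - apply is_lim_seq_inv_INR. }
  destruct (bounded_extraction (fun n => fst (u n)) 1) as (psi & l & Hpsi & Ll).
  { intros n. apply Rlt_le, Hu. }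
  destruct (stable_limit (fun n => fst (u (psi n))) (fun n => snd (u (psi n))) l 1)
    as (_ & _ & [P | (_ & _ & P)]).
  - intros n. repeat split; apply (Hu (psi n)).
  - exact Ll.
  - apply (Clim_extraction (fun n => snd (u n))); assumption.
  - rewrite Cmod_1 in P. lra.
  - lra.
Qed.

Lemma bounce_back_not_SSOO (lam : R) : 0 < lam -> Cr < 0 -> ~ SSOO_estimate lam Cr s2 s3 BounceBack.
Proof.
  intros Hl HC. destruct (stable_root_away_from_1 HC) as (c & Hc & H).
  apply (degenerate_resid_not_SSOO lam (/ c)); try exact I; try assumption.
  { apply Rinv_0_lt_compat, Hc. }
  intros r k phi Hr Hk B.
  assert (Hw : Cmod (RtoC r) < 1) by (rewrite Cmod_R, Rabs_pos_eq; lra).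
  assert (HD := H _ _ Hw Hk (bulk_w_disp _ _ _ (Rlt_le _ _ Hw) B)).
  assert (E := f_equal Cmod (resid_bounce_back _ _ _ B)). rewrite !Cmod_mult in E.
  rewrite <- RtoC_minus, Cmod_R, Rabs_pos_eq in E by lra.
  apply Rmult_le_reg_l with c; [exact Hc|].
  replace (c * (/ c * (1 - r) * Cmod (rho phi))) with ((1 - r) * Cmod (rho phi)) by (field; lra).
  rewrite <- E. apply Rmult_le_compat_r; [apply Cmod_ge_0 | exact HD].
Qed.

(* The residual of the extrapolation condition vanishes like (1 - k)^sigma, while
   1 - k is controlled by 1 - w through the bounce-back residual. *)
Lemma extrapolation_not_SSOO (lam : R) (sigma : nat) :
  0 < lam -> 0 < Cr -> (1 <= sigma <= 4)%nat ->
  ~ SSOO_estimate lam Cr s2 s3 (Extrapolation sigma).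
Proof.
  intros Hl HC Hs.
  destruct (uniform_kreiss_lopatinskii BounceBack HC) as (cb & Hcb & HB).
  destruct (uniform_kreiss_lopatinskii TwoStepsAntiBounceBack Logic.I) as (ct & Hct & HT).
  apply (degenerate_resid_not_SSOO lam (8 * (/ cb * / ct))); try exact Hs; try assumption.
  { apply Rmult_lt_0_compat; [lra|]. apply Rmult_lt_0_compat; apply Rinv_0_lt_compat; assumption. }
  intros r k phi Hr Hk B.
  assert (Hw : Cmod (RtoC r) < 1) by (rewrite Cmod_R, Rabs_pos_eq; lra).
  assert (E := f_equal Cmod (resid_bounce_back _ _ _ B)). rewrite !Cmod_mult in E.
  rewrite <- RtoC_minus, Cmod_R, Rabs_pos_eq in E by lra.
  assert (B1 := HB _ _ _ Hw Hk B). assert (T1 := HT _ _ _ Hw Hk B).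
  rewrite (resid_two_steps _ _ _ B) in T1.
  rewrite (resid_extrapolation _ _ _ _ Hs B), Cmod_mult, Cmod_pow.
  assert (Nphi := norm1_pos phi (proj1 B)).
  assert (Hrho := Cmod_rho_le phi).
  assert (K1 : Cmod (1 - k) <= / cb * (1 - r)).
  { apply Rmult_le_reg_l with cb; [exact Hcb|].
    replace (cb * (/ cb * (1 - r))) with (1 - r) by (field; lra).
    apply Rmult_le_reg_r with (norm1 phi); [exact Nphi|].
    apply Rle_trans with (Cmod (1 - k) * (cb * norm1 phi)); [lra|].
    apply Rle_trans with (Cmod (1 - k) * Cmod (resid BounceBack (RtoC r) k phi)).
    - apply Rmult_le_compat_l; [apply Cmod_ge_0 | exact B1].
    - rewrite E. apply Rmult_le_compat_l; lra. }
  assert (K2 : Cmod (1 - k) <= 2).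
  { eapply Rle_trans; [apply Cmod_minus_le; apply Rle_refl|]. rewrite Cmod_1. lra. }
  assert (D2 : Cmod (d2 phi) <= / ct * Cmod (rho phi)).
  { apply Rmult_le_reg_l with ct; [exact Hct|].
    replace (ct * (/ ct * Cmod (rho phi))) with (Cmod (rho phi)) by (field; lra).
    apply Rle_trans with (2 := T1). apply Rmult_le_compat_l; [lra|].
    unfold norm1. pose proof (Cmod_ge_0 (d1 phi)). pose proof (Cmod_ge_0 (d3 phi)). lra. }
  (* One factor is kept to be small; the other [sigma - 1 <= 3] factors are at most 2 each. *)
  assert (K3 : Cmod (1 - k) ^ sigma <= 8 * Cmod (1 - k)).
  { destruct sigma as [|s]; [lia|]. simpl. rewrite Rmult_comm.
    apply Rmult_le_compat_r; [apply Cmod_ge_0|].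
    apply Rle_trans with (2 ^ s); [apply pow_incr; split; [apply Cmod_ge_0 | exact K2]|].
    replace 8 with (2 ^ 3) by ring. apply Rle_pow; [lra | lia]. }
  apply Rle_trans with (8 * (/ cb * (1 - r)) * (/ ct * Cmod (rho phi))); [|right; ring].
  apply Rmult_le_compat; [apply pow_le, Cmod_ge_0 | apply Cmod_ge_0 | | exact D2].
  apply Rle_trans with (1 := K3). lra.
Qed.

(** Stable roots have accumulation points as [z] tends to 1, and [stable_limit] confines these to
    the candidates in the hypothesis. A single candidate therefore means convergence. *)
Lemma stable_root_limit_at_1 (kappa : C) :
  (forall m, disp 1 m = 0 -> Cmod m < 1 \/ m = 1 /\ 0 < Cr -> m = kappa) ->
  stable_root_limit Cr s2 s3 1 kappa.
Proof.
  intros Huniq eps Heps.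
  assert (Hinv : forall z : C, 1 < Cmod z -> z <> 0 /\ Cmod (/ z) < 1).
  { intros z Hz. assert (Hz0 : z <> 0) by (apply Cmod_gt_0; lra). split; [exact Hz0|].
    rewrite Cmod_inv by exact Hz0. rewrite <- Rinv_1. apply Rinv_lt_contravar; lra. }
  assert (Hex : forall z : C, 1 < Cmod z -> exists k, Cmod k < 1 /\ bulk_root Cr s2 s3 z k).
  { intros z Hz. destruct (Hinv z Hz) as [Hz0 Hw].
    destruct (stable_split (/ z) Hw) as (k & v & Hk & _ & Hs).
    exists k. split; [exact Hk|].
    destruct (bulk_w_exists (/ z) k (Rlt_le _ _ Hw)) as [phi B].
    - rewrite (is_split_disp _ _ _ _ Hs). ring.
    - exists phi. apply bulk_w_iff; assumption. }
  apply NNPP. intros N.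
  assert (S : forall n : nat, exists zk : C * C,
    1 < Cmod (fst zk) /\ Cmod (fst zk - 1) < / (INR n + 1) /\ Cmod (snd zk) < 1 /\
    bulk_root Cr s2 s3 (fst zk) (snd zk) /\ eps <= Cmod (snd zk - kappa)).
  { intros n. apply NNPP. intros N2. apply N. exists (/ (INR n + 1)).
    split; [apply inv_INR_pos|].
    intros z Hz Hd. split; [apply Hex, Hz|]. intros k Hk Hb.
    apply Rnot_le_lt. intros L. apply N2. exists (z, k). simpl. repeat split; assumption. }
  destruct (choice_sequence _ S) as [u Hu]. cbv beta in Hu.
  clear S N.
  set (w := fun n => (/ fst (u n))%C).
  assert (Lw : Clim w 1).
  { apply Clim_of_Cmod. apply is_lim_seq_le_le with (fun _ => 0) (fun n => / (INR n + 1)).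
    - intros n. split; [apply Cmod_ge_0|]. destruct (Hu n) as (Hz & Hd & _).
      destruct (Hinv _ Hz) as [Hz0 Hw].
      replace (w n - 1)%C with (/ fst (u n) * - (fst (u n) - 1))%C by (unfold w; field; exact Hz0).
      rewrite Cmod_mult, Cmod_opp. pose proof (Cmod_ge_0 (fst (u n) - 1)). nra.
    - apply is_lim_seq_const.
    - apply is_lim_seq_inv_INR. }
  destruct (bounded_extraction (fun n => snd (u n)) 1) as (psi & m & Hpsi & Lk).
  { intros n. apply Rlt_le, Hu. }
  destruct (stable_limit (fun n => w (psi n)) (fun n => snd (u (psi n))) 1 m) as (_ & E & P).
  - intros n. destruct (Hu (psi n)) as (Hz & _ & Hk & (phi & B) & _).
    destruct (Hinv _ Hz) as [Hz0 Hw]. split; [exact Hw|]. split; [exact Hk|].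
    apply (bulk_w_disp _ _ phi (Rlt_le _ _ Hw)). apply bulk_w_iff; assumption.
  - apply (Clim_extraction w); assumption.
  - exact Lk.
  - assert (Em : m = kappa) by (apply Huniq; [exact E | tauto]).
    assert (L : Rbar_le eps (Cmod (m - kappa))).
    { apply (is_lim_seq_le (fun _ => eps) (fun n => Cmod (snd (u (psi n)) - kappa))).
      - intros n. apply (Hu (psi n)).
      - apply is_lim_seq_const.
      - apply (Clim_Cmod (fun n => snd (u (psi n)) - kappa)%C).
        apply Clim_minus; [exact Lk | apply Clim_const]. }
    simpl in L. rewrite Em in L. replace (kappa - kappa)%C with (RtoC 0) in L by ring.
    rewrite Cmod_0 in L. lra.
Qed.

Lemma bulk_mode_at_1 (k : C) (phi : CF3) : bulk_mode Cr s2 s3 1 k phi -> bulk_w 1 k phi.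
Proof.
  intros H. apply bulk_w_iff in H; [|apply C1_nz].
  replace (/ 1)%C with (RtoC 1) in H by (field; apply C1_nz). exact H.
Qed.

Lemma bounce_back_critical_mode :
  Cr < 0 -> exists kappa, critical_mode Cr s2 s3 BounceBack 1 kappa /\ Cmod kappa < 1.
Proof.
  intros HC. destruct (adm_s2 Hadm). destruct (adm_s3 Hadm).
  (* [x] solves [(1 + k) (1 - pX) pU + (1 - k) (1 + pY) pV = 0], the condition found in
     [stable_mode_bounce_back], after division by [s3 Cr]. *)
  set (den := (2 - s2) * Cr - s2).
  assert (Hden : den < 0) by (unfold den; nra).
  set (x := ((2 - s2) * Cr + s2) / den).
  assert (Hx : Rabs x < 1).
  { assert (Ex : x * den = (2 - s2) * Cr + s2) by (unfold x; field; lra).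
    apply Rabs_def1; unfold den in *; nra. }
  (* At [w = 1] bounce-back makes the relaxation exchange the moving populations 1 and [x]. So
     [m3 = 1 + x] is unchanged, hence at equilibrium, which fixes the mass to [(1 + x) / Cr ^ 2]. *)
  set (f := mkF3 ((1 + x) / Cr ^ 2 - 1 - x) 1 x).
  assert (Rf : relax Cr s2 s3 f = mkF3 (c1 f) x 1).
  { unfold relax, f; cbn [c1 c2 c3]. unfold x, den in *. f_equal; field; split; lra. }
  assert (Bm : bulk_mode Cr s2 s3 1 (RtoC x) (toC f)).
  { unfold bulk_mode. rewrite toC_relax, Rf. split.
    - intros E. apply (f_equal d2) in E. simpl in E. apply C1_nz, E.
    - unfold toC; cbn [d1 d2 d3 c1 c2 c3 f]. split; [ring|]. split; ring. }
  assert (Bw := bulk_mode_at_1 _ _ Bm).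
  exists (RtoC x). split; [|rewrite Cmod_R; exact Hx].
  split; [apply Cmod_1|]. split.
  - apply stable_root_limit_at_1. intros m Em [Hm | [_ Hp]]; [|lra].
    assert (HC1 : Cmod 1 <= 1) by (rewrite Cmod_1; lra).
    assert (E0 := bulk_w_disp _ _ _ HC1 Bw).
    assert (Hsol : forall y : C, Cmod y < 1 -> disp 1 y = 0 -> (qa 1 * y)%C = qc 1).
    { intros y Hy E. rewrite (is_split_disp _ _ _ _ is_split_at_1) in E.
      apply Cmult_eq_0 in E. destruct E as [E|E].
      - exfalso. apply Ceq_minus in E. rewrite E, Cmod_1 in Hy. lra.
      - apply Ceq_minus, E. }
    apply (Cmult_cancel_l (qa 1)).
    + intros Z. assert (N := split_at_1_neg HC). rewrite Z, Cmod_0 in N.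
      pose proof (Cmod_ge_0 (qc 1)). lra.
    + rewrite (Hsol m Hm Em), (Hsol (RtoC x)); [reflexivity | | exact E0].
      rewrite Cmod_R. exact Hx.
  - exists (toC f). split; [exact Bm|]. rewrite toC_relax, Rf. simpl. ring.
Qed.

Lemma extrapolation_critical_mode (sigma : nat) :
  0 < Cr -> (1 <= sigma <= 4)%nat -> critical_mode Cr s2 s3 (Extrapolation sigma) 1 1.
Proof.
  intros HC Hs. split; [apply Cmod_1|]. split.
  - apply stable_root_limit_at_1. intros m Em [Hm | [E _]]; [|exact E].
    apply (stable_root_unique 1 1 (qc 1)); [apply split_at_1_pos, HC | apply is_split_at_1 | lra | exact Em].
  (* The equilibrium of unit mass, constant in space and time. *)
  - set (f := mkF3 (1 - Cr ^ 2) ((Cr ^ 2 + Cr) / 2) ((Cr ^ 2 - Cr) / 2)).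
    assert (Rf : relax Cr s2 s3 f = f)
      by (unfold relax, f; cbn [c1 c2 c3]; f_equal; field).
    assert (Bm : bulk_mode Cr s2 s3 1 1 (toC f)).
    { unfold bulk_mode. rewrite toC_relax, Rf. split; [|split; [|split]; ring].
      intros E. apply (f_equal d2) in E. simpl in E. apply RtoC_inj in E.
      pose proof (pow_lt Cr 2 HC). simpl in *. lra. }
    exists (toC f). split; [exact Bm|].
    assert (E := resid_extrapolation sigma 1 1 (toC f) Hs (bulk_mode_at_1 _ _ Bm)).
    unfold resid in E.
    apply Ceq_minus. transitivity (d2 (toC f) - 1 *
        ghostC (Extrapolation sigma) 1 (relaxC Cr s2 s3 (toC f)))%C; [ring|].
    rewrite E. destruct sigma as [|s]; [lia|].
    change ((1 - 1) ^ S s)%C with ((1 - 1) * (1 - 1) ^ s)%C. ring.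
Qed.

End Admissible.
End Symbol.

Theorem mainTheorem7 (lam Cr s2 s3 : R) :
  0 < lam ->
  ((-1 < Cr < 0) \/ (0 < Cr < 1)) ->
  0 < s2 < 2 -> 0 < s3 < 2 -> s3 <= s3star s2 ->
  (Cr < 0 ->
     label_MU_L lam Cr s2 s3 BounceBack /\
     label_SS lam Cr s2 s3 AntiBounceBack /\
     label_SS lam Cr s2 s3 TwoStepsAntiBounceBack /\
     (forall sigma : nat, (1 <= sigma <= 4)%nat ->
        label_SS lam Cr s2 s3 (Extrapolation sigma)) /\
     label_SS lam Cr s2 s3 KineticDirichlet) /\
  (0 < Cr ->
     label_SS lam Cr s2 s3 BounceBack /\
     label_SS lam Cr s2 s3 AntiBounceBack /\
     label_SS lam Cr s2 s3 TwoStepsAntiBounceBack /\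
     (forall sigma : nat, (1 <= sigma <= 4)%nat ->
        label_MU_E lam Cr s2 s3 (Extrapolation sigma)) /\
     label_SS lam Cr s2 s3 KineticDirichlet).
Proof.
  intros Hl HCr H2 H3 Hs.
  destruct (s3star_henon s2 s3 H2 H3 Hs) as (_ & _ & Hst).
  assert (Hadm : admissible Cr s2 s3) by (constructor; try assumption; lra).
  assert (SS : forall b, well_posed Cr b -> label_SS lam Cr s2 s3 b)
    by (intros b; apply well_posed_SS; assumption).
  split; intros HC.
  - split; [split; [|split]|].
    + intros S. apply (bounce_back_not_SSOO Cr s2 s3 Hadm lam Hl HC).
      apply SS_estimate_SSOO; assumption.
    + apply (bounce_back_not_SSOO Cr s2 s3 Hadm lam Hl HC).
    + exists (RtoC 1). apply (bounce_back_critical_mode Cr s2 s3 Hadm HC).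
    + split; [apply SS; exact Logic.I|]. split; [apply SS; exact Logic.I|].
      split; [|apply SS; exact Logic.I].
      intros sigma Hsigma. apply SS. split; assumption.
  - split; [apply SS; exact HC|].
    split; [apply SS; exact Logic.I|]. split; [apply SS; exact Logic.I|].
    split; [|apply SS; exact Logic.I].
    intros sigma Hsigma. assert (N := extrapolation_not_SSOO Cr s2 s3 Hadm lam sigma Hl HC Hsigma).
    split; [|split; [exact N|]].
    + intros S. apply N, SS_estimate_SSOO; assumption.
    + exists (RtoC 1), (RtoC 1). split; [|apply Cmod_1].
      apply extrapolation_critical_mode; assumption.
Qed.
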